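(* Let $n\in\{2,3\}$ and $G>0$. Let $\rho_0\in L^1(\mathbb{T}^n)$ with $\rho_0\ge0$ (void regions allowed) and $\vec u_0\in L^\infty(\mathbb{T}^n)^n$. Let $\rho_{0,\epsilon}\in\mathcal{C}(\mathbb{T}^n)$, $\vec u_{0,\epsilon}\in\mathcal{C}(\mathbb{T}^n)^n$, $\epsilon\in(0,1]$, satisfy $\rho_{0,\epsilon}(x)>0$ for all $x\in\mathbb{T}^n$, $\|\rho_0-\rho_{0,\epsilon}\|_{L^1(\mathbb{T}^n)}\to0$ and $\|\vec u_0-\vec u_{0,\epsilon}\|_{L^\infty(\mathbb{T}^n)}\to0$ as $\epsilon\to0$. Let $\phi\in\mathcal{C}_c^\infty(\mathbb{R}^n)$ with $\phi\ge0$ and $\int\phi=1$, let $0<\alpha<1$, and set $\phi_{\epsilon^\alpha}(x)=\epsilon^{-n\alpha}\phi(x/\epsilon^\alpha)$. For each $\epsilon$ consider the system of ODEs, with unknowns $\rho>0$ and $\rho\vec u=(\rho u_1,\dots,\rho u_n)$, $$\frac{d}{dt}\rho(x,t,\epsilon)=\frac1\epsilon\sum_{k=1}^n\big[(\rho u_k^+)(x-\epsilon e_k,t,\epsilon)-(\rho|u_k|)(x,t,\epsilon)+(\rho u_k^-)(x+\epsilon e_k,t,\epsilon)\big],$$ and, for $j=1,\dots,n$, $$\begin{aligned}\frac{d}{dt}(\rho u_j)(x,t,\epsilon)=\frac1\epsilon\sum_{k=1}^n\big[(\rho u_ju_k^+)(x-\epsilon e_k,t,\epsilon)-(\rho u_j|u_k|)(x,t,\epsilon)+(\rho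 u_ju_k^-)(x+\epsilon e_k,t,\epsilon)\big]&\\-\rho(x,t,\epsilon)\,\frac{\partial\Phi_\epsilon}{\partial x_j}(x,t),&\end{aligned}$$ complemented by $u_j=(\rho u_j)/\rho$ and by the regularized Poisson equation $$\Delta\Phi_\epsilon=4\pi G\,(\rho_\epsilon*\phi_{\epsilon^\alpha}),\qquad \rho_\epsilon=\rho(\cdot,t,\epsilon),$$ where $\Phi_\epsilon$ is its solution given by the classical Newtonian potential, with initial conditions $\rho(\cdot,0,\epsilon)=\rho_{0,\epsilon}$, $(\rho\vec u)(\cdot,0,\epsilon)=\rho_{0,\epsilon}\vec u_{0,\epsilon}$. Then, for $\alpha>0$ chosen small enough, this system provides a weak asymptotic method, global in space and in positive time, for the $n$-dimensional system of self-gravitating pressureless fluids $$\frac{\partial\rho}{\partial t}+\vec\nabla\cdot(\rho\vec u)=0,\qquad\frac{\partial}{\partial t}(\rho\vec u)+\vec\nabla\cdot(\rho\vec u\otimes\vec u)+\rho\vec\nabla\Phi=\vec0,\qquad\Delta\Phi=4\pi G\rho .$$ That is, the system of ODEs has for each $\epsilon$ a solution defined for all $t\in[0,+\infty)$, and for every $\psi\in\mathcal{C}_c^\infty(\mathbb{R}^n)$, every $t\in[0,+\infty)$ and every $j=1,\dots,n$, as $\epsilon\to0^+$, $$\int_{\mathbb{R}^n}\Big(\frac{\partial\rho}{\partial t}\psi-\rho\,\vec u\cdot\vec\nabla\psi\Big)dx\to0,$$ $$\int_{\mathbb{R}^n}\Big(\frac{\partial(\rho u_j)}{\partial t}\psi-\rho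 u_j\,\vec u\cdot\vec\nabla\psi+\rho\,\frac{\partial\Phi_\epsilon}{\partial x_j}\psi\Big)dx\to0,$$ $$\int_{\mathbb{R}^n}\big(\Delta\Phi_\epsilon-4\pi G\rho\big)\psi\,dx\to0,$$ all functions being evaluated at $(x,t,\epsilon)$.
   Context: $\mathbb{T}^n=\mathbb{R}^n/(2\pi\mathbb{Z})^n$; functions on $\mathbb{T}^n$ are identified with functions on $\mathbb{R}^n$ that are $2\pi$-periodic in each variable. $\mathcal{C}(\mathbb{T}^n)$ is the Banach space of continuous real-valued functions on $\mathbb{T}^n$ with the sup norm. $(e_k)$ is the standard basis of $\mathbb{R}^n$. For a real function $f$, $f^+=\max(0,f)$, $f^-=\max(0,-f)$. $G$ is the gravitation constant. The classical Newtonian potential of a continuous density $\sigma$ (here $\sigma=\rho_\epsilon*\phi_{\epsilon^\alpha}$) is $\Phi(x)=G\int_{\mathbb{T}^2}\sigma(\xi)\log(|x-\xi|^2)\,d\xi$ for $n=2$ and $\Phi(x)=-G\int_{\mathbb{T}^3}\sigma(\xi)\,|x-\xi|^{-1}d\xi$ for $n=3$, where points of $\mathbb{T}^n$ are represented in $[-\pi,\pi)^n$; in the last displayed integral of the claim, $\Delta\Phi_\epsilon$ is the function $4\pi G(\rho_\epsilon*\phi_{\epsilon^\alpha})$. A solution of the ODE system on $[0,+\infty)$ is a continuously differentiable map $t\mapsto(\rho,\rho\vec u)(\cdot,t,\epsilon)$ from $[0,+\infty)$ (right-hand derivative at $t=0$) to $\mathcal{C}(\mathbb{T}^n)^{n+1}$,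 with $\rho>0$. A weak asymptotic method for a system of PDEs is a family of functions, indexed by $\epsilon$ and differentiable in $t$, which satisfies the equations in the sense of distributions in the space variables, for each $t$, up to a remainder tending to $0$ as $\epsilon\to0^+$. *)

(* Defs.v *)
From HB Require Import structures.
From mathcomp Require Import all_boot all_order all_algebra.
From mathcomp Require Import all_classical all_reals all_analysis.

Set Implicit Arguments.
Unset Strict Implicit.
Unset Printing Implicit Defensive.

Import Order.TTheory GRing.Theory Num.Theory.
Import numFieldNormedType.Exports.

Local Open Scope classical_set_scope.
Local Open Scope ring_scope.

(* R^n is 'rV[R]_n; the library has its topology and normed structure, but
   neither a sigma-algebra nor Lebesgue measure on it. *)

Section measurable_rV.
Context {R : realType} (n : nat).

Let coord (i : 'I_n) (x : 'rV[R]_n) : R := x ord0 i.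

Let rV_set0 : g_sigma_preimage coord set0.
Proof. exact: sigma_algebra0. Qed.

Let rV_setC A : g_sigma_preimage coord A -> g_sigma_preimage coord (~` A).
Proof. exact: sigma_algebraC. Qed.

Let rV_bigcup (F : (set 'rV[R]_n)^nat) :
  (forall i, g_sigma_preimage coord (F i)) ->
  g_sigma_preimage coord (\bigcup_i F i).
Proof. exact: sigma_algebra_bigcup. Qed.

(* Same construction as the library's sigma-algebra on [n.-tuple T]: it is
   generated by the coordinates, hence is the Borel sigma-algebra of R^n. *)
HB.instance Definition _ := @isMeasurable.Build default_measure_display
  'rV[R]_n (g_sigma_preimage coord) rV_set0 rV_setC rV_bigcup.

Lemma measurable_coord_rV (i : 'I_n) :
  measurable_fun [set: 'rV[R]_n] (fun x : 'rV[R]_n => x ord0 i : R).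
Proof.
move=> _ Y mY; rewrite setTI; apply: sub_sigma_algebra => /=.
rewrite -bigcup_seq/=; exists i => /=; first by rewrite mem_index_enum.
by exists Y => //; rewrite setTI.
Qed.

Lemma measurable_fun_rVP d (T : measurableType d) (f : T -> 'rV[R]_n) :
  measurable_fun [set: T] f <->
  forall i, measurable_fun [set: T] (fun t => f t ord0 i : R).
Proof.
split=> [mf i|mf].
  exact: (measurableT_comp (measurable_coord_rV i) mf).
apply: (@measurability _ _ _ _ _ f
  (\big[setU/set0]_(i < n) preimage_set_system setT (coord i) measurable)) => //.
move=> _ [C GC <-]; move: GC; rewrite -bigcup_seq => -[i _ [B mB <-]].
by rewrite !setTI; move: (mf i measurableT _ mB); rewrite setTI.
Qed.

End measurable_rV.

Section lebesgue_rV_step.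
Context {R : realType} (n : nat).
Variable mu : {sigma_finite_measure set 'rV[R]_n -> \bar R}.

Definition consr (p : measurableTypeR R * 'rV[R]_n) : 'rV[R]_n.+1 :=
  \row_i oapp (p.2 ord0) (p.1 : R) (unlift ord0 i).

Lemma consr0 p : consr p ord0 ord0 = p.1.
Proof. by rewrite mxE unlift_none. Qed.

Lemma consrS p i : consr p ord0 (lift ord0 i) = p.2 ord0 i.
Proof. by rewrite mxE liftK. Qed.

Lemma measurable_consr : measurable_fun [set: _] consr.
Proof.
apply/measurable_fun_rVP => i; have [j ->|->] := unliftP ord0 i.
  under eq_fun do rewrite consrS.
  exact: (measurableT_comp (measurable_coord_rV j) measurable_snd).
by under eq_fun do rewrite consr0; exact: measurable_fst.
Qed.

Definition unconsr (x : 'rV[R]_n.+1) : measurableTypeR R * 'rV[R]_n :=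
  (x ord0 ord0, \row_i x ord0 (lift ord0 i)).

Lemma consrK : cancel consr unconsr.
Proof.
move=> p; rewrite /unconsr consr0 [p in RHS]surjective_pairing; congr pair.
by apply/rowP => i; rewrite mxE consrS.
Qed.

Lemma unconsrK : cancel unconsr consr.
Proof.
move=> x; apply/rowP => i; have [j ->|->] := unliftP ord0 i.
  by rewrite consrS mxE.
by rewrite consr0.
Qed.

Lemma measurable_unconsr : measurable_fun [set: _] unconsr.
Proof.
apply: measurable_fun_pair; first exact: measurable_coord_rV.
apply/measurable_fun_rVP => i.
by under eq_fun do rewrite mxE; exact: measurable_coord_rV.
Qed.

Definition lebesgue_rVS : set 'rV[R]_n.+1 -> \bar R :=
  pushforward (@lebesgue_measure R \x mu)%E consr.

Let lebesgue_rVS0 : lebesgue_rVS set0 = 0%E.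
Proof. by rewrite /lebesgue_rVS /pushforward preimage_set0 measure0. Qed.

Let lebesgue_rVS_ge0 A : (0 <= lebesgue_rVS A)%E.
Proof. exact: (measure_ge0 (@lebesgue_measure R \x mu)%E). Qed.

Let lebesgue_rVS_sigma_additive : semi_sigma_additive lebesgue_rVS.
Proof.
by apply: measure_semi_sigma_additive => //; exact: measurable_consr.
Qed.

HB.instance Definition _ := isMeasure.Build _ _ _ lebesgue_rVS
  lebesgue_rVS0 lebesgue_rVS_ge0 lebesgue_rVS_sigma_additive.

Let sigma_finite_lebesgue_rVS : sigma_finite setT lebesgue_rVS.
Proof.
have [F FT Foo] : sigma_finite setT (@lebesgue_measure R \x mu)%E.
  have /sigma_finiteP[A [AT ndA Aoo]] := sigma_finiteT (@lebesgue_measure R).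
  have /sigma_finiteP[B [BT ndB Boo]] := sigma_finiteT mu.
  exists (fun k => A k `*` B k).
    rewrite -setXTT AT BT predeqE => -[x y]; split.
      move=> [/= [k _ Akx] [l _ Bly]]; exists (maxn k l) => //; split.
      - by move: x Akx; exact/subsetPset/ndA/leq_maxl.
      - by move: y Bly; exact/subsetPset/ndB/leq_maxr.
    by move=> [k _ []/= ? ?]; split; exists k.
  move=> k; have [? ?] := Aoo k; have [? ?] := Boo k.
  split; first exact: measurableX.
  by rewrite product_measure1E// lte_mul_pinfty// ge0_fin_numE.
have imE k : consr @` F k = unconsr @^-1` F k.
  apply/seteqP; split=> [_ [p Fp <-]/=|x Fx]; first by rewrite consrK.
  by exists (unconsr x) => //; exact: unconsrK.
exists (fun k => consr @` F k).
  apply/seteqP; split=> // x _.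
  have : setT (unconsr x) by [].
  by rewrite FT => -[k _ Fk]; exists k => //; rewrite imE.
move=> k; have [mF Fk] := Foo k; split.
  by rewrite imE -[X in measurable X]setTI; exact: measurable_unconsr.
rewrite /lebesgue_rVS /pushforward imE -comp_preimage.
by rewrite (_ : unconsr \o consr = id) //; apply/funext => p /=; exact: consrK.
Qed.

HB.instance Definition _ := Measure_isSigmaFinite.Build _ _ _ lebesgue_rVS
  sigma_finite_lebesgue_rVS.

End lebesgue_rV_step.

Fixpoint lebesgue_rV (R : realType) (n : nat) :
    {sigma_finite_measure set 'rV[R]_n -> \bar R} :=
  if n is m.+1 then
    [the {sigma_finite_measure set 'rV[R]_m.+1 -> \bar R} of
      lebesgue_rVS (lebesgue_rV R m)]
  else
    [the {sigma_finite_measure set 'rV[R]_0 -> \bar R} of dirac (0 : 'rV[R]_0)].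

Lemma lebesgue_rV_box (R : realType) n (A : 'I_n -> set (measurableTypeR R)) :
  (forall i, measurable (A i)) ->
  lebesgue_rV R n [set x | forall i, A i (x ord0 i)] =
  (\prod_(i < n) lebesgue_measure (A i))%E.
Proof.
elim: n A => [|n IHn] A mA.
  by rewrite big_ord0 /= diracE mem_set// => -[].
have mB : measurable [set x : 'rV[R]_n | forall i, A (lift ord0 i) (x ord0 i)].
  rewrite [X in measurable X](_ : _ = \bigcap_(i in [set: 'I_n])
    ((fun x : 'rV[R]_n => x ord0 i : R) @^-1` A (lift ord0 i))).
    apply: fin_bigcap_measurable => // i _.
    have := measurable_coord_rV i measurableT (mA (lift ord0 i)).
    by rewrite setTI.
  by apply/seteqP; split=> x /= Ax i; [move=> _; exact: Ax|exact: (Ax i)].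
rewrite big_ord_recl -IHn//= -product_measure1E//.
congr product_measure1; apply/seteqP; split=> p /=.
  by move=> Ap; split=> [|i]; [have := Ap ord0|have := Ap (lift ord0 i)];
    rewrite ?consr0 ?consrS.
move=> [Ap1 Ap2] i; have [j ->|->] := unliftP ord0 i.
  by rewrite consrS.
by rewrite consr0.
Qed.

Section torus.
Context {R : realType}.

Definition basis_rV n (k : 'I_n) : 'rV[R]_n := delta_mx ord0 k.

Definition periodic_2pi n (f : 'rV[R]_n -> R) :=
  forall (k : 'I_n) x, f (x + (2 * pi) *: basis_rV k) = f x.

Definition continuous_torus n (f : 'rV[R]_n -> R) := continuous f /\ periodic_2pi f.

Definition cube n : set 'rV[R]_n := [set x | forall i, x ord0 i \in `[- pi, pi[].
Arguments cube : clear implicits.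

Lemma measurable_cube n : measurable (cube n).
Proof.
rewrite (_ : cube n = \bigcap_(i in [set: 'I_n])
  ((fun x : 'rV[R]_n => x ord0 i : R) @^-1` [set` `[- pi, pi[])).
  apply: fin_bigcap_measurable => // i _.
  by rewrite -[X in measurable X]setTI; exact: measurable_coord_rV.
by apply/seteqP; split=> x /= Ax i; [move=> _; exact: Ax|exact: (Ax i)].
Qed.

Arguments measurable_cube : clear implicits.

(* Integration over T^n is integration over the fundamental domain [-pi, pi)^n. *)
Definition torus_measure n : set 'rV[R]_n -> \bar R :=
  mrestr (lebesgue_rV R n) (measurable_cube n).

Arguments torus_measure : clear implicits.

HB.instance Definition _ n := Measure.on (torus_measure n).

(* The representative in [-pi, pi)^n of the class of x modulo (2 pi Z)^n. *)
Definition torus_repr n (x : 'rV[R]_n) : 'rV[R]_n :=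
  \row_i (x ord0 i - 2 * pi * (Num.floor ((x ord0 i + pi) / (2 * pi)))%:~R).

Definition euclid_norm n (x : 'rV[R]_n) : R :=
  Num.sqrt (\sum_(i < n) x ord0 i ^+ 2).

(* Only used for n = 2 and n = 3. *)
Definition newton_kernel n (y : 'rV[R]_n) : R :=
  if (n == 2)%N then ln (euclid_norm y ^+ 2) else - (euclid_norm y)^-1.

(* The difference x - xi of two points of T^n is itself the point of T^n that is
   represented in [-pi, pi)^n, so that Phi is a function on T^n, with continuous
   partial derivatives when sigma is smooth.  (With the distance between the
   separate representatives of x and xi, the partial derivatives of Phi would
   jump across the faces of the cube as soon as sigma > 0.) *)
Definition newton_potential (G : R) n (sigma : 'rV[R]_n -> R) (x : 'rV[R]_n) : R :=
  G * \int[torus_measure n]_xi (sigma xi * newton_kernel (torus_repr (x - xi))).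

Definition mollifier (alpha eps : R) n (phi : 'rV[R]_n -> R) (x : 'rV[R]_n) : R :=
  eps `^ (- (n%:R * alpha)) * phi ((eps `^ alpha)^-1 *: x).

Definition convolution n (f g : 'rV[R]_n -> R) (x : 'rV[R]_n) : R :=
  \int[lebesgue_rV R n]_y (f (x - y) * g y).

Definition partials n (s : seq 'I_n) (f : 'rV[R]_n -> R) : 'rV[R]_n -> R :=
  foldr (fun k g => 'D_(basis_rV k) g) f s.

Definition smooth n (f : 'rV[R]_n -> R) := forall s : seq 'I_n,
  continuous (partials s f) /\
  forall k x, derivable (partials s f) x (basis_rV k).

Definition test_function n (f : 'rV[R]_n -> R) :=
  smooth f /\ compact (closure [set x | f x != 0]).

(* f is a C^1 map from [0, +oo[ to the Banach space C(T^n), with derivative df;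
   convergence in C(T^n) is uniform convergence, and h is restricted so that
   t + h >= 0, which makes the derivative at t = 0 a right-hand one. *)
Definition C1_torus n (f df : R -> 'rV[R]_n -> R) := forall t : R, 0 <= t ->
  [/\ continuous_torus (f t),
      continuous_torus (df t),
      {uniform, (fun (h : R) x => h^-1 * (f (t + h) x - f t x)) @
        within [set h : R | 0 <= t + h] (0 : R)^' --> df t} &
      {uniform, df @ within [set s : R | 0 <= s] (nbhs t) --> df t}].

Section self_gravitating_fluid.
Variables (G alpha : R) (n : nat) (phi : 'rV[R]_n -> R) (eps : R).

Definition velocity (rho : 'rV[R]_n -> R) (m : 'I_n -> 'rV[R]_n -> R)
  (j : 'I_n) (x : 'rV[R]_n) : R := m j x / rho x.

Definition upwind (u : 'I_n -> 'rV[R]_n -> R) (w : 'rV[R]_n -> R)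
    (x : 'rV[R]_n) : R :=
  eps^-1 * \sum_(k < n)
    ((w \* (u k)^\+) (x - eps *: basis_rV k) - w x * `|u k x|
     + (w \* (u k)^\-) (x + eps *: basis_rV k)).

(* The right-hand side of the regularized Poisson equation, i.e. the function
   which is denoted by the Laplacian of Phi_eps. *)
Definition poisson_rhs (rho : 'rV[R]_n -> R) (x : 'rV[R]_n) : R :=
  4 * pi * G * convolution rho (mollifier alpha eps phi) x.

Definition potential (rho : 'rV[R]_n -> R) : 'rV[R]_n -> R :=
  newton_potential G (convolution rho (mollifier alpha eps phi)).

(* rho t x and m t j x stand for rho(x, t, eps) and (rho u_j)(x, t, eps). *)
Record is_solution (rho0 : 'rV[R]_n -> R) (u0 : 'I_n -> 'rV[R]_n -> R)
    (rho drho : R -> 'rV[R]_n -> R) (m dm : R -> 'I_n -> 'rV[R]_n -> R) : Prop := {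
  solution_rho_C1 : C1_torus rho drho ;
  solution_m_C1 : forall j, C1_torus (m ^~ j) (dm ^~ j) ;
  solution_rho_gt0 : forall (t : R) x, 0 <= t -> 0 < rho t x ;
  solution_potential_derivable : forall (t : R) j x, 0 <= t ->
    derivable (potential (rho t)) x (basis_rV j) ;
  solution_rho_eq : forall (t : R) x, 0 <= t ->
    drho t x = upwind (velocity (rho t) (m t)) (rho t) x ;
  solution_m_eq : forall (t : R) j x, 0 <= t ->
    dm t j x = upwind (velocity (rho t) (m t)) (m t j) x
               - rho t x * 'D_(basis_rV j) (potential (rho t)) x ;
  solution_rho_init : forall x, rho 0 x = rho0 x ;
  solution_m_init : forall j x, m 0 j x = rho0 x * u0 j x
}.

End self_gravitating_fluid.

End torus.

Arguments torus_measure R n : clear implicits.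

(* Main.v *)
Require Import Defs.
From HB Require Import structures.
From mathcomp Require Import all_boot all_order all_algebra.
From mathcomp Require Import all_classical all_reals all_analysis.
From mathcomp Require Import measurable_realfun ess_sup_inf.
From mathcomp Require Import ring lra.

Set Implicit Arguments.
Unset Strict Implicit.
Unset Printing Implicit Defensive.

Import Order.TTheory GRing.Theory Num.Theory.
Import numFieldNormedType.Exports.

Local Open Scope classical_set_scope.
Local Open Scope ring_scope.

(** Why the scheme has global solutions.  The upwind operator only moves mass
    around ([Rintegral_upwind]), so the mass of the fluid is that of the initial
    density.  In the mollified potential the derivatives fall on the mollifier,
    and the Newtonian kernel is integrable; hence the acceleration is at most
    C = const * eps^(-(n+1) alpha) * mass ([acceleration_bound]).  Under such a
    force the speed cannot exceed V(t) = U0 + C t, where U0 bounds the initial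
    speed: V rho + m_j and V rho - m_j stay nonnegative, since the operator
    transports nonnegative quantities without making them negative
    ([upwind_ge]).  With a bounded speed, the density leaves each cell at a
    bounded rate, so that it decays and grows at most exponentially, and in
    particular remains positive.

    These a priori bounds are turned into existence by truncation.  The system
    in which the density and the momenta are cut off at the bounds has a right-hand
    side that is bounded and Lipschitz continuous on the space of continuous
    functions on the torus, so Picard's iteration solves it for all times
    ([ode_solution]).  The a priori estimates are then proved for the truncated
    system, pointwise in x, by a comparison principle for scalar functions
    ([comparison]); they show that no cut-off is ever active, whence
    [exists_solution].

    Why the scheme is consistent.  Translation invariance of the integral moves
    the differences of the scheme to the test function psi, whose Taylor
    expansion leaves an error of order eps V for the mass and eps V^2 for the
    momentum, times the mass of the fluid ([upwind_weak_error]).  As V is of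
    order eps^(-(n+1) alpha), both errors vanish in the limit as soon as
    2 (n+1) alpha < 1.  In the Poisson equation Fubini's theorem moves the
    mollification to psi and leaves an error of order eps^alpha
    ([mollification_weak_error]).  That the initial masses and velocities are
    bounded uniformly in eps follows from their convergence in L^1 and in
    L^infinity ([mass_bound], [velocity_bound]). *)

(** * Lebesgue measure on R^n *)

Section measure_rV.
Context {R : realType}.
Implicit Types (n : nat).

Lemma measurable_rV_box n (A : 'I_n -> set (measurableTypeR R)) :
  (forall i, measurable (A i)) -> measurable [set x : 'rV[R]_n | forall i, A i (x ord0 i)].
Proof.
move=> mA; rewrite [X in measurable X](_ : _ = \bigcap_(i in [set: 'I_n])
    ((fun x : 'rV[R]_n => x ord0 i : R) @^-1` A i)).
  apply: fin_bigcap_measurable => // i _.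
  by rewrite -[X in measurable X]setTI; exact: (measurable_coord_rV i measurableT (mA i)).
by apply/seteqP; split=> x /= Ax i; [move=> _; exact: Ax|exact: (Ax i)].
Qed.

(** Boxes with rational centre and radius 1/(k+1) form a countable base of the
    topology, and each of them is measurable by construction of the sigma-algebra. *)
Lemma open_rV_measurable n (U : set 'rV[R]_n) : open U -> measurable U.
Proof.
move=> oU.
pose box (p : 'rV[rat]_n * nat) : set 'rV[R]_n :=
  [set x | forall i, `|ratr (p.1 ord0 i) - x ord0 i| < p.2.+1%:R^-1].
pose F p := if `[< box p `<=` U >] then box p else set0.
have -> : U = \bigcup_p F p.
  apply/seteqP; split=> [x Ux|x [p _]]; last first.
    by rewrite /F; case: asboolP => // + bx; exact.
  have /nbhs_ballP[e /= e0 eU] : nbhs x U by exact: open_nbhs_nbhs.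
  have [k ke] : exists k : nat, k.+1%:R^-1 < e / 2.
    have e2 : 0 < e / 2 by rewrite divr_gt0.
    exists (Num.truncn (e / 2)^-1).
    rewrite invf_plt ?posrE//; exact: truncnS_gt.
  have q_ (i : 'I_n) : {q : rat | `|ratr q - x ord0 i| < k.+1%:R^-1}.
    apply: cid; have [] := @rat_in_itvoo R (x ord0 i - k.+1%:R^-1) (x ord0 i + k.+1%:R^-1).
      by rewrite ltrBlDr -addrA ltrDl addr_gt0// invr_gt0.
    move=> q; rewrite in_itv/= => /andP[q1 q2]; exists q.
    by rewrite ltr_distl q1 q2.
  exists (\row_i sval (q_ i), k) => //.
  have xb : box (\row_i sval (q_ i), k) x.
    by move=> i/=; rewrite mxE; case: (q_ i).
  rewrite /F; case: asboolP => // -[] y yb; apply: eU; split=> // i j.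
  rewrite ord1 /ball/=.
  have := xb j; have := yb j => /=; rewrite distrC => h1.
  rewrite distrC => h2.
  rewrite (le_lt_trans (ler_distD (ratr ((\row_i0 sval (q_ i0)) ord0 j)) _ _))//.
  rewrite [e]splitr ltrD// (lt_trans _ ke)//.
apply: countable_bigcupT_measurable => [|p]; first exact: countableP.
rewrite /F; case: asboolP => // _.
apply: (measurable_rV_box (A := fun i => [set t : R | `|ratr (p.1 ord0 i) - t| < p.2.+1%:R^-1])) => i.
set q : R := ratr _; rewrite [X in measurable X](_ : _ =
  [set` `]q - p.2.+1%:R^-1, q + p.2.+1%:R^-1[]); first exact: measurable_itv.
by apply/seteqP; split=> t /=; rewrite in_itv/= distrC ltr_distl.
Qed.

Lemma continuous_rV_measurable n (f : 'rV[R]_n -> R) :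
  continuous f -> measurable_fun setT f.
Proof.
move=> cf; apply: (measurability _ (RGenOpens.measurableE R)).
move=> _ [_ [a [b ->] <-]]; rewrite setTI; apply: open_rV_measurable.
by apply: open_comp => [x _|]; [exact: cf|exact: interval_open].
Qed.

Lemma measurable_rV_affine n (c : R) (a : 'rV[R]_n) :
  measurable_fun setT (fun x : 'rV[R]_n => c *: x + a).
Proof.
apply/measurable_fun_rVP => i.
rewrite (_ : (fun t => _) = fun t : 'rV[R]_n => c * t ord0 i + a ord0 i); last first.
  by apply/funext => t; rewrite !mxE.
apply: measurable_funD; last exact: measurable_cst.
by apply: measurable_funM; [exact: measurable_cst|exact: measurable_coord_rV].
Qed.

Lemma measurable_shift n (f : 'rV[R]_n -> R) (a : 'rV[R]_n) : measurable_fun setT f ->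
  measurable_fun setT (fun x : 'rV[R]_n => f (x + a)).
Proof.
move=> mf; have m1 := measurable_rV_affine 1 a.
rewrite (_ : (fun _ => _) = f \o (fun x : 'rV[R]_n => 1 *: x + a)).
  exact: measurableT_comp.
by apply/funext => x /=; rewrite scale1r.
Qed.

Local Open Scope ereal_scope.

(** Tonelli in the first coordinate; with it, properties of the measure on R^n
    are proved by induction from those on R. *)
Lemma ge0_integral_rVS n (f : 'rV[R]_n.+1 -> \bar R) :
  measurable_fun setT f -> (forall x, 0 <= f x) ->
  \int[lebesgue_rV R n.+1]_x f x =
  \int[@lebesgue_measure R]_s \int[lebesgue_rV R n]_y f (consr (s, y)).
Proof.
move=> mf f0.
rewrite [LHS]/= /lebesgue_rVS.
rewrite [LHS](@ge0_integral_pushforward _ _ _ _ _ _ (@measurable_consr R n)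
  (lebesgue_measure \x lebesgue_rV R n)%E setT f)//.
rewrite preimage_setT.
rewrite (@fubini_tonelli1 _ _ (measurableTypeR R) _ R (@lebesgue_measure R) (lebesgue_rV R n) (f \o @consr R n))//.
  by apply: measurableT_comp => //; exact: measurable_consr.
by move=> x; exact: f0.
Qed.


(** The part of the domain outside [D] is null for the restricted measure, and
    the two measures agree on subsets of [D]. *)
Lemma integral_mrestr d (T : measurableType d) (mu : {measure set T -> \bar R})
    (D : set T) (mD : measurable D) (f : T -> \bar R) :
  measurable_fun setT f ->
  \int[mrestr mu mD]_x f x = \int[mu]_(x in D) f x.
Proof.
wlog f0 : f / forall x, 0 <= f x => [hw mf|mf].
  rewrite [LHS]integralE [RHS]integralE hw ?hw//.
  - exact: measurable_funeneg.
  - exact: measurable_funepos.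
have mDC : measurable (~` D) by exact: measurableC.
have -> : \int[mrestr mu mD]_x f x = \int[mrestr mu mD]_(x in D) f x.
  rewrite -(setUv D) ge0_integral_setU//; last 2 first.
  - by rewrite setUv.
  - by rewrite disj_set2E setICr.
  rewrite [X in _ + X]null_set_integral ?adde0//.
    exact: measurable_funTS.
  by rewrite /= /mrestr setIC setICr measure0.
apply: eq_measure_integral => A mA AD.
by rewrite /= /mrestr setIidl.
Qed.


Lemma measurable_affine1 (c a : R) :
  measurable_fun (setT : set (measurableTypeR R))
    ((fun x => c * x + a)%R : measurableTypeR R -> measurableTypeR R).
Proof. by apply: measurable_funD => //; apply: measurable_funM. Qed.

(** The image of Lebesgue measure under the affine map, scaled by |c|, gives
    intervals their length, hence is Lebesgue measure by uniqueness. *)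
Lemma ge0_integral_affine1 (c a : R) (f : R -> \bar R) : c != 0%R ->
  measurable_fun setT f -> (forall x, 0 <= f x) ->
  \int[@lebesgue_measure R]_x f (c * x + a)%R =
  (`|c|^-1)%:E * \int[@lebesgue_measure R]_x f x.
Proof.
move=> c0 mf f0.
have mg := measurable_affine1 c a.
have cp : (0 <= `|c|)%R by [].
pose pf : {measure set _ -> \bar R} :=
  measure_function_pushforward__canonical__measure_function_Measure
    (@lebesgue_measure R) mg.
have key A : measurable A -> lebesgue_measure A = mscale (NngNum cp) pf A.
  apply: lebesgue_measure_unique => _ [[p q]] _ <-.
  rewrite lebesgue_measure_itv/=.
  have -> : mscale (NngNum cp) pf [set` `]p, q]%R] =
    `|c|%:E * lebesgue_measure [set x : R | (c * x + a)%R \in `]p, q]%R] by [].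
  have [c1|c1|c1] := ltgtP c 0%R; last by rewrite c1 eqxx in c0.
  - rewrite (_ : [set x : R | _] = [set` `[(q - a) / c, (p - a) / c[%R]); last first.
      apply/seteqP; split=> x /=; rewrite !in_itv/=.
        by rewrite ler_ndivrMr// ltr_ndivlMr// mulrC lerBrDr ltrBlDr andbC.
      by rewrite ler_ndivrMr// ltr_ndivlMr// mulrC lerBrDr ltrBlDr andbC.
    rewrite lebesgue_measure_itv/= !lte_fin ltr_ndivrMr// divfK ?lt_eqF//.
    rewrite ltrD2r; case: ifPn => // _; last by rewrite mule0.
    rewrite -!EFinB -EFinM ltr0_norm//; congr EFin.
    by field.
  - rewrite (_ : [set x : R | _] = [set` `](p - a) / c, (q - a) / c]%R]); last first.
      apply/seteqP; split=> x /=; rewrite !in_itv/=.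
        by rewrite ler_pdivlMr// ltr_pdivrMr// mulrC lerBrDr ltrBlDr.
      by rewrite ler_pdivlMr// ltr_pdivrMr// mulrC lerBrDr ltrBlDr.
    rewrite lebesgue_measure_itv/= !lte_fin ltr_pdivrMr// divfK ?gt_eqF//.
    rewrite ltrD2r; case: ifPn => // _; last by rewrite mule0.
    rewrite -!EFinB -EFinM gtr0_norm//; congr EFin.
    by field.
rewrite [X in _ = _ * X](eq_measure_integral (mscale (NngNum cp) pf)); last first.
  by move=> A mA _; exact: key.
rewrite ge0_integral_mscale// muleA -EFinM mulVf ?normr_eq0// mul1e.
by rewrite (ge0_integral_pushforward mg)// preimage_setT.
Qed.

Lemma measurable_integral_consr n (f : 'rV[R]_n.+1 -> \bar R) :
  measurable_fun setT f -> (forall x, 0 <= f x) ->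
  measurable_fun setT
    (fun t : measurableTypeR R => \int[lebesgue_rV R n]_y f (consr (t, y))).
Proof.
move=> mf f0.
have mfC : measurable_fun setT (f \o @consr R n).
  by apply: measurableT_comp => //; exact: measurable_consr.
have fC0 x : 0 <= (f \o @consr R n) x by exact: f0.
have := @measurable_fun_fubini_tonelli_F _ _ _ _ _ (lebesgue_rV R n) _ mfC fC0.
exact.
Qed.

(** By induction on the dimension, one coordinate at a time. *)
Lemma ge0_integral_affine n (c : R) (a : 'rV[R]_n) (f : 'rV[R]_n -> \bar R) :
  c != 0%R -> measurable_fun setT f -> (forall x, 0 <= f x) ->
  \int[lebesgue_rV R n]_x f (c *: x + a)%R =
  (`|c| ^- n)%:E * \int[lebesgue_rV R n]_x f x.
Proof.
elim: n a f => [|n IH] a f c0 mf f0.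
  rewrite expr0 invr1 mul1e; apply: eq_integral => x _; congr (f _).
  by apply/rowP => -[].
have mcons t : measurable_fun setT (fun y : 'rV[R]_n => consr (t, y)).
  apply: (measurableT_comp (@measurable_consr R n)).
  exact: measurable_fun_pair.
have mfc : measurable_fun setT (fun x : 'rV[R]_n.+1 => f (c *: x + a)%R).
  by apply: (measurableT_comp mf); exact: measurable_rV_affine.
have mF := measurable_integral_consr mf f0.
rewrite ge0_integral_rVS//.
have E t : \int[lebesgue_rV R n]_y f (c *: consr (t, y) + a)%R =
    (`|c| ^- n)%:E * \int[lebesgue_rV R n]_y
      f (consr ((c * t + a ord0 ord0)%R, y)).
  rewrite -(IH (\row_i a ord0 (lift ord0 i)) (fun y => f (consr (_, y))))//; last first.
    exact: measurableT_comp.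
  apply: eq_integral => y _; congr (f _); apply/rowP => i.
  have [j ->|->] := unliftP ord0 i; first by rewrite !mxE !liftK/= !mxE.
  by rewrite !mxE !unlift_none.
under eq_integral do rewrite E.
have mFc := measurableT_comp mF (measurable_affine1 c (a ord0 ord0)).
rewrite ge0_integralZl//; last by move=> t _; apply: integral_ge0.
rewrite (ge0_integral_affine1 _ c0 mF); last by move=> t; apply: integral_ge0.
by rewrite -ge0_integral_rVS// muleA -EFinM exprS invfM mulrC.
Qed.

End measure_rV.

(** * Integration of periodic functions *)

Arguments cube {R} n _.

Section periodic.
Context {R : realType}.
Local Open Scope ereal_scope.

Lemma integral_translate n (a : 'rV[R]_n) (f : 'rV[R]_n -> \bar R) :
  measurable_fun setT f ->
  \int[lebesgue_rV R n]_x f (x + a)%R = \int[lebesgue_rV R n]_x f x.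
Proof.
move=> mf.
have ge0E (g : 'rV[R]_n -> \bar R) : measurable_fun setT g -> (forall x, 0 <= g x) ->
    \int[lebesgue_rV R n]_x g (x + a)%R = \int[lebesgue_rV R n]_x g x.
  move=> mg g0; have := ge0_integral_affine a (oner_neq0 R) mg g0.
  rewrite normr1 expr1n invr1 mul1e => <-.
  by apply: eq_integral => x _; rewrite scale1r.
rewrite [LHS]integralE [RHS]integralE; congr (_ - _).
  rewrite -[RHS]ge0E; [|exact: measurable_funepos|exact: funepos_ge0].
  by apply: eq_integral => x _; rewrite !funeposE.
rewrite -[RHS]ge0E; [|exact: measurable_funeneg|exact: funeneg_ge0].
by apply: eq_integral => x _; rewrite !funenegE.
Qed.

Section dimension_one.
Variable f : R -> \bar R.
Hypothesis mf : measurable_fun setT f.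
Hypothesis f0 : forall x, 0 <= f x.
Hypothesis fT : forall x, f (x + 2 * pi)%R = f x.
Let I a b := \int[@lebesgue_measure R]_(x in [set` `[a, b[%R]) f x.

Let I_shift a b : I (a + 2 * pi)%R (b + 2 * pi)%R = I a b.
Proof.
rewrite /I integral_mkcond [RHS]integral_mkcond.
have := @ge0_integral_affine1 R 1%R (2 * pi)%R
  (f \_ [set` `[(a + 2 * pi)%R, (b + 2 * pi)%R[%R]) (oner_neq0 _).
rewrite normr1 invr1 mul1e => <-.
- apply: eq_integral => x _; rewrite /patch mul1r.
  rewrite fT; congr (if _ then _ else _).
  by rewrite !mem_setE !in_itv/= lerD2r ltrD2r.
- by apply/(measurable_restrictT _ _).1 => //; exact: measurable_funTS.
- by move=> x; rewrite /patch; case: ifP.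
Qed.

Let I_cat a b c : (a <= b -> b <= c -> I a c = I a b + I b c)%R.
Proof.
move=> ab bc; rewrite /I -ge0_integral_setU//.
- congr (integral _ _ _); apply/seteqP; split=> x /=; rewrite !in_itv/=.
    by move=> /andP[ax xc]; have [xb|bx] := ltP x b; [left|right]; apply/andP.
  case=> /andP[h1 h2]; first by rewrite h1 (lt_le_trans h2).
  by rewrite h2 (le_trans ab).
- exact: measurable_funTS.
- rewrite disj_set2E; apply/eqP/seteqP; split=> x //= [].
  by rewrite !in_itv/= => /andP[_ h] /andP[h' _]; rewrite ltNge h' in h.
Qed.

Let I_period_nat (k : nat) a : I (a + k%:R * (2 * pi))%R (a + k%:R * (2 * pi) + 2 * pi)%R = I a (a + 2 * pi)%R.
Proof.
elim: k a => [|k IH] a; first by rewrite mul0r addr0.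
by rewrite -[RHS]IH -[RHS]I_shift -natr1 mulrDl mul1r !addrA.
Qed.

Let I_period_int (k : int) a : I (a + k%:~R * (2 * pi))%R (a + k%:~R * (2 * pi) + 2 * pi)%R = I a (a + 2 * pi)%R.
Proof.
case: k => k; first exact: I_period_nat.
by rewrite NegzE -[LHS](I_period_nat k.+1) mulrNz/= -pmulrn mulNr subrK.
Qed.

(** After a shift by whole periods the left end point [b] lies in [-pi, pi[; the
    part of [b, b + 2 pi[ beyond pi is then the period-translate of [-pi, b[. *)
Lemma integral_period a : I a (a + 2 * pi)%R = I (- pi)%R pi.
Proof.
have pi2 : (0 < 2 * pi :> R)%R by rewrite mulr_gt0// pi_gt0.
pose k := Num.floor ((a + pi) / (2 * pi)).
rewrite -[LHS](I_period_int (- k)%R); set b := (a + _)%R.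
have [b1 b2] : (- pi <= b /\ b < pi)%R.
  have /andP[] := floor_itv ((a + pi) / (2 * pi)).
  rewrite -/k ler_pdivlMr// ltr_pdivrMr// /b intrD mulrDl mul1r mulrNz mulNr => h1 h2.
  by split; lra.
rewrite (@I_cat b pi)//; [|exact: ltW|by lra].
rewrite (_ : I pi _ = I (- pi)%R b); last first.
  by rewrite -[RHS]I_shift (_ : - pi + 2 * pi = pi)%R// mulr2n mulrDl mul1r addKr.
by rewrite addeC -I_cat// ltW.
Qed.

Lemma integral_periods (m : nat) a :
  I a (a + m%:R * (2 * pi))%R = m%:R%:E * I (- pi)%R pi.
Proof.
have pi2 : (0 < 2 * pi :> R)%R by rewrite mulr_gt0// pi_gt0.
elim: m => [|m IH].
  by rewrite mul0r mul0e addr0 /I set_itvco0 integral_set0.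
rewrite (@I_cat a (a + m%:R * (2 * pi))%R); last 2 first.
- by rewrite lerDl mulr_ge0// ltW.
- by rewrite lerD2l ler_pM2r// ler_nat.
rewrite IH (_ : (a + m.+1%:R * _ = (a + m%:R * (2 * pi)) + 2 * pi)%R); last first.
  by rewrite -natr1 mulrDl mul1r addrA.
rewrite integral_period -natr1 EFinD ge0_muleDl ?lee_fin// mul1e//.
Qed.

Lemma integral_period_reflect a :
  \int[@lebesgue_measure R]_(x in [set` `[(- pi)%R, pi[%R]) f (a - x)%R =
  I (- pi)%R pi.
Proof.
rewrite -(integral_period (a - pi)%R) /I.
rewrite integral_mkcond.
have mp (D : set R) : measurable D -> measurable_fun setT (f \_ D).
  by move=> mD; apply/(measurable_restrictT _ _).1 => //; exact: measurable_funTS.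
have := @ge0_integral_affine1 R (-1)%R a
  (f \_ [set` `](a - pi)%R, (a + pi)%R]%R]).
rewrite oppr_eq0 oner_eq0 normrN normr1 invr1 mul1e => /(_ isT) E.
transitivity (\int[@lebesgue_measure R]_x
   (f \_ [set` `](a - pi)%R, (a + pi)%R]%R]) (-1 * x + a)%R).
  apply: eq_integral => x _; rewrite /patch mulN1r addrC.
  congr (if _ then _ else _); rewrite !mem_setE !in_itv/=.
  by apply/andP/andP => -[? ?]; split; lra.
rewrite E; last 2 first.
- exact: mp.
- by move=> x; rewrite /patch; case: ifP.
rewrite -integral_mkcond.
rewrite (_ : (a - pi + 2 * pi = a + pi)%R); last by lra.
by rewrite integral_itv_bndoo ?[RHS]integral_itv_bndoo//; exact: measurable_funTS.
Qed.

End dimension_one.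

Definition box n (A : set R) : set 'rV[R]_n := [set x | forall i, A (x ord0 i)].

Arguments box : clear implicits.

Lemma box_cube n : cube n = box n [set` `[(- pi)%R, pi[%R].
Proof. by []. Qed.

Lemma measurable_box n (A : set (measurableTypeR R)) :
  measurable A -> measurable (box n A).
Proof. by move=> mA; exact: (measurable_rV_box (A := fun=> A) (fun=> mA)). Qed.

Lemma box_consr n (A : set R) t (y : 'rV[R]_n) :
  box n.+1 A (consr (t, y)) <-> A t /\ box n A y.
Proof.
split=> [Ax|[At Ay] i].
  split=> [|i]; first by have := Ax ord0; rewrite consr0.
  by have := Ax (lift ord0 i); rewrite consrS.
by have [j ->|->] := unliftP ord0 i; rewrite ?consrS ?consr0//; exact: Ay.
Qed.

Lemma eq_patch T1 T2 (A : set T1) (B : set T2) (f : T1 -> \bar R) g x y :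
  A x = B y -> f x = g y -> (f \_ A) x = (g \_ B) y.
Proof.
move=> E F; rewrite /patch F; congr (if _ then _ else _).
by apply/idP/idP => /set_mem h; apply/mem_set; [rewrite -E|rewrite E].
Qed.

Lemma measurable_patch n (A : set 'rV[R]_n) (f : 'rV[R]_n -> \bar R) :
  measurable A -> measurable_fun setT f -> measurable_fun setT (f \_ A).
Proof.
by move=> mA mf; apply/(measurable_restrictT _ _).1 => //; exact: measurable_funTS.
Qed.

Lemma measurable_consrt n (t : R) :
  measurable_fun setT (fun y : 'rV[R]_n => consr (t, y)).
Proof.
apply: (measurableT_comp (@measurable_consr R n)).
exact: (@measurable_fun_pair _ _ _ _ (measurableTypeR R)).
Qed.

Lemma ge0_integral_boxS n (A : set (measurableTypeR R)) (f : 'rV[R]_n.+1 -> \bar R) :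
  measurable A -> measurable_fun setT f -> (forall x, 0 <= f x) ->
  \int[lebesgue_rV R n.+1]_(x in box n.+1 A) f x =
  \int[@lebesgue_measure R]_(s in A) \int[lebesgue_rV R n]_(y in box n A) f (consr (s, y)).
Proof.
move=> mA mf f0; rewrite integral_mkcond ge0_integral_rVS; last 2 first.
- by apply: measurable_patch => //; exact: measurable_box.
- by move=> x; rewrite /patch; case: ifP.
rewrite [RHS]integral_mkcond; apply: eq_integral => t _.
rewrite [RHS]/patch; case: ifPn => [tA|tA].
  rewrite [RHS]integral_mkcond; apply: eq_integral => y _; rewrite /patch.
  congr (if _ then _ else _); apply/idP/idP; rewrite !inE.
    by move=> /box_consr[].
  by move=> h; apply/box_consr; split=> //; rewrite inE in tA.
rewrite -[RHS](integral0 (lebesgue_rV R n) setT); apply: eq_integral => y _.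
rewrite /patch; case: ifPn => //; rewrite inE => /box_consr[h _].
by move: tA; rewrite notin_setE.
Qed.

Lemma measurable_integral_box_consr n (A : set (measurableTypeR R)) (f : 'rV[R]_n.+1 -> \bar R) :
  measurable A -> measurable_fun setT f -> (forall x, 0 <= f x) ->
  measurable_fun setT
    (fun t : measurableTypeR R => \int[lebesgue_rV R n]_(y in box n A) f (consr (t, y))).
Proof.
move=> mA mf f0.
have mfA : measurable_fun setT (fun x : 'rV[R]_n.+1 =>
    (f \_ [set x | box n A (unconsr x).2]) x).
  apply: measurable_patch => //; rewrite -[X in measurable X]setTI.
  apply: (measurableT_comp measurable_snd (@measurable_unconsr R n)) => //.
  exact: measurable_box.
have mfA0 x : 0 <= (f \_ [set x | box n A (unconsr x).2]) x.
  by rewrite /patch; case: ifP.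
have := measurable_integral_consr mfA mfA0.
congr measurable_fun; apply/funext => t; rewrite [RHS]integral_mkcond.
apply: eq_integral => y _.
have E : [set x | box n A (unconsr x).2] (consr (t, y)) = box n A y.
  by rewrite /mkset consrK.
exact: eq_patch.
Qed.

Definition eperiodic n (f : 'rV[R]_n -> \bar R) :=
  forall k x, f (x + (2 * pi) *: basis_rV k)%R = f x.

Lemma consr_basis0 n (t c : R) (y : 'rV[R]_n) :
  (consr (t, y) + c *: basis_rV ord0 = consr (t + c, y))%R.
Proof.
apply/rowP => i; have [j ->|->] := unliftP ord0 i.
  by rewrite !mxE !liftK/= mulr0 addr0.
by rewrite !mxE !unlift_none/= mulr1.
Qed.

Lemma consr_basisS n (t c : R) k (y : 'rV[R]_n) :
  (consr (t, y) + c *: basis_rV (lift ord0 k) = consr (t, y + c *: basis_rV k))%R.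
Proof.
apply/rowP => i; have [j ->|->] := unliftP ord0 i.
  by rewrite !mxE !liftK/= !mxE (inj_eq lift_inj).
by rewrite !mxE !unlift_none/= mulr0 addr0.
Qed.

Lemma eperiodic_consrt n (f : 'rV[R]_n.+1 -> \bar R) t :
  eperiodic f -> eperiodic (fun y => f (consr (t, y))).
Proof. by move=> fT k x; rewrite -consr_basisS fT. Qed.

(** By induction on the dimension, from the statement for one coordinate
    ([integral_period_reflect]). *)
Lemma ge0_integral_cube_reflect n (a : 'rV[R]_n) (f : 'rV[R]_n -> \bar R) :
  measurable_fun setT f -> (forall x, 0 <= f x) -> eperiodic f ->
  \int[lebesgue_rV R n]_(x in cube n) f (a - x)%R =
  \int[lebesgue_rV R n]_(x in cube n) f x.
Proof.
elim: n a f => [|n IH] a f mf f0 fT.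
  by apply: eq_integral => x _; congr f; apply/rowP => -[].
have mfa : measurable_fun setT (fun x : 'rV[R]_n.+1 => f (a - x)%R).
  rewrite (_ : (fun _ => _) = f \o (fun x : 'rV[R]_n.+1 => (-1) *: x + a)%R); last first.
    by apply/funext => x /=; rewrite scaleN1r addrC.
  by apply: measurableT_comp => //; exact: measurable_rV_affine.
have mI : measurable ([set` `[(- pi)%R, pi[%R] : set (measurableTypeR R)) by exact: measurable_itv.
rewrite box_cube (ge0_integral_boxS mI mfa (fun=> f0 _)) (ge0_integral_boxS mI mf f0).
pose F s := \int[lebesgue_rV R n]_(y in cube n) f (consr (s, y)).
transitivity (\int[@lebesgue_measure R]_(s in [set` `[(- pi)%R, pi[%R])
   F (a ord0 ord0 - s)%R).
  apply: eq_integral => s _.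
  rewrite /F -(IH (\row_i a ord0 (lift ord0 i)))//; last 2 first.
  - by apply: measurableT_comp => //; exact: measurable_consrt.
  - exact: eperiodic_consrt.
  apply: eq_integral => y _; congr f; apply/rowP => i.
  have [j ->|->] := unliftP ord0 i; first by rewrite !mxE !liftK/= !mxE.
  by rewrite !mxE !unlift_none.
rewrite integral_period_reflect//.
- exact: (measurable_integral_box_consr (measurable_itv (`[(- pi)%R, pi[%R : interval R)) mf f0).
- by move=> s; apply: integral_ge0.
- by move=> s; apply: eq_integral => y _; rewrite -consr_basis0 fT.
Qed.

(** The box is tiled by (2 N + 1)^n translates of the cube. *)
Lemma ge0_integral_box_periods n (N : nat) (f : 'rV[R]_n -> \bar R) :
  measurable_fun setT f -> (forall x, 0 <= f x) -> eperiodic f ->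
  \int[lebesgue_rV R n]_(x in box n
     [set` `[(- pi - N%:R * (2 * pi))%R, (- pi + N.+1%:R * (2 * pi))%R[ ]) f x =
  (N.*2.+1%:R ^+ n)%:E * \int[lebesgue_rV R n]_(x in cube n) f x.
Proof.
elim: n f => [|n IH] f mf f0 fT.
  rewrite expr0 mul1e; congr (integral _ _ _); apply/seteqP; split => x _ //= -[]//.
rewrite box_cube [LHS]ge0_integral_boxS// [in RHS]ge0_integral_boxS//.
pose F s := \int[lebesgue_rV R n]_(y in cube n) f (consr (s, y)).
have F0 s : 0 <= F s by apply: integral_ge0.
have mF : measurable_fun setT F by exact: (measurable_integral_box_consr (measurable_itv (`[(- pi)%R, pi[%R : interval R)) mf f0).
transitivity (\int[@lebesgue_measure R]_(s in
    [set` `[(- pi - N%:R * (2 * pi))%R, (- pi + N.+1%:R * (2 * pi))%R[ ])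
    ((N.*2.+1%:R ^+ n)%:E * F s)).
  apply: eq_integral => s _; rewrite IH//.
  - by apply: measurableT_comp => //; exact: measurable_consrt.
  - exact: eperiodic_consrt.
rewrite ge0_integralZl//; last exact: measurable_funTS.
rewrite (_ : (- pi + N.+1%:R * (2 * pi) =
   - pi - N%:R * (2 * pi) + N.*2.+1%:R * (2 * pi))%R); last first.
  by rewrite -!natr1 -addnn natrD; lra.
rewrite (integral_periods mF F0); last first.
  by move=> s; apply: eq_integral => y _; rewrite -consr_basis0 fT.
by rewrite muleA -EFinM -exprSr.
Qed.

End periodic.

Arguments box {R} n A _.

(** * Continuous functions on the torus *)

Section torus_functions.
Context {R : realType} {n : nat}.
Implicit Types (f g p : 'rV[R]_n -> R).
Local Notation mu := (lebesgue_rV R n).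

Definition rbox (r : R) : set 'rV[R]_n := box n [set` `[(- r), r]%R].

Lemma rboxP r x : rbox r x <-> forall i, `|x ord0 i| <= r.
Proof.
by split=> rx i; have := rx i; rewrite /= in_itv/= ler_norml.
Qed.

Lemma subset_rbox (r s : R) (x : 'rV[R]_n) : r <= s -> ~ rbox s x -> ~ rbox r x.
Proof. by move=> rs xs /rboxP xr; apply: xs; apply/rboxP => i; exact: le_trans (xr i) rs. Qed.

Lemma measurable_rbox r : measurable (rbox r).
Proof. by apply: measurable_box; exact: measurable_itv. Qed.

Lemma lebesgue_box_fin (i : interval R) : (lebesgue_measure [set` i] < +oo)%E ->
  (mu (box n [set` i]) < +oo)%E.
Proof.
move=> fi; have -> := @lebesgue_rV_box R n (fun=> [set` i]); last first.
  by move=> ?; exact: measurable_itv.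
suff : (0 <= (\prod_(j < n) lebesgue_measure [set` i]) /\
  (\prod_(j < n) lebesgue_measure [set` i]) < +oo)%E by case.
apply: (@big_ind _ (fun x : \bar R => (0 <= x)%E /\ (x < +oo)%E)).
- by rewrite ltry lee01.
- move=> x y [x0 xy] [y0 yy]; split; first exact: mule_ge0.
  by rewrite lte_mul_pinfty// ge0_fin_numE.
- by move=> j _; split.
Qed.

Lemma lebesgue_rbox_fin r : (mu (rbox r) < +oo)%E.
Proof.
apply: lebesgue_box_fin; rewrite lebesgue_measure_itv/=.
by case: ifP => // _; rewrite -EFinB ltry.
Qed.

Lemma lebesgue_cube_fin : (mu (cube n) < +oo)%E.
Proof.
apply: lebesgue_box_fin; rewrite lebesgue_measure_itv/=.
by case: ifP => // _; rewrite -EFinB ltry.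
Qed.

Lemma measurable_cubeT : measurable (cube n : set 'rV[R]_n).
Proof. exact: measurable_cube. Qed.

Lemma bounded_integrable (A : set 'rV[R]_n) f (M : R) : measurable A ->
  (mu A < +oo)%E -> measurable_fun setT f -> (forall x, A x -> `|f x| <= M) ->
  mu.-integrable A (EFin \o f).
Proof.
move=> mA fA mf fM; apply: measurable_bounded_integrable => //.
  exact: measurable_funTS.
exists M; split; first exact: num_real.
by move=> y My x /= Ax; apply: le_trans (fM _ Ax) (ltW My).
Qed.

Lemma integrable_support f r (M : R) : measurable_fun setT f ->
  (forall x, `|f x| <= M) -> (forall x, ~ rbox r x -> f x = 0) ->
  mu.-integrable setT (EFin \o f).
Proof.
move=> mf fM f0.
have := bounded_integrable (measurable_rbox r) (lebesgue_rbox_fin r) mf (fun x _ => fM x).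
move/(integrable_mkcond _ (measurable_rbox r)).
congr (integrable _ _ _); apply/funext => x.
by rewrite /patch; case: ifPn => //; rewrite notin_setE /= => /f0 ->.
Qed.

Lemma Rintegral_support f r : (forall x, ~ rbox r x -> f x = 0) ->
  \int[mu]_x f x = \int[mu]_(x in rbox r) f x.
Proof.
move=> f0; rewrite /Rintegral [in RHS]integral_mkcond; congr fine.
apply: eq_integral => x _.
by rewrite /patch; case: ifPn => //; rewrite notin_setE /= => /f0 ->.
Qed.

Lemma norm_Rintegral_le (A : set 'rV[R]_n) f g : measurable A ->
  mu.-integrable A (EFin \o f) -> mu.-integrable A (EFin \o g) ->
  (forall x, A x -> `|f x| <= g x) ->
  `|\int[mu]_(x in A) f x| <= \int[mu]_(x in A) g x.
Proof.
move=> mA If Ig fg; apply: (le_trans (le_normr_Rintegral mA If)).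
by apply: le_Rintegral => //; exact: integrable_norm.
Qed.

Lemma eq_Rintegral_in (A : set 'rV[R]_n) f g : (forall x, A x -> f x = g x) ->
  \int[mu]_(x in A) f x = \int[mu]_(x in A) g x.
Proof.
by move=> fg; rewrite /Rintegral; congr fine; apply: eq_integral => x /set_mem/fg ->.
Qed.

Lemma torus_Rintegral f : measurable_fun setT f ->
  \int[torus_measure R n]_x f x = \int[mu]_(x in cube n) f x.
Proof.
move=> mf; rewrite /Rintegral /torus_measure integral_mrestr//.
exact/measurable_EFinP.
Qed.

Lemma continuous_torus_measurable f : continuous_torus f -> measurable_fun setT f.
Proof. by move=> [/continuous_rV_measurable]. Qed.

(** Invariance under the basis translations gives invariance under the whole
    lattice, one coordinate at a time; the subtraction has the form in which
    [torus_repr] performs it. *)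
Lemma periodic_int f (z : 'I_n -> int) (x : 'rV[R]_n) : periodic_2pi f ->
  f (\row_i (x ord0 i - 2 * pi * (z i)%:~R)) = f x.
Proof.
move=> fT.
have nat1 (k : 'I_n) (m : nat) y : f (y + (m%:R * (2 * pi)) *: basis_rV k) = f y.
  elim: m => [|m IH]; first by rewrite mul0r scale0r addr0.
  by rewrite -natr1 mulrDl mul1r scalerDl addrA fT.
have int1 (k : 'I_n) (m : int) y : f (y + (m%:~R * (2 * pi)) *: basis_rV k) = f y.
  case: m => m; first exact: nat1.
  by rewrite NegzE -[LHS](nat1 k m.+1) mulrNz/= -pmulrn mulNr scaleNr subrK.
have sum1 (s : seq 'I_n) y : f (y + \sum_(k <- s) ((- z k)%:~R * (2 * pi)) *: basis_rV k) = f y.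
  elim: s y => [|k s IH] y; first by rewrite big_nil addr0.
  by rewrite big_cons addrA IH int1.
rewrite -[RHS](sum1 (index_enum _)); congr f; apply/rowP => i.
rewrite !mxE summxE (bigD1 i)//= big1 ?addr0.
  by rewrite !mxE !eqxx/= mulr1 mulrNz mulNr mulrC.
by move=> j ji; rewrite !mxE (eq_sym i) (negbTE ji) andbF mulr0.
Qed.

Lemma periodic_torus_repr f x : periodic_2pi f -> f (torus_repr x) = f x.
Proof. by move=> fT; rewrite /torus_repr periodic_int. Qed.

Lemma torus_repr_cube (x : 'rV[R]_n) : cube n (torus_repr x).
Proof.
move=> i; rewrite mxE in_itv/=.
have pi2 : 0 < 2 * pi :> R by rewrite mulr_gt0// pi_gt0.
move: (Num.floor _) (floor_itv ((x ord0 i + pi) / (2 * pi))) => z /andP[].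
rewrite ler_pdivlMr// ltr_pdivrMr// intrD mulrDl mul1r => h1 h2.
by apply/andP; split; lra.
Qed.

Lemma torus_repr_id (x : 'rV[R]_n) : cube n x -> torus_repr x = x.
Proof.
move=> cx; apply/rowP => i; rewrite mxE.
have pi2 : 0 < 2 * pi :> R by rewrite mulr_gt0// pi_gt0.
have := cx i; rewrite in_itv/= => /andP[h1 h2].
rewrite (_ : Num.floor _ = 0) ?mulr0 ?subr0//; apply/eqP.
rewrite floor_eq// ler_pdivlMr// ltr_pdivrMr// mul0r add0r mul1r.
by apply/andP; split; lra.
Qed.

Lemma torus_repr_periodic (x : 'rV[R]_n) (k : 'I_n) :
  torus_repr (x + (2 * pi) *: basis_rV k) = torus_repr x.
Proof.
have pi2 : 2 * pi != 0 :> R by rewrite mulf_neq0// gt_eqF// pi_gt0.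
apply/rowP => i; rewrite !mxE eqxx/=.
have [ik|ik] := eqVneq i k; last by rewrite mulr0 addr0.
rewrite /= mulr1n mulr1 (_ : _ / _ = (x ord0 i + pi) / (2 * pi) + 1); last first.
  by rewrite addrAC mulrDl divff.
rewrite floorDrz ?intr1//= floor1 intrD -[1%:~R]/(1 : R).
by move: (_%:~R) => z; clear; ring.
Qed.

Definition ccube : set 'rV[R]_n := rbox pi.

Lemma compact_ccube : compact ccube.
Proof. have := @rV_compact R n (fun=> [set` `[(- pi), pi]%R]).
by move=> /(_ (fun=> @segment_compact R _ _)). Qed.

Lemma cube_ccube : cube n `<=` ccube.
Proof.
by move=> x cx i; have := cx i; rewrite /= !in_itv/= => /andP[-> /ltW ->].
Qed.

Lemma ccube_torus_repr (x : 'rV[R]_n) : ccube (torus_repr x).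
Proof. exact/cube_ccube/torus_repr_cube. Qed.

Lemma ccube0 : ccube 0.
Proof. by apply/rboxP => i; rewrite mxE normr0 pi_ge0. Qed.

Lemma periodic_max f : continuous_torus f -> exists c, forall x, f x <= f c.
Proof.
move=> [cf fT].
have [c _ cm] := @EVT_max_rV R n f _ (ex_intro _ 0 ccube0) compact_ccube
  (@continuous_subspaceT _ _ _ _ cf).
exists c => x; rewrite -(periodic_torus_repr x fT); apply: cm.
by rewrite inE; exact: ccube_torus_repr.
Qed.

Lemma periodic_min f : continuous_torus f -> exists c, forall x, f c <= f x.
Proof.
move=> [cf fT].
have [c _ cm] := @EVT_min_rV R n f _ (ex_intro _ 0 ccube0) compact_ccube
  (@continuous_subspaceT _ _ _ _ cf).
exists c => x; rewrite -(periodic_torus_repr x fT); apply: cm.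
by rewrite inE; exact: ccube_torus_repr.
Qed.

Lemma continuous_torus_norm f : continuous_torus f -> continuous_torus (fun x => `|f x|).
Proof.
move=> [cf fT]; split; last by move=> k x; rewrite fT.
by move=> x; apply: continuous_comp; [exact: cf|exact: norm_continuous].
Qed.

Lemma periodic_bounded f : continuous_torus f -> exists2 M : R, 0 <= M & forall x, `|f x| <= M.
Proof.
by move=> /continuous_torus_norm/periodic_max[c fc]; exists (`|f c|).
Qed.

Lemma continuous_ball f x (e : R) : continuous f -> 0 < e ->
  exists2 d : R, 0 < d & forall y, `|x - y| < d -> `|f x - f y| < e.
Proof.
move=> cf e0; have /cvgrPdist_lt/(_ e e0) := cf x.
rewrite /prop_near1 => /nbhs_ballP[d /= d0 xd]; exists d => // y xy.
by apply: xd; rewrite -ball_normE.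
Qed.

Lemma ball_continuous f : (forall x (e : R), 0 < e ->
  exists2 d : R, 0 < d & forall y, `|x - y| < d -> `|f x - f y| < e) -> continuous f.
Proof.
move=> h x A /nbhs_ballP[e /= e0 eA]; have [d d0 xd] := h x e e0.
apply/nbhs_ballP; exists d => // y; rewrite -ball_normE => /xd fxy.
by apply: eA; rewrite -ball_normE.
Qed.

(** Both points may be moved by the lattice vector that brings the first one into
    the cube, which is compact. *)
Lemma periodic_unif f (e : R) : continuous_torus f -> 0 < e ->
  exists2 d : R, 0 < d & forall x y, `|x - y| < d -> `|f x - f y| < e.
Proof.
move=> [cf fT] e0.
have := compact_ccube; rewrite compact_near_coveringP.
move=> /(_ _ (nbhs (0 : 'rV[R]_n)) (fun d x => `|f x - f (x + d)| < e)).
move=> /(_ (nbhs_filter _)) H.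
have {H} : \forall d \near (0 : 'rV[R]_n), ccube `<=` (fun x => `|f x - f (x + d)| < e).
  apply: H => x _.
  have [d d0 xd] := @continuous_ball f x (e / 2) cf (divr_gt0 e0 (ltr0Sn _ 1)).
  have d20 : 0 < d / 2 by rewrite divr_gt0.
  exists (ball x (d / 2), ball (0 : 'rV[R]_n) (d / 2)).
    by split; exact: nbhsx_ballx.
  move=> [x' y] []/=; rewrite -!ball_normE/= sub0r normrN => xx' yd.
  rewrite (le_lt_trans (ler_distD (f x) _ _))// [e]splitr ltrD//.
    rewrite distrC; apply: xd; apply: (lt_trans xx').
    by rewrite ltr_pdivrMr// ltr_pMr// ltr1n.
  apply: xd; rewrite opprD addrA (le_lt_trans (ler_normB _ _))//.
  by rewrite [d]splitr ltrD.
move=> /nbhs_ballP[d /= d0]; rewrite -ball_normE => dP.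
exists d => // x y xy.
pose z := torus_repr x.
have zE (v : 'rV[R]_n) : f (z + v) = f (x + v).
  rewrite -[RHS](periodic_int (fun i => Num.floor ((x ord0 i + pi) / (2 * pi))) _ fT).
  by congr f; apply/rowP => i; rewrite !mxE addrAC.
have := dP (y - x); rewrite /= sub0r normrN distrC => /(_ xy z (ccube_torus_repr x)).
by rewrite zE (addrC x) subrK periodic_torus_repr.
Qed.

(** The way in which continuity of a convolution is obtained: its oscillation
    under translations is controlled by that of the convolved function. *)
Lemma continuous_modulus f g (A : R) : continuous_torus f -> 0 <= A ->
  (forall (d : 'rV[R]_n) (e : R), (forall x, `|f x - f (x + d)| <= e) -> forall x, `|g x - g (x + d)| <= A * e) ->
  continuous g.
Proof.
move=> ctf A0 fg; apply: ball_continuous => x e e0.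
have A1 : 0 < A + 1 by rewrite ltr_wpDl.
have [d d0 fd] := periodic_unif ctf (divr_gt0 e0 A1).
exists d => // y xy.
have -> : y = x + (y - x) by rewrite addrC subrK.
apply: le_lt_trans (fg (y - x) (e / (A + 1)) _ x) _.
  move=> z; apply/ltW/fd; rewrite opprD addrA subrr sub0r normrN distrC.
  exact: xy.
by rewrite mulrA ltr_pdivrMr// mulrC ltr_pM2l// ltrDl.
Qed.

Lemma continuous_torus_cst (c : R) : continuous_torus (fun=> c : R) (n := n).
Proof. by split=> //; exact: cst_continuous. Qed.

Lemma continuous_torusD f g : continuous_torus f -> continuous_torus g ->
  continuous_torus (fun x => f x + g x).
Proof.
move=> [cf fT] [cg gT]; split; last by move=> k x; rewrite fT gT.
by move=> x; apply: continuousD; [exact: cf|exact: cg].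
Qed.

Lemma continuous_torusN f : continuous_torus f -> continuous_torus (fun x => - f x).
Proof.
move=> [cf fT]; split; last by move=> k x; rewrite fT.
by move=> x; apply: continuousN; exact: cf.
Qed.

Lemma continuous_torusB f g : continuous_torus f -> continuous_torus g ->
  continuous_torus (fun x => f x - g x).
Proof. by move=> cf cg; apply: continuous_torusD => //; exact: continuous_torusN. Qed.

Lemma continuous_torusM f g : continuous_torus f -> continuous_torus g ->
  continuous_torus (fun x => f x * g x).
Proof.
move=> [cf fT] [cg gT]; split; last by move=> k x; rewrite fT gT.
by move=> x; apply: continuousM; [exact: cf|exact: cg].
Qed.

Lemma continuous_torus_sum (I : Type) (s : seq I) (F : I -> 'rV[R]_n -> R) :
  (forall i, continuous_torus (F i)) -> continuous_torus (fun x => \sum_(i <- s) F i x).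
Proof.
move=> cF; elim: s => [|i s IH].
  by under eq_fun do rewrite big_nil; exact: continuous_torus_cst.
by under eq_fun do rewrite big_cons; exact: continuous_torusD.
Qed.

Lemma continuous_torusV f : continuous_torus f -> (forall x, f x != 0) ->
  continuous_torus (fun x => (f x)^-1).
Proof.
move=> [cf fT] f0; split; last by move=> k x; rewrite fT.
by move=> x; apply: continuousV => //; exact: cf.
Qed.

Lemma continuous_torus_max f g : continuous_torus f -> continuous_torus g ->
  continuous_torus (fun x => Num.max (f x) (g x)).
Proof.
move=> [cf fT] [cg gT]; split; last by move=> k x; rewrite fT gT.
by move=> x; apply: continuous_max; [exact: cf|exact: cg].
Qed.

Lemma continuous_torus_min f g : continuous_torus f -> continuous_torus g ->
  continuous_torus (fun x => Num.min (f x) (g x)).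
Proof.
move=> [cf fT] [cg gT]; split; last by move=> k x; rewrite fT gT.
by move=> x; apply: continuous_min; [exact: cf|exact: cg].
Qed.

Lemma continuous_shift (a : 'rV[R]_n) : continuous (fun x : 'rV[R]_n => x + a).
Proof. by move=> x; apply: (@continuousD _ _ _ id (cst a) x); [exact: cvg_id|exact: cst_continuous]. Qed.

Lemma continuous_torus_shift f (a : 'rV[R]_n) :
  continuous_torus f -> continuous_torus (fun x => f (x + a)).
Proof.
move=> [cf fT]; split; last by move=> k x; rewrite addrAC fT.
by move=> x; apply: (continuous_comp (@continuous_shift a x)); exact: cf.
Qed.

Lemma continuous_reflect (a : 'rV[R]_n) : continuous (fun x : 'rV[R]_n => a - x).
Proof. by move=> x; apply: (@continuousB _ _ _ (cst a) id x); [exact: cst_continuous|exact: cvg_id]. Qed.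

Lemma continuous_torus_reflect f (a : 'rV[R]_n) :
  continuous_torus f -> continuous_torus (fun x => f (a - x)).
Proof.
move=> [cf fT]; split.
  by move=> x; apply: (continuous_comp (@continuous_reflect a x)); exact: cf.
by move=> k x; rewrite opprD addrA -(fT k) subrK.
Qed.

(** * Real-valued integrals *)

Lemma integrable_cube f : continuous_torus f -> mu.-integrable (cube n) (EFin \o f).
Proof.
move=> cf; have [M _ fM] := periodic_bounded cf.
apply: (@bounded_integrable _ _ M measurable_cubeT lebesgue_cube_fin) => //.
exact: continuous_torus_measurable.
Qed.

Lemma Rintegral_translate f (a : 'rV[R]_n) : measurable_fun setT f ->
  \int[mu]_x f (x + a) = \int[mu]_x f x.
Proof.
move=> mf; rewrite /Rintegral -[in RHS](integral_translate a)//.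
exact/measurable_EFinP.
Qed.

Lemma Rintegral_cube_reflect f (a : 'rV[R]_n) : measurable_fun setT f -> periodic_2pi f ->
  \int[mu]_(x in cube n) f (a - x) = \int[mu]_(x in cube n) f x.
Proof.
move=> mf fT; rewrite /Rintegral; congr fine.
have mEf : measurable_fun setT (EFin \o f) by exact/measurable_EFinP.
rewrite [LHS]integralE [RHS]integralE.
rewrite -(@ge0_integral_cube_reflect _ _ a (EFin \o f)^\+%E); last 3 first.
- exact: measurable_funepos.
- exact: funepos_ge0.
- by move=> k x; rewrite !funeposE/= fT.
rewrite -(@ge0_integral_cube_reflect _ _ a (EFin \o f)^\-%E); last 3 first.
- exact: measurable_funeneg.
- exact: funeneg_ge0.
- by move=> k x; rewrite !funenegE/= fT.
by congr (_ - _)%E; apply: eq_integral => x _; rewrite ?funeposE ?funenegE.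
Qed.

Lemma Rintegral_cube_translate f (a : 'rV[R]_n) : continuous_torus f ->
  \int[mu]_(x in cube n) f (x + a) = \int[mu]_(x in cube n) f x.
Proof.
move=> cf; have mf := continuous_torus_measurable cf.
rewrite -(Rintegral_cube_reflect 0 mf cf.2).
rewrite -(@Rintegral_cube_reflect (fun x => f (0 - x)) (- a)); last 2 first.
- exact: (continuous_torus_measurable (continuous_torus_reflect 0 cf)).
- exact: (continuous_torus_reflect 0 cf).2.
by apply: eq_Rintegral_in => x _; rewrite sub0r opprB opprK.
Qed.

(** An upper bound for the number of translates of the cube that cover the box
    of radius [r]; it uses only that a period is at least 2. *)
Definition covering_number (r : R) : R := (Num.truncn r).*2.+1%:R ^+ n.

Lemma covering_number_ge0 r : 0 <= covering_number r.
Proof. exact: exprn_ge0. Qed.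

Lemma Rintegral_ge0 (A : set 'rV[R]_n) f : (forall x, A x -> 0 <= f x) ->
  0 <= \int[mu]_(x in A) f x.
Proof.
by move=> f0; apply: fine_ge0; apply: integral_ge0 => x Ax; rewrite lee_fin f0.
Qed.

Lemma Rintegral_rbox p r : continuous_torus p -> (forall x, 0 <= p x) ->
  \int[mu]_(x in rbox r) p x <= covering_number r * \int[mu]_(x in cube n) p x.
Proof.
move=> cp p0; have [M _ pM] := periodic_bounded cp.
have mp := continuous_torus_measurable cp.
have mEp : measurable_fun setT (EFin \o p) by exact/measurable_EFinP.
have Ic := integrable_cube cp.
have Ir := bounded_integrable (measurable_rbox r) (lebesgue_rbox_fin r) mp (fun x _ => pM x).
rewrite -lee_fin EFinM /Rintegral !fineK; last 2 first.
- exact: (integrable_fin_num measurable_cubeT Ic).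
- exact: (integrable_fin_num (measurable_rbox r) Ir).
rewrite -(@ge0_integral_box_periods _ _ (Num.truncn r))//; last first.
  by move=> k x /=; rewrite cp.2.
apply: ge0_subset_integral => //.
- exact: measurable_rbox.
- by apply: measurable_box; exact: measurable_itv.
- exact: measurable_funTS.
- by move=> x _; rewrite lee_fin.
- move=> x rx i; have := rx i; rewrite /= !in_itv/= => /andP[h1 h2].
  have r0 : 0 <= r by lra.
  have := truncnS_gt r; set N := Num.truncn r => rN.
  have N0 : 0 <= N%:R :> R by [].
  have pi1 : 1 <= pi :> R by rewrite (le_trans _ (pi_ge2 _))// ler1n.
  rewrite -natr1 in rN *; apply/andP; split; nra.
Qed.

(** The bound that every integral over R^n below reduces to: what is dominated by
    a periodic [p] on a bounded set is controlled by the mass of [p] on the torus. *)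
Lemma Rintegral_support_bound f p r (M : R) : continuous_torus p ->
    (forall x, 0 <= p x) -> 0 <= M ->
  measurable_fun setT f -> (forall x, `|f x| <= M * p x) ->
  (forall x, ~ rbox r x -> f x = 0) ->
  `|\int[mu]_x f x| <= M * (covering_number r * \int[mu]_(x in cube n) p x).
Proof.
move=> cp p0 M0 mf fMp f0; have [K _ pK] := periodic_bounded cp.
have mp := continuous_torus_measurable cp.
have Ir := bounded_integrable (measurable_rbox r) (lebesgue_rbox_fin r) mp (fun x _ => pK x).
have If : mu.-integrable (rbox r) (EFin \o f).
  apply: (@bounded_integrable _ _ (M * K) (measurable_rbox r) (lebesgue_rbox_fin r) mf) => x _.
  by rewrite (le_trans (fMp x))// ler_wpM2l// (le_trans (ler_norm _)).
rewrite (Rintegral_support f0).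
apply: (le_trans (norm_Rintegral_le (measurable_rbox r) If _ (fun x _ => fMp x))).
  by have := integrableZl (measurable_rbox r) M Ir.
rewrite RintegralZl//; last exact: measurable_rbox.
by rewrite ler_wpM2l// Rintegral_rbox.
Qed.

(** * Convolution with a function of bounded support *)

Section convolution.
Variables (g : 'rV[R]_n -> R) (r M : R).
Hypothesis mg : measurable_fun setT g.
Hypothesis gM : forall x, `|g x| <= M.
Hypothesis g0 : forall x, ~ rbox r x -> g x = 0.

Let M0 : 0 <= M. Proof. exact: le_trans (gM 0). Qed.

Lemma convolution_integrable f x : continuous_torus f ->
  mu.-integrable setT (fun y => (f (x - y) * g y)%:E).
Proof.
move=> cf; have [K K0 fK] := periodic_bounded cf.
have := @integrable_support (fun y => f (x - y) * g y) r (K * M); apply.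
- apply: measurable_funM => //.
  exact: (continuous_torus_measurable (continuous_torus_reflect x cf)).
- by move=> y; rewrite normrM ler_pM.
- by move=> y /g0 ->; rewrite mulr0.
Qed.

Lemma convolution_bound f x : continuous_torus f ->
  `|convolution f g x| <= M * (covering_number r * \int[mu]_(y in cube n) `|f y|).
Proof.
move=> cf; have cnf := continuous_torus_norm cf.
have crf := continuous_torus_reflect x cnf.
rewrite -(@Rintegral_cube_reflect (fun y => `|f y|) x); last 2 first.
- exact: continuous_torus_measurable.
- exact: cnf.2.
apply: Rintegral_support_bound => //.
- apply: measurable_funM => //.
  exact: (continuous_torus_measurable (continuous_torus_reflect x cf)).
- by move=> y; rewrite normrM mulrC ler_wpM2r.
- by move=> y /g0 ->; rewrite mulr0.
Qed.

Lemma convolutionB f1 f2 x : continuous_torus f1 -> continuous_torus f2 ->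
  convolution (fun y => f1 y - f2 y) g x = convolution f1 g x - convolution f2 g x.
Proof.
move=> c1 c2; rewrite /convolution.
rewrite -(RintegralB measurableT (convolution_integrable x c1) (convolution_integrable x c2)).
by apply: eq_Rintegral_in => y _; rewrite mulrBl.
Qed.

Lemma convolution_torus f : continuous_torus f -> continuous_torus (convolution f g).
Proof.
move=> cf; split; last first.
  by move=> k x; apply: eq_Rintegral_in => y _; rewrite addrAC cf.2.
pose V := fine (mu (rbox r)).
have V0 : 0 <= V by apply: fine_ge0.
apply: (continuous_modulus (A := M * V) cf); first exact: mulr_ge0.
move=> d e fe x; rewrite /convolution.
have cf' := continuous_torus_shift d cf.
have -> : \int[mu]_y (f (x + d - y) * g y) = \int[mu]_y (f (x - y + d) * g y).
  by apply: eq_Rintegral_in => y _; rewrite addrAC.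
have I1 := convolution_integrable x cf.
have I2 := convolution_integrable x cf'.
rewrite -(RintegralB measurableT I1 I2) (@Rintegral_support _ r); last first.
  by move=> y /g0 ->; rewrite !mulr0 subrr.
apply: (@le_trans _ _ (\int[mu]_(y in rbox r) (M * e))).
  apply: norm_Rintegral_le; first exact: measurable_rbox.
  - apply: (integrableS measurableT) => //; first exact: measurable_rbox.
    by have := integrableB measurableT I1 I2.
  - apply: (@bounded_integrable _ _ (M * e)); rewrite ?lebesgue_rbox_fin//.
      exact: measurable_rbox.
    move=> y _; rewrite ger0_norm// mulr_ge0//.
    exact: le_trans (fe 0).
  - by move=> y _; rewrite -mulrBl normrM mulrC ler_pM.
rewrite Rintegral_cst; last exact: measurable_rbox.
by rewrite mulrAC.
Qed.

End convolution.

End torus_functions.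

(** * The Newtonian kernel *)

Section newton_kernel.
Context {R : realType} {n : nat}.
Local Notation mu := (lebesgue_rV R n).
Implicit Types x y : 'rV[R]_n.

Lemma rV_norm_le x (r : R) : 0 <= r -> (`|x| <= r) <-> rbox r x.
Proof.
move=> r0; split=> [xr|/rboxP xr].
  apply/rboxP => i; apply: le_trans xr.
  rewrite [leRHS]/Num.norm/= mx_normrE; apply/bigmax_geP; right.
  by exists (ord0, i).
rewrite [leLHS]/Num.norm/= mx_normrE; apply/bigmax_leP; split=> // -[i j] _ /=.
by rewrite ord1.
Qed.

Lemma rV_coord_le x i : `|x ord0 i| <= `|x|.
Proof. by have /rboxP := (rV_norm_le x (normr_ge0 x)).1 (lexx _). Qed.

Lemma euclid_norm_ge x : `|x| <= euclid_norm x.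
Proof.
apply/(rV_norm_le _ (sqrtr_ge0 _))/rboxP => i.
rewrite -sqrtr_sqr ler_wsqrtr// (bigD1 i)//= lerDl sumr_ge0// => j _.
exact: sqr_ge0.
Qed.

Lemma euclid_norm_le x : euclid_norm x <= n%:R * `|x|.
Proof.
rewrite -[leRHS]ger0_norm ?mulr_ge0// -sqrtr_sqr ler_wsqrtr//.
apply: (@le_trans _ _ (\sum_(i < n) `|x| ^+ 2)).
  apply: ler_sum => i _; rewrite -[leLHS]real_normK ?num_real//.
  by rewrite lerXn2r ?nnegrE// rV_coord_le.
rewrite sumr_const card_ord exprMn -[leLHS]mulr_natl ler_wpM2r ?sqr_ge0//.
by rewrite -natrX ler_nat; case: (n) => // k; rewrite -mulnn leq_pmulr.
Qed.

Lemma continuous_euclid_norm : continuous (@euclid_norm R n).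
Proof.
have cs (s : seq 'I_n) : continuous (fun x : 'rV[R]_n => \sum_(i <- s) x ord0 i ^+ 2).
  elim: s => [|i s IH].
    by under eq_fun do rewrite big_nil; exact: cst_continuous.
  under eq_fun do rewrite big_cons.
  move=> x; apply: (@continuousD _ _ _ (fun x : 'rV[R]_n => x ord0 i ^+ 2)); last exact: IH.
  apply: (@continuous_comp _ _ _ (fun x : 'rV[R]_n => x ord0 i) (fun t : R => t ^+ 2)).
    exact: coord_continuous.
  exact: exprn_continuous.
by move=> x; apply: continuous_comp; [exact: cs|exact: sqrt_continuous].
Qed.

Lemma measurable_newton_kernel : measurable_fun setT (@newton_kernel R n).
Proof.
have mE := continuous_rV_measurable continuous_euclid_norm.
have -> : @newton_kernel R n =
  fun y => if (n == 2)%N then ln (euclid_norm y ^+ 2) else - (euclid_norm y)^-1 by [].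
case: (n == 2)%N.
  apply: (measurableT_comp (@measurable_ln R)).
  exact: measurable_funX.
apply: measurableT_comp => //.
rewrite (_ : (fun _ => _) = fun y : 'rV[R]_n => (euclid_norm y) `^ (-1)).
  exact: (measurableT_comp (@measurable_powR R (-1)) mE).
by apply/funext => y; rewrite powR_inv1// sqrtr_ge0.
Qed.

(** In dimension 2 the logarithm is dominated by E + 1/E, where E is the
    Euclidean norm; on the cube, E itself is bounded by a multiple of 1/|y|. *)
Lemma newton_kernel_le y : cube n y ->
  `|newton_kernel y| <= 2 * (n%:R * pi ^+ 2 + 1) * `|y|^-1.
Proof.
move=> cy; have yp : `|y| <= pi by apply/(rV_norm_le _ (pi_ge0 _)); exact: cube_ccube.
rewrite /newton_kernel.
have n0 : 0 <= n%:R * pi ^+ 2 :> R by rewrite mulr_ge0// exprn_ge0// pi_ge0.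
have [->|y0] := eqVneq y 0.
  have -> : euclid_norm (0 : 'rV[R]_n) = 0.
    by apply/eqP; rewrite eq_le sqrtr_ge0 andbT (le_trans (euclid_norm_le _))// normr0 mulr0.
  by rewrite expr2 mulr0 ln0// !normr0 !invr0 oppr0 if_same normr0 mulr0.
have ny0 : 0 < `|y| by rewrite normr_gt0.
set E := euclid_norm y.
have yE : `|y| <= E := euclid_norm_ge y.
have E0 : 0 < E by exact: lt_le_trans yE.
have iE : E^-1 <= `|y|^-1 by rewrite lef_pV2.
have iy : 0 <= `|y|^-1 by rewrite invr_ge0.
case: ifP => _; last first.
  have iE0 : 0 <= E^-1 by rewrite invr_ge0 ltW.
  rewrite normrN (ger0_norm iE0) (le_trans iE)//.
  by rewrite ler_peMl//; lra.
rewrite (_ : `|ln (E ^+ 2)| = 2 * `|ln E|); last by rewrite lnXn// normrMn mulr_natl.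
rewrite -mulrA ler_pM2l// mulrDl mul1r.
have lnE : `|ln E| <= E + E^-1.
  rewrite ler_norml; apply/andP; split.
    rewrite lerNl -lnV ?posrE// (le_trans (ltW (ln_sublinear _))) ?invr_gt0//.
    by rewrite lerDr ltW.
  by rewrite (le_trans (ltW (ln_sublinear _)))// lerDl invr_ge0 ltW.
rewrite (le_trans lnE)// lerD// (le_trans (euclid_norm_le y))//.
by rewrite -mulrA ler_wpM2l// expr2 ler_pdivlMr// ler_pM.
Qed.

(** On the shell of points with pi / 2^(k+1) < |y| <= pi / 2^k the function 1/|y|
    is at most the k-th of these step functions, so that their sum dominates it. *)
Definition dyadic_bound (k : nat) y : R := 2 ^+ k.+1 / pi * \1_(rbox (pi / 2 ^+ k)) y.

Lemma dyadic_bound_ge0 k y : 0 <= dyadic_bound k y.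
Proof. by rewrite mulr_ge0// divr_ge0 ?exprn_ge0 ?pi_ge0. Qed.

Lemma inv_norm_le_dyadic y : cube n y ->
  ((`|y|^-1)%:E <= \sum_(0 <= k <oo) (dyadic_bound k y)%:E)%E.
Proof.
move=> cy; have yp : `|y| <= pi by apply/(rV_norm_le _ (pi_ge0 _)); exact: cube_ccube.
have pi0 := pi_gt0 R.
have [->|y0] := eqVneq y 0.
  by rewrite normr0 invr0 nneseries_ge0// => k _ _; rewrite lee_fin; exact: dyadic_bound_ge0.
have ny0 : 0 < `|y| by rewrite normr_gt0.
have ex : exists k, pi / 2 ^+ k.+1 < `|y|.
  exists (Num.truncn (pi / `|y|)).
  rewrite ltr_pdivrMr ?exprn_gt0// mulrC -ltr_pdivrMr//.
  apply: (lt_trans (truncnS_gt _)); rewrite -natrX ltr_nat.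
  exact: ltn_expl.
have [k ky kmin] := ex_minnP ex.
have yk : rbox (pi / 2 ^+ k) y.
  apply/rV_norm_le; first by rewrite divr_ge0// ?exprn_ge0// ltW.
  case: k ky kmin => [|k] ky kmin; first by rewrite expr0 divr1.
  by rewrite leNgt; apply/negP => /kmin; rewrite ltnn.
apply: (@le_trans _ _ (\sum_(0 <= i < k.+1) (dyadic_bound i y)%:E)%E); last first.
  by apply: nneseries_lim_ge => i _ _; rewrite lee_fin dyadic_bound_ge0.
rewrite sumEFin lee_fin big_nat_recr//= ler_wpDl//.
  by apply: sumr_ge0 => i _; exact: dyadic_bound_ge0.
rewrite /dyadic_bound indicE mem_set// mulr1 -[2 ^+ k.+1 / pi]invrK lef_pV2 ?posrE//.
  by rewrite invf_div ltW.
by rewrite invf_div divr_gt0// exprn_gt0.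
Qed.

Lemma lebesgue_rbox (r : R) : 0 <= r -> mu (rbox r) = ((2 * r) ^+ n)%:E.
Proof.
move=> r0; have -> := @lebesgue_rV_box R n (fun=> [set` `[(- r), r]%R]); last first.
  by move=> ?; exact: measurable_itv.
rewrite (eq_bigr (fun=> (2 * r)%:E)); last first.
  move=> i _; rewrite lebesgue_measure_itv/= lte_fin.
  case: ifPn => [_|]; first by rewrite -EFinB opprK mulr2n mulrDl mul1r.
  by rewrite -leNgt => rr; congr EFin; lra.
elim: (n) => [|m IH]; first by rewrite big_ord0 expr0.
by rewrite big_ord_recl IH -EFinM exprS.
Qed.

Lemma measurable_inv_norm : measurable_fun setT (fun y => `|y|^-1).
Proof.
have mN := continuous_rV_measurable (@norm_continuous R 'rV[R]_n).
rewrite (_ : (fun _ => _) = fun y : 'rV[R]_n => `|y| `^ (-1)).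
  exact: (measurableT_comp (@measurable_powR R (-1)) mN).
by apply/funext => y; rewrite powR_inv1.
Qed.

Lemma measurable_dyadic_bound k : measurable_fun setT (dyadic_bound k).
Proof.
apply: measurable_funM => //; apply: measurable_indic; exact: measurable_rbox.
Qed.

(** The measure of the k-th box is of order 2^(- k n) while the step has height of
    order 2^k; for n >= 2 the integrals are summable in k. *)
Lemma integral_dyadic_bound k : (2 <= n)%N ->
  (\int[mu]_(y in cube n) (dyadic_bound k y)%:E <=
   (4 * (2 * pi) ^+ n / pi / (2 ^ k.+1)%:R)%:E)%E.
Proof.
move=> n2; have pi0 := pi_gt0 R.
have c0 : 0 <= 2 ^+ k.+1 / pi :> R by rewrite divr_ge0// ?exprn_ge0// ltW.
under eq_integral do rewrite /dyadic_bound EFinM.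
rewrite ge0_integralZl_EFin//; last 2 first.
- exact: measurable_cubeT.
- by apply/measurable_EFinP/measurable_funTS/measurable_indic; exact: measurable_rbox.
rewrite integral_indic; [|exact: measurable_cubeT|exact: measurable_rbox].
have r0 : 0 <= pi / 2 ^+ k :> R by rewrite divr_ge0// ?exprn_ge0// ltW.
apply: (@le_trans _ _ ((2 ^+ k.+1 / pi)%:E * mu (rbox (pi / 2 ^+ k)))%E).
  have mr : measurable (rbox (pi / 2 ^+ k) : set 'rV[R]_n) by exact: measurable_rbox.
  rewrite lee_wpmul2l ?lee_fin//; apply: le_measure; rewrite ?inE//.
  by apply: measurableI => //; exact: measurable_cubeT.
rewrite lebesgue_rbox// -EFinM lee_fin natrX.
have k0 : 0 < 2 ^+ k :> R by rewrite exprn_gt0.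
rewrite (_ : 2 * (pi / 2 ^+ k) = 2 * pi * (2 ^+ k)^-1) ?mulrA// exprMn.
have : (2 ^+ k)^-1 ^+ n <= (2 ^+ k)^-1 ^+ 2 :> R.
  apply: ler_wiXn2l => //.
  by rewrite invf_le1// exprn_ege1// ler1n.
set X := (2 ^+ k)^-1 ^+ n => XX.
have -> : 4 * (2 * pi) ^+ n / pi / 2 ^+ k.+1 =
   2 ^+ k.+1 / pi * ((2 * pi) ^+ n * (2 ^+ k)^-1 ^+ 2) :> R.
  rewrite exprS; move: ((2 * pi : R) ^+ n) (2 ^+ k : R) k0 (pi : R) pi0 => Q K K0 p p0.
  by field; rewrite !gt_eqF.
by rewrite ler_wpM2l// ler_wpM2l// exprn_ge0// mulr_ge0// ltW.
Qed.

Lemma integrable_inv_norm : (2 <= n)%N ->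
  mu.-integrable (cube n) (fun y => (`|y|^-1)%:E).
Proof.
move=> n2; apply/integrableP; split.
  by apply: measurable_funTS; apply/measurable_EFinP; exact: measurable_inv_norm.
have pi0 := pi_gt0 R.
apply: (@le_lt_trans _ _
    (\int[mu]_(y in cube n) (\sum_(0 <= k <oo) (dyadic_bound k y)%:E))%E).
  apply: ge0_le_integral => //; first exact: measurable_cubeT.
  - apply: measurableT_comp => //; apply: measurable_funTS.
    by apply/measurable_EFinP; exact: measurable_inv_norm.
  - apply: ge0_emeasurable_sum => [k x _ _|k _].
      by rewrite lee_fin dyadic_bound_ge0.
    by apply: measurable_funTS; apply/measurable_EFinP; exact: measurable_dyadic_bound.
  - move=> y cy; rewrite gee0_abs ?lee_fin ?invr_ge0//.
    exact: inv_norm_le_dyadic.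
rewrite integral_nneseries; last 3 first.
- exact: measurable_cubeT.
- by move=> k; apply: measurable_funTS; apply/measurable_EFinP; exact: measurable_dyadic_bound.
- by move=> k x _; rewrite lee_fin dyadic_bound_ge0.
apply: (@le_lt_trans _ _
   (\sum_(0 <= k <oo) (4 * (2 * pi) ^+ n / pi / (2 ^ k.+1)%:R)%:E)%E).
  apply: lee_nneseries => k _; last exact: integral_dyadic_bound.
  by move=> _; apply: integral_ge0 => y _; rewrite lee_fin dyadic_bound_ge0.
apply: (le_lt_trans (epsilon_trick0 _ _)); last exact: ltry.
by rewrite divr_ge0 ?mulr_ge0 ?exprn_ge0 ?mulr_ge0 ?ltW.
Qed.

Lemma newton_kernel_integrable : (2 <= n)%N ->
  mu.-integrable (cube n) (EFin \o @newton_kernel R n).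
Proof.
move=> n2; have := integrableZl (@measurable_cubeT R n) (2 * (n%:R * pi ^+ 2 + 1)) (integrable_inv_norm n2).
apply: le_integrable; first exact: measurable_cubeT.
  by apply: measurable_funTS; apply/measurable_EFinP; exact: measurable_newton_kernel.
move=> y cy; rewrite /= lee_fin (le_trans (newton_kernel_le cy))//.
exact: ler_norm.
Qed.

End newton_kernel.

(** * Test functions *)

Section test_functions.
Context {R : realType} {n : nat}.
Implicit Types (f g : 'rV[R]_n -> R) (x v : 'rV[R]_n).

Lemma is_derive_line f x v s : derivable f (x + s *: v) v ->
  is_derive s 1 (fun t : R => f (x + t *: v)) ('D_v f (x + s *: v)).
Proof.
have E : (fun h : R => h^-1 *: (((fun t : R => f (x + t *: v)) \o shift s) (h *: (1 : R)) - f (x + s *: v))) =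
    (fun h => h^-1 *: ((f \o shift (x + s *: v)) (h *: v) - f (x + s *: v))).
  apply/funext => h /=; congr (_ *: (f _ - _)).
  by rewrite /shift/= scalerDl addrCA (addrC (_ *: v)) -scalerA scale1r addrC addrA.
move=> df; apply: DeriveDef; first by rewrite /derivable E.
by rewrite /derive E.
Qed.

Lemma is_derive_continuous (F dF : R -> R) :
  (forall s : R, is_derive s 1 F (dF s)) -> continuous F.
Proof.
move=> dFE s; apply/differentiable_continuous/derivable1_diffP.
by have [] := dFE s.
Qed.

Lemma mean_value_bound (F dF : R -> R) (h K : R) :
  (forall s : R, is_derive s 1 F (dF s)) ->
  (forall s, `|s| <= `|h| -> `|dF s| <= K) -> `|F h - F 0| <= K * `|h|.
Proof.
move=> dFE dFK; have cF := is_derive_continuous dFE.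
have [h0|h0|->] := ltgtP h 0; last by rewrite subrr !normr0 mulr0.
- have [c /[!in_itv]/= /andP[hc c0]] := MVT h0 (fun s _ => dFE s) (continuous_subspaceT cF).
  rewrite sub0r distrC => ->; rewrite normrM normrN ler_wpM2r// dFK//.
  by rewrite !ltr0_norm// lerN2 ltW.
- have [c /[!in_itv]/= /andP[c0 ch]] := MVT h0 (fun s _ => dFE s) (continuous_subspaceT cF).
  rewrite subr0 => ->; rewrite normrM ler_wpM2r// dFK//.
  by rewrite !gtr0_norm// ltW.
Qed.

Lemma mean_value_line f x v (h K : R) : (forall y, derivable f y v) ->
  (forall y, `|'D_v f y| <= K) -> `|f (x + h *: v) - f x| <= K * `|h|.
Proof.
move=> df fK.
have := @mean_value_bound (fun t => f (x + t *: v)) (fun t => 'D_v f (x + t *: v)) h K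
  (fun s => is_derive_line (df _)) (fun s _ => fK _).
by rewrite scale0r addr0.
Qed.

Lemma taylor_line f x v (h K : R) : (forall y, derivable f y v) ->
  (forall y, derivable ('D_v f) y v) -> (forall y, `|'D_v ('D_v f) y| <= K) ->
  `|f (x + h *: v) - f x - h * 'D_v f x| <= K * h ^+ 2.
Proof.
move=> df ddf fK.
have K0 : 0 <= K by exact: le_trans (fK 0).
have dF (s : R) : is_derive s 1 (fun t : R => f (x + t *: v) - t * 'D_v f x)
    ('D_v f (x + s *: v) - 'D_v f x).
  have H := is_derive_line (df (x + s *: v)).
  apply: is_deriveB.
  have := @is_deriveM R R id (cst ('D_v f x)) s 1 1 0 (is_derive_id s 1) (is_derive_cst _ s 1).
  by rewrite scaler0 add0r /cst/= -[_ *: 1]/(_ * 1) mulr1.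
have := @mean_value_bound _ _ h (K * `|h|) dF.
rewrite scale0r addr0 mul0r subr0 -mulrA -expr2 real_normK ?num_real// addrAC.
apply=> s sh; rewrite (le_trans (mean_value_line x s ddf fK))//.
by rewrite ler_wpM2l.
Qed.

(** The criterion by which the derivatives of the potential are computed. *)
Lemma derive_quadratic f x v (l C : R) :
  (forall h : R, `|h| <= 1 -> `|f (x + h *: v) - f x - h * l| <= C * h ^+ 2) ->
  is_derive x v f l.
Proof.
move=> fC.
have C0 : 0 <= C.
  by have := fC 1; rewrite normr1 lexx expr1n mulr1 => /(_ isT); exact: le_trans.
have cv : (fun h : R => h^-1 *: ((f \o shift x) (h *: v) - f x)) @ (0 : R)^' --> l.
  apply/cvgrPdist_le => e e0.
  have C1 : 0 < C + 1 by rewrite ltr_wpDl.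
  near=> h.
  have h0 : h != 0 by near: h; exact: nbhs_dnbhs_neq.
  have h1 : `|h| <= 1.
    near: h; apply: nbhs_dnbhs; exists 1 => //= z; rewrite /ball/= sub0r normrN.
    exact: ltW.
  have hd : `|h| <= e / (C + 1).
    near: h; apply: nbhs_dnbhs; exists (e / (C + 1)) => /=; first by rewrite divr_gt0.
    by move=> z; rewrite /ball/= sub0r normrN; exact: ltW.
  rewrite distrC (_ : _ - l = h^-1 * (f (x + h *: v) - f x - h * l)); last first.
    by rewrite /= (addrC x) mulrBr mulrA mulVf// mul1r.
  rewrite normrM normfV ler_pdivrMl ?normr_gt0//.
  apply: (le_trans (fC h h1)); rewrite -(real_normK (num_real h)) expr2 mulrCA ler_wpM2l//.
  rewrite (le_trans (ler_wpM2l C0 hd))// mulrA ler_pdivrMr// mulrC ler_pM2l//.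
  by rewrite lerDl.
apply: DeriveDef; first by apply/cvg_ex; exists l.
exact/cvg_lim.
Unshelve. all: by end_near.
Qed.

Lemma measurable_torus_repr : measurable_fun setT (@torus_repr R n).
Proof.
have mfl : measurable_fun (setT : set (measurableTypeR R)) (fun t : measurableTypeR R => (Num.floor t)%:~R : R).
  move=> _ Y mY; rewrite setTI.
  rewrite (_ : _ @^-1` Y = \bigcup_(z : int)
     (if z%:~R \in Y then [set` `[z%:~R : R, (z + 1)%:~R[%R] else set0)).
    apply: countable_bigcupT_measurable; first exact: countableP.
    by move=> z; case: ifP => _; [exact: measurable_itv|exact: measurable0].
  apply/seteqP; split=> [t Yt|t [z _]].
    exists (Num.floor t) => //; rewrite mem_set// /= in_itv/=; exact: floor_itv.
  case: ifPn => // /set_mem zY; rewrite /= in_itv/= => tz.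
  by rewrite /preimage/= (floor_def tz).
apply/measurable_fun_rVP => i; under eq_fun do rewrite mxE.
apply: measurable_funB; first exact: measurable_coord_rV.
apply: measurable_funM => //.
apply: (measurableT_comp mfl); apply: measurable_funM => //.
by apply: measurable_funD => //; exact: measurable_coord_rV.
Qed.

(** It gives the derivatives of a test function the support of the function. *)
Lemma derive_near0 f x v : (\near x, f x = 0) -> 'D_v f x = 0.
Proof.
move=> f0; rewrite (@near_eq_derive _ _ _ f (cst 0) x v)//.
exact: derive_cst.
Qed.

(** What the estimates use of a test function.  Second derivatives are hidden in
    the Taylor remainder, and one constant [M] serves for all the bounds. *)
Record c2_bounded (f : 'rV[R]_n -> R) (df : 'I_n -> 'rV[R]_n -> R) (B M : R) : Prop := {
  c2_ge0 : 0 <= B ;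
  c2_continuous : continuous f ;
  c2_dcontinuous : forall k, continuous (df k) ;
  c2_support : forall x, ~ rbox B x -> f x = 0 ;
  c2_dsupport : forall k x, ~ rbox B x -> df k x = 0 ;
  c2_bound : forall x, `|f x| <= M ;
  c2_dbound : forall k x, `|df k x| <= M ;
  c2_taylor : forall k x (h : R), 
    `|f (x + h *: basis_rV k) - f x - h * df k x| <= M * h ^+ 2 ;
  c2_lipschitz : forall k x (h : R), `|f (x + h *: basis_rV k) - f x| <= M * `|h| }.

Lemma compact_support_bounded f B : 0 <= B -> continuous f ->
  (forall x, ~ rbox B x -> f x = 0) -> exists M : R, forall x, `|f x| <= M.
Proof.
move=> B0 cf f0.
have cb : compact (rbox B : set 'rV[R]_n).
  have := @rV_compact R n (fun=> [set` `[(- B), B]%R]).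
  by move=> /(_ (fun=> @segment_compact R _ _)).
have b0 : rbox B (0 : 'rV[R]_n) by apply/rboxP => i; rewrite mxE normr0.
have cnf : continuous (fun x => `|f x|).
  by move=> x; apply: continuous_comp; [exact: cf|exact: norm_continuous].
have [c _ cm] := @EVT_max_rV R n _ _ (ex_intro _ 0 b0) cb (continuous_subspaceT cnf).
exists `|f c| => x; have [xb|/f0 ->] := pselect (rbox B x); last by rewrite normr0.
by apply: cm; rewrite inE.
Qed.

Lemma test_function_c2 f : test_function f ->
  exists B M, c2_bounded f (fun k => 'D_(basis_rV k) f) B M.
Proof.
move=> [sf]; set S := closure _ => cS.
have [B B0 SB] : exists2 B : R, 0 <= B & forall x, ~ rbox B x -> ~ S x.
  have [M0 [_ SM]] := compact_bounded cS.
  exists (`|M0| + 1); first exact: addr_ge0.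
  move=> x nx Sx; apply: nx; apply/(rV_norm_le _ (addr_ge0 _ _)) => //.
  by apply: (SM (`|M0| + 1)) => //; rewrite (le_lt_trans (ler_norm _))// ltrDl.
have oS : open (~` S) by apply/closed_openC/closed_closure.
have zero (g : 'rV[R]_n -> R) k : (forall x, ~ S x -> g x = 0) -> forall x, ~ S x -> 'D_(basis_rV k) g x = 0.
  move=> g0 x Sx; apply: derive_near0.
  have : nbhs x (~` S) by apply: open_nbhs_nbhs.
  by apply: filterS => y /g0.
have f0 x : ~ S x -> f x = 0.
  move=> Sx; apply: contrapT => /eqP fx; apply: Sx.
  exact: subset_closure.
have d0 k := zero f k f0.
have dd0 k := zero _ k (d0 k).
have [cf df] := sf [::].
have [Mf Mfb] := compact_support_bounded B0 cf (fun x xB => f0 x (SB x xB)).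
have dk k := sf [:: k].
have ddk k := sf [:: k; k].
have Mdb k := compact_support_bounded B0 (dk k).1 (fun x xB => d0 k x (SB x xB)).
have Mddb k := compact_support_bounded B0 (ddk k).1 (fun x xB => dd0 k x (SB x xB)).
pose Md k := sval (cid (Mdb k)); pose Mdd k := sval (cid (Mddb k)).
have MdP k x : `|'D_(basis_rV k) f x| <= Md k by exact: (svalP (cid (Mdb k)) x).
have MddP k x : `|'D_(basis_rV k) ('D_(basis_rV k) f) x| <= Mdd k by exact: (svalP (cid (Mddb k)) x).
pose M := `|Mf| + \sum_k `|Md k| + \sum_k `|Mdd k|.
have sd k : `|Md k| <= \sum_k `|Md k| by rewrite (bigD1 k)//= lerDl sumr_ge0.
have sdd k : `|Mdd k| <= \sum_k `|Mdd k| by rewrite (bigD1 k)//= lerDl sumr_ge0.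
have s0 (F : 'I_n -> R) : 0 <= \sum_k `|F k| by apply: sumr_ge0.
have MfM : Mf <= M by rewrite /M -addrA ler_wpDr ?addr_ge0// ler_norm.
have MdM k : Md k <= M.
  rewrite /M addrAC ler_wpDl ?addr_ge0//.
  exact: le_trans (ler_norm _) (sd k).
have MddM k : Mdd k <= M.
  rewrite /M ler_wpDl ?addr_ge0//.
  exact: le_trans (ler_norm _) (sdd k).
exists B, M; split => //.
- by move=> k; exact: (dk k).1.
- by move=> x /SB/f0.
- by move=> k x /SB/d0.
- by move=> x; apply: le_trans (Mfb x) MfM.
- by move=> k x; apply: le_trans (MdP k x) (MdM k).
- move=> k x h; apply: taylor_line => [y|y|y]; [exact: df|exact: (dk k).2|].
  exact: le_trans (MddP k y) (MddM k).
- move=> k x h; apply: mean_value_line => y; first exact: df.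
  exact: le_trans (MdP k y) (MdM k).
Qed.

End test_functions.

(** * The gravitational acceleration *)

Section potential.
Context {R : realType} {n : nat}.
Hypothesis n2 : (2 <= n)%N.
Local Notation mu := (lebesgue_rV R n).
Implicit Types (s r f g : 'rV[R]_n -> R) (x : 'rV[R]_n).

Definition kernel_mass : R := \int[mu]_(y in cube n) `|newton_kernel y|.

Lemma kernel_mass_ge0 : 0 <= kernel_mass.
Proof. exact: Rintegral_ge0. Qed.

Definition newton_convolution s x : R := \int[mu]_(y in cube n) (s (x - y) * newton_kernel y).

Lemma newton_convolution_integrable s x : continuous_torus s ->
  mu.-integrable (cube n) (fun y => (s (x - y) * newton_kernel y)%:E).
Proof.
move=> cs; have [M M0 sM] := periodic_bounded cs.
have := integrableZl (@measurable_cubeT R n) M (newton_kernel_integrable n2).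
apply: le_integrable; first exact: measurable_cubeT.
  apply: measurable_funTS; apply/measurable_EFinP; apply: measurable_funM.
    exact: (continuous_torus_measurable (continuous_torus_reflect x cs)).
  exact: measurable_newton_kernel.
by move=> y _; rewrite /= lee_fin !normrM (ger0_norm M0) ler_wpM2r.
Qed.

Lemma newton_convolution_bound s x (M : R) : continuous_torus s ->
  (forall y, `|s y| <= M) -> `|newton_convolution s x| <= M * kernel_mass.
Proof.
move=> cs sM.
have IK := integrable_norm (@newton_kernel_integrable R n n2).
rewrite -(RintegralZl M (@measurable_cubeT R n) IK).
apply: norm_Rintegral_le.
- exact: measurable_cubeT.
- exact: newton_convolution_integrable.
- by have := integrableZl (@measurable_cubeT R n) M IK.
- by move=> y _; rewrite normrM ler_wpM2r.
Qed.

Lemma newton_convolutionB s1 s2 x : continuous_torus s1 -> continuous_torus s2 ->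
  newton_convolution (fun y => s1 y - s2 y) x =
  newton_convolution s1 x - newton_convolution s2 x.
Proof.
move=> c1 c2; rewrite /newton_convolution -RintegralB.
- by apply: eq_Rintegral_in => y _; rewrite mulrBl.
- exact: measurable_cubeT.
- exact: newton_convolution_integrable.
- exact: newton_convolution_integrable.
Qed.

Lemma newton_convolutionZ (c : R) s x : continuous_torus s ->
  newton_convolution (fun y => c * s y) x = c * newton_convolution s x.
Proof.
move=> cs; rewrite /newton_convolution -RintegralZl.
- by apply: eq_Rintegral_in => y _; rewrite mulrA.
- exact: measurable_cubeT.
- exact: newton_convolution_integrable.
Qed.

Lemma newton_convolution_shift s x (a : 'rV[R]_n) :
  newton_convolution s (x + a) = newton_convolution (fun y => s (y + a)) x.
Proof. by apply: eq_Rintegral_in => y _; rewrite addrAC. Qed.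

Lemma newton_convolution_torus s : continuous_torus s -> continuous_torus (newton_convolution s).
Proof.
move=> cs; split; last first.
  by move=> k x; rewrite newton_convolution_shift; apply: eq_Rintegral_in => y _; rewrite cs.2.
apply: (continuous_modulus (A := kernel_mass) cs); first exact: kernel_mass_ge0.
move=> d e se x.
have cs' := continuous_torus_shift d cs.
rewrite newton_convolution_shift -newton_convolutionB// mulrC.
by apply: newton_convolution_bound => //; exact: continuous_torusB.
Qed.

(** The substitution y = x - xi turns the representative of the difference into
    the integration variable, because the integrand is periodic in xi. *)
Lemma newton_potentialE (G : R) s x : continuous_torus s ->
  newton_potential G s x = G * newton_convolution s x.
Proof.
move=> cs; rewrite /newton_potential; congr (_ * _).
have mK : measurable_fun setT (fun xi : 'rV[R]_n => newton_kernel (torus_repr (x - xi)) : R).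
  apply: measurableT_comp; first exact: measurable_newton_kernel.
  apply: measurableT_comp; first exact: measurable_torus_repr.
  rewrite (_ : (fun _ => _) = (fun y : 'rV[R]_n => (-1) *: y + x)); first exact: measurable_rV_affine.
  by apply/funext => y /=; rewrite scaleN1r addrC.
have mF : measurable_fun setT (fun xi : 'rV[R]_n => s xi * newton_kernel (torus_repr (x - xi))).
  by apply: measurable_funM => //; exact: continuous_torus_measurable.
rewrite torus_Rintegral// -(Rintegral_cube_reflect x mF).
  by apply: eq_Rintegral_in => y cy; rewrite subKr torus_repr_id.
by move=> k y; rewrite cs.2 opprD addrA -(torus_repr_periodic (x - y - _) k) subrK.
Qed.

Section mollified.
Variables (w : 'rV[R]_n -> R) (dw : 'I_n -> 'rV[R]_n -> R) (B M D : R) (G : R).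
Hypothesis mw : measurable_fun setT w.
Hypothesis mdw : forall j, measurable_fun setT (dw j).
Hypothesis wM : forall x, `|w x| <= M.
Hypothesis dwM : forall j x, `|dw j x| <= M.
Hypothesis w0 : forall x, ~ rbox B x -> w x = 0.
Hypothesis dw0 : forall j x, ~ rbox B x -> dw j x = 0.
Hypothesis w_taylor : forall j x (h : R),
  `|w (x + h *: basis_rV j) - w x - h * dw j x| <= D * h ^+ 2.
Hypothesis G0 : 0 <= G.

Let N := @covering_number R n (B + 1).

(** The derivative falls on the mollifier, since [r] is merely continuous. *)
Lemma convolution_taylor r j x (h : R) : continuous_torus r -> `|h| <= 1 ->
  `|convolution r w (x + h *: basis_rV j) - convolution r w x - h * convolution r (dw j) x|
  <= D * h ^+ 2 * (N * \int[mu]_(y in cube n) `|r y|).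
Proof.
move=> cr h1; set v := h *: basis_rV j.
have mwv := measurable_shift v mw.
have wv0 y : ~ rbox (B + 1) y -> w (y + v) = 0.
  move=> yB; apply: w0 => /rboxP yvB; apply: yB; apply/rboxP => i.
  have := yvB i; rewrite !mxE eqxx/=; case: (i == j) => /=; last first.
    by rewrite mulr0 addr0 => /le_trans; apply; rewrite lerDl.
  rewrite mulr1 => H; rewrite -[y ord0 i](addrK h) (le_trans (ler_normB _ _))//.
  by rewrite lerD.
have sE : convolution r w (x + v) = convolution r (fun y => w (y + v)) x.
  rewrite /convolution -[LHS](Rintegral_translate v).
    by apply: eq_Rintegral_in => y _; rewrite opprD addrACA subrr addr0.
  apply: measurable_funM => //.
  exact: (continuous_torus_measurable (continuous_torus_reflect (x + v) cr)).
have I1 := convolution_integrable mwv (fun y => wM (y + v)) wv0 x cr.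
have I2 := convolution_integrable mw wM w0 x cr.
have I3 := convolution_integrable (mdw j) (dwM j) (dw0 j) x cr.
have I3' : mu.-integrable setT (fun y => (h * (r (x - y) * dw j y))%:E).
  by have := integrableZl measurableT h I3.
have I12 : mu.-integrable setT (fun y => (r (x - y) * w (y + v) - r (x - y) * w y)%:E).
  by have := integrableB measurableT I1 I2.
rewrite sE (_ : _ - _ - _ = convolution r (fun y => w (y + v) - w y - h * dw j y) x).
  apply: convolution_bound => //.
  - apply: measurable_funB; first exact: measurable_funB.
    exact: measurable_funM.
  - by move=> y; exact: w_taylor.
  - by move=> y yB; rewrite wv0// w0 ?dw0 ?mulr0 ?subr0//; by apply: subset_rbox yB; rewrite lerDl.
rewrite /convolution -(RintegralZl h measurableT I3) -(RintegralB measurableT I1 I2).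
rewrite -(RintegralB measurableT I12 I3').
by apply: eq_Rintegral_in => y _; rewrite !mulrBr (mulrCA h).
Qed.

Lemma newton_potential_derive r j x : continuous_torus r ->
  is_derive x (basis_rV j) (newton_potential G (convolution r w))
    (G * newton_convolution (convolution r (dw j)) x).
Proof.
move=> cr.
have cs := convolution_torus mw wM w0 cr.
have cds := convolution_torus (mdw j) (dwM j) (dw0 j) cr.
pose I := \int[mu]_(y in cube n) `|r y|.
apply: (@derive_quadratic _ _ _ _ _ _ (G * (D * (N * I) * kernel_mass))) => h h1.
have csv := continuous_torus_shift (h *: basis_rV j) cs.
have chd := continuous_torusM (continuous_torus_cst h) cds.
have c1 := continuous_torusB csv cs.
have c2 := continuous_torusB c1 chd.
rewrite !newton_potentialE// newton_convolution_shift mulrCA -!mulrBr.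
rewrite -newton_convolutionZ// -!newton_convolutionB//.
rewrite normrM ger0_norm// -mulrA ler_wpM2l// mulrAC -!mulrA.
rewrite (_ : D * _ = D * h ^+ 2 * (N * I) * kernel_mass); last by ring.
by apply: newton_convolution_bound => // y; exact: convolution_taylor.
Qed.

Lemma newton_potential_deriveE r j x : continuous_torus r ->
  'D_(basis_rV j) (newton_potential G (convolution r w)) x =
  G * newton_convolution (convolution r (dw j)) x.
Proof. by move=> cr; have H := newton_potential_derive j x cr; exact: derive_val. Qed.

Lemma newton_potential_derive_bound r j x : continuous_torus r ->
  `|'D_(basis_rV j) (newton_potential G (convolution r w)) x| <=
  G * (M * (@covering_number R n B * \int[mu]_(y in cube n) `|r y|) * kernel_mass).
Proof.
move=> cr; rewrite newton_potential_deriveE// normrM ger0_norm// ler_wpM2l//.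
apply: newton_convolution_bound; first exact: (convolution_torus (mdw j) (dwM j) (dw0 j) cr).
by move=> y; exact: (convolution_bound (mdw j) (dwM j) (dw0 j) _ cr).
Qed.

Lemma newton_potential_derive_torus r j : continuous_torus r ->
  continuous_torus ('D_(basis_rV j) (newton_potential G (convolution r w))).
Proof.
move=> cr.
have cds := convolution_torus (mdw j) (dwM j) (dw0 j) cr.
rewrite (_ : 'D_(basis_rV j) _ = (fun x => G * newton_convolution (convolution r (dw j)) x)).
  apply: continuous_torusM; first exact: continuous_torus_cst.
  exact: newton_convolution_torus.
by apply/funext => x; exact: newton_potential_deriveE.
Qed.

Lemma newton_potential_deriveB r1 r2 j x : continuous_torus r1 -> continuous_torus r2 ->
  'D_(basis_rV j) (newton_potential G (convolution (fun y => r1 y - r2 y) w)) x =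
  'D_(basis_rV j) (newton_potential G (convolution r1 w)) x -
  'D_(basis_rV j) (newton_potential G (convolution r2 w)) x.
Proof.
move=> c1 c2.
have E1 := newton_potential_deriveE j x c1.
have E2 := newton_potential_deriveE j x c2.
apply: (eq_trans (newton_potential_deriveE j x (continuous_torusB c1 c2))).
apply: (eq_trans _ (esym (congr2 (fun a b => a - b) E1 E2))).
have cd1 := convolution_torus (mdw j) (dwM j) (dw0 j) c1.
have cd2 := convolution_torus (mdw j) (dwM j) (dw0 j) c2.
rewrite -mulrBr; congr (_ * _); apply: (eq_trans _ (newton_convolutionB x cd1 cd2)).
by apply: eq_Rintegral_in => y _; congr (_ * _); exact: (convolutionB (mdw j) (dwM j) (dw0 j) _ c1 c2).
Qed.

End mollified.

Section mollifier.
Variables (phi : 'rV[R]_n -> R) (dphi : 'I_n -> 'rV[R]_n -> R) (B M : R).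
Hypothesis c2phi : c2_bounded phi dphi B M.
Variables (G alpha eps : R).
Hypotheses (G0 : 0 <= G) (alpha0 : 0 <= alpha) (eps01 : 0 < eps <= 1).

Let c := eps `^ (- (n%:R * alpha)).
Let l := (eps `^ alpha)^-1.
Let w := mollifier alpha eps phi.
Let dw j x := c * (l * dphi j (l *: x)).

Let c0 : 0 <= c. Proof. exact: powR_ge0. Qed.

Let eps0 : 0 < eps. Proof. by case/andP: eps01. Qed.

Let l1 : 1 <= l.
Proof.
have ea : 0 < eps `^ alpha by apply: powR_gt0.
rewrite invf_ge1//; case/andP: eps01 => _ e1.
have -> : 1 = 1 `^ alpha :> R by rewrite powR1.
by apply: ge0_ler_powR => //; rewrite nnegrE// ltW.
Qed.

Let clE : c * l = eps `^ (- (n.+1%:R * alpha)).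
Proof.
rewrite /c /l -powRN -powRD; last by apply/implyP => _; rewrite gt_eqF.
by congr (_ `^ _); rewrite -natr1; ring.
Qed.

Let scaled x : ~ rbox B x -> ~ rbox B (l *: x).
Proof.
move=> xB /rboxP lxB; apply: xB; apply/rboxP => i; apply: le_trans (lxB i).
by rewrite mxE normrM ger0_norm ?(le_trans _ l1)// ler_peMl.
Qed.

Let M0 : 0 <= M. Proof. exact: le_trans (c2_bound c2phi 0). Qed.

Let mscaled (f : 'rV[R]_n -> R) : continuous f -> measurable_fun setT (fun x : 'rV[R]_n => f (l *: x)).
Proof.
move=> cf; rewrite (_ : (fun _ => _) = f \o (fun x : 'rV[R]_n => l *: x + 0)).
  apply: measurableT_comp; first exact: continuous_rV_measurable.
  exact: measurable_rV_affine.
by apply/funext => x /=; rewrite addr0.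
Qed.

Lemma measurable_mollifier : measurable_fun setT w.
Proof. by apply: measurable_funM => //; exact: (mscaled (c2_continuous c2phi)). Qed.

Let mdw j : measurable_fun setT (dw j).
Proof.
apply: measurable_funM => //; apply: measurable_funM => //.
by apply: mscaled; exact: (c2_dcontinuous c2phi).
Qed.

Lemma mollifier_bound x : `|w x| <= eps `^ (- (n.+1%:R * alpha)) * M.
Proof.
rewrite -clE /w /mollifier normrM (ger0_norm c0) -mulrA ler_wpM2l//.
apply: (le_trans (c2_bound c2phi _)); exact: ler_peMl.
Qed.

Let dwM j x : `|dw j x| <= eps `^ (- (n.+1%:R * alpha)) * M.
Proof.
have l0 : 0 <= l by exact: le_trans l1.
rewrite -clE /dw !normrM (ger0_norm c0) (ger0_norm l0) -mulrA ler_wpM2l// ler_wpM2l//.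
exact: (c2_dbound c2phi).
Qed.

Let w0 x : ~ rbox B x -> w x = 0.
Proof. by move=> /scaled/(c2_support c2phi) E; rewrite /w /mollifier E mulr0. Qed.

Let dw0 j x : ~ rbox B x -> dw j x = 0.
Proof. by move=> /scaled/(c2_dsupport c2phi) E; rewrite /dw E !mulr0. Qed.

Let w_taylor j x (h : R) :
  `|w (x + h *: basis_rV j) - w x - h * dw j x| <= c * (M * l ^+ 2) * h ^+ 2.
Proof.
have := c2_taylor c2phi j (l *: x) (l * h); rewrite -scalerA -scalerDr => H.
rewrite (_ : _ - _ - _ = c * (phi (l *: (x + h *: basis_rV j)) - phi (l *: x)
   - l * h * dphi j (l *: x))); last by rewrite /w /mollifier /dw -/c -/l; ring.
rewrite normrM (ger0_norm c0) -(mulrA c) ler_wpM2l// (le_trans H)//.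
by rewrite exprMn mulrA.
Qed.

Lemma potential_derivable r j x : continuous_torus r ->
  derivable (potential G alpha phi eps r) x (basis_rV j).
Proof.
move=> cr; have := newton_potential_derive measurable_mollifier mdw mollifier_bound dwM w0 dw0 w_taylor G0 j x cr.
by case.
Qed.

Lemma acceleration_torus r j : continuous_torus r ->
  continuous_torus ('D_(basis_rV j) (potential G alpha phi eps r)).
Proof. exact: (newton_potential_derive_torus measurable_mollifier mdw mollifier_bound dwM w0 dw0 w_taylor G0). Qed.

Lemma accelerationB r1 r2 j x : continuous_torus r1 -> continuous_torus r2 ->
  'D_(basis_rV j) (potential G alpha phi eps (fun y => r1 y - r2 y)) x =
  'D_(basis_rV j) (potential G alpha phi eps r1) x -
  'D_(basis_rV j) (potential G alpha phi eps r2) x.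
Proof. exact: (newton_potential_deriveB measurable_mollifier mdw mollifier_bound dwM w0 dw0 w_taylor G0). Qed.

(** The gradient of the mollifier is of order eps^(-(n+1) alpha), and the two
    convolutions only bring in the mass of the fluid and that of the kernel; the
    bound thus blows up as slowly in eps as alpha is small. *)
Lemma acceleration_bound r j x : continuous_torus r ->
  `|'D_(basis_rV j) (potential G alpha phi eps r) x| <=
  G * (M * @covering_number R n B * kernel_mass) * eps `^ (- (n.+1%:R * alpha)) *
  \int[mu]_(y in cube n) `|r y|.
Proof.
move=> cr; apply: le_trans
  (newton_potential_derive_bound measurable_mollifier mdw mollifier_bound dwM w0 dw0 w_taylor G0 j x cr) _.
rewrite le_eqVlt; apply/orP; left; apply/eqP.
by move: kernel_mass (covering_number _) (Rintegral _ _ _) (_ `^ _) => a b e d; ring.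
Qed.

End mollifier.
End potential.

(** * Ordinary differential equations in the space of continuous functions on the torus *)

Section scalar.
Context {R : realType}.

(** Error bounds are stated as geometric sequences throughout; this replaces the
    passage to the limit. *)
Lemma le0_geometric (z b : R) : (forall k, z <= b / 2 ^+ k) -> z <= 0.
Proof.
move=> zb; rewrite leNgt; apply/negP => z0.
pose k := Num.truncn (b / z).
have := zb k; rewrite leNgt => /negP; apply.
rewrite ltr_pdivrMr ?exprn_gt0// mulrC -ltr_pdivrMr//.
apply: (lt_le_trans (truncnS_gt _)).
by rewrite -natrX ler_nat ltn_expl.
Qed.

Lemma le_geometric (y z b : R) : (forall k, y <= z + b / 2 ^+ k) -> y <= z.
Proof.
move=> H; rewrite -subr_le0; apply: (@le0_geometric _ b) => k.
by rewrite lerBlDl.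
Qed.

Lemma geometric_limit (u : nat -> R) (a : R) :
  (forall k, `|u k.+1 - u k| <= a / 2 ^+ k) ->
  exists l : R, forall k, `|l - u k| <= 2 * a / 2 ^+ k.
Proof.
move=> ua.
have p2 k : 0 < 2 ^+ k :> R by rewrite exprn_gt0.
have a2 k : 2 * a / 2 ^+ k.+1 = a / 2 ^+ k.
  by rewrite exprS invfM mulrACA divff ?mul1r ?gt_eqF.
have a2' k : 2 * a / 2 ^+ k = a / 2 ^+ k + a / 2 ^+ k by rewrite -mulrA mulrDl !mul1r.
pose v k := u k - 2 * a / 2 ^+ k; pose w k := u k + 2 * a / 2 ^+ k.
have vS k : v k <= v k.+1.
  by have := ua k; rewrite ler_norml => /andP[]; rewrite /v a2 a2'; lra.
have wS k : w k.+1 <= w k.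
  by have := ua k; rewrite ler_norml => /andP[]; rewrite /w a2 a2'; lra.
have a0 : 0 <= a by have := le_trans (normr_ge0 _) (ua 0%N); rewrite expr0 divr1.
have vw k : v k <= w k.
  have : 0 <= 2 * a / 2 ^+ k by rewrite !mulr_ge0// invr_ge0 ltW.
  by rewrite /v /w; lra.
have vm k m : v k <= v (k + m)%N.
  elim: m => [|m IH]; first by rewrite addn0.
  by rewrite addnS (le_trans IH).
have wm k m : w (k + m)%N <= w k.
  elim: m => [|m IH]; first by rewrite addn0.
  by rewrite addnS (le_trans (wS _)).
have vkw k m : v m <= w k.
  by apply: (le_trans (vm m k)); rewrite addnC (le_trans (vw _)).
exists (sup (range v)) => k; rewrite ler_norml; apply/andP; split.
  have : v k <= sup (range v).
    by apply: ub_le_sup; [exists (w k) => _ [m _ <-]; exact: vkw|exists k].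
  by rewrite /v; lra.
have : sup (range v) <= w k.
  by apply: ge_sup; [exists (v 0%N), 0%N|move=> _ [m _ <-]; exact: vkw].
by rewrite /w; lra.
Qed.

Definition locally_lipschitz (f : R -> R) := forall T : R, exists K : R,
  forall s t : R, 0 <= s <= T -> 0 <= t <= T -> `|f t - f s| <= K * `|t - s|.

(** The integral of [f] from 0 to t.  As [f] is only meaningful at nonnegative
    times, it is extended by [f 0] to the left, and the integration starts at -1;
    then 0 is an interior point, and the primitive is differentiable there. *)
Definition primitive (f : R -> R) (t : R) : R :=
  \int[lebesgue_measure]_(s in [set` `[(-1), t]]) f (Num.max s 0) -
  \int[lebesgue_measure]_(s in [set` `[(-1), 0]]) f (Num.max s 0).

Lemma maxr0_lipschitz (s t : R) : `|Num.max t 0 - Num.max s 0| <= `|t - s|.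
Proof.
have A := ler_norm (t - s).
have B : s - t <= `|t - s| by rewrite distrC ler_norm.
have [h1|h1] := ltP t 0; have [h2|h2] := ltP s 0; rewrite ?subrr ?normr0//.
- by rewrite sub0r normrN (ger0_norm h2); lra.
- by rewrite subr0 (ger0_norm h1); lra.
Qed.

Lemma locally_lipschitz_continuous f : locally_lipschitz f ->
  continuous (fun s : R => f (Num.max s 0)).
Proof.
move=> lf s; apply/cvgrPdist_lt => e e0.
have [K fK] := lf (Num.max s 0 + 1).
have K0 : 0 < `|K| + 1 by rewrite ltr_wpDl.
near=> t.
have st : `|t - s| < Num.min 1 (e / (`|K| + 1)).
  rewrite distrC; near: t; exists (Num.min 1 (e / (`|K| + 1))) => //=.
  by rewrite lt_min ltr01 divr_gt0.
rewrite lt_min in st; case/andP: st => st1 st2.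
have M0 (z : R) : 0 <= Num.max z 0 by rewrite le_max lexx orbT.
have := maxr0_lipschitz s t => ml.
rewrite distrC; apply: (@le_lt_trans _ _ (K * `|Num.max t 0 - Num.max s 0|)).
  apply: fK; rewrite M0/= ?lerDl//.
  by have := ler_norm (Num.max t 0 - Num.max s 0); lra.
apply: (@le_lt_trans _ _ ((`|K| + 1) * `|t - s|)).
  apply: (@le_trans _ _ (`|K| * `|Num.max t 0 - Num.max s 0|)).
    by rewrite ler_wpM2r// ler_norm.
  by apply: ler_pM => //; rewrite lerDl.
by rewrite mulrC -ltr_pdivlMr.
Unshelve. all: by end_near.
Qed.

Lemma is_derive_primitive (f : R -> R) (t : R) : locally_lipschitz f -> 0 <= t ->
  is_derive t 1 (primitive f) (f t).
Proof.
move=> lf t0; have cf := locally_lipschitz_continuous lf.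
have tu : t < t + 1 by rewrite ltrDl.
have If : lebesgue_measure.-integrable [set` `[(-1), (t + 1)]] (EFin \o (fun s => f (Num.max s 0))).
  apply: continuous_compact_integrable; first exact: segment_compact.
  exact: continuous_subspaceT.
have := @continuous_FTC1 R (fun s => f (Num.max s 0)) (BLeft (-1)) t (t + 1) tu If.
move=> /(_ _ (cf t)) [].
  by rewrite /= lte_fin; lra.
move=> d1 d2.
have -> : f t = f (Num.max t 0) - 0 by rewrite subr0 max_l.
apply: (@is_deriveB R R R
  (fun y => \int[lebesgue_measure]_(s in [set` `[(-1), y]]) f (Num.max s 0))
  (cst _) t 1 (f (Num.max t 0)) 0).
by apply: DeriveDef; [exact: d1|rewrite -derive1E; exact: d2].
Qed.

Lemma primitive0 f : primitive f 0 = 0.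
Proof. by rewrite /primitive subrr. Qed.

Lemma eq_primitive (f g : R -> R) t : (forall s, 0 <= s -> f s = g s) ->
  primitive f t = primitive g t.
Proof.
move=> fg; rewrite /primitive; congr (_ - _); apply: eq_Rintegral => s _.
  by rewrite fg// le_max lexx orbT.
by rewrite fg// le_max lexx orbT.
Qed.

Lemma mean_value_nonneg (F dF : R -> R) (a b : R) : 0 <= a -> a <= b ->
  (forall s : R, 0 <= s -> is_derive s 1 F (dF s)) ->
  exists2 s, a <= s <= b & F b - F a = dF s * (b - a).
Proof.
move=> a0; rewrite le_eqVlt => /orP[/eqP <- dFE|ab dFE].
  by exists a; rewrite ?lexx// !subrr mulr0.
have D (s : R) : s \in `]a, b[ -> is_derive s 1 F (dF s).
  by rewrite in_itv/= => /andP[/ltW as_ _]; apply: dFE; exact: le_trans as_.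
have [|s] := MVT ab D.
  apply: derivable_within_continuous => s; rewrite in_itv/= => /andP[as_ _].
  by have [] := dFE s (le_trans a0 as_).
by rewrite in_itv/= => /andP[as_ sb] E; exists s => //; rewrite !ltW.
Qed.

Lemma primitive_bound (f : R -> R) (T K s t : R) : locally_lipschitz f ->
  (forall u, 0 <= u <= T -> `|f u| <= K) -> 0 <= s <= T -> 0 <= t <= T ->
  `|primitive f t - primitive f s| <= K * `|t - s|.
Proof.
move=> lf fK; wlog st : s t / s <= t => [hw sT tT|/andP[s0 sT] /andP[t0 tT]].
  have [st|/ltW ts] := leP s t; first exact: hw.
  by rewrite distrC (distrC t); exact: hw.
have [u /andP[su ut] ->] := mean_value_nonneg s0 st (fun u u0 => is_derive_primitive lf u0).
by rewrite normrM ler_wpM2r// fK// (le_trans s0 su) (le_trans ut tT).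
Qed.

Lemma primitive_taylor (f : R -> R) (T K s t : R) : locally_lipschitz f -> 0 <= K ->
  (forall u v, 0 <= u <= T -> 0 <= v <= T -> `|f u - f v| <= K * `|u - v|) ->
  0 <= s <= T -> 0 <= t <= T ->
  `|primitive f t - primitive f s - (t - s) * f s| <= K * (t - s) ^+ 2.
Proof.
move=> lf K0 fK sT tT.
have key a b c : 0 <= a -> a <= b -> b <= T -> 0 <= c <= T -> (c = a \/ c = b) ->
    `|primitive f b - primitive f a - (b - a) * f c| <= K * (b - a) ^+ 2.
  move=> a0 ab bT cT cab.
  have [u /andP[au ub] ->] := mean_value_nonneg a0 ab (fun u u0 => is_derive_primitive lf u0).
  rewrite mulrC -mulrBr normrM expr2 mulrCA ger0_norm ?subr_ge0// ler_wpM2l ?subr_ge0//.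
  apply: (le_trans (fK _ _ _ cT)); first by rewrite (le_trans a0 au) (le_trans ub).
  by rewrite ler_wpM2l// ler_norml; case: cab => ->; apply/andP; split; lra.
case/andP: (sT) => s0 s1; case/andP: (tT) => t0 t1.
have [st|/ltW ts] := leP s t; first by apply: key => //; left.
rewrite (_ : _ - _ - _ = - (primitive f s - primitive f t - (s - t) * f s)); last by ring.
rewrite normrN (_ : (t - s) ^+ 2 = (s - t) ^+ 2); last by ring.
by apply: key => //; right.
Qed.

Lemma nondecreasing_nonneg (F dF : R -> R) (T : R) :
  (forall s : R, 0 <= s -> is_derive s 1 F (dF s)) ->
  (forall s, 0 <= s <= T -> 0 <= dF s) -> 0 <= T -> F 0 <= F T.
Proof.
move=> dFE dF0 T0; have [s sT E] := mean_value_nonneg (lexx _) T0 dFE.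
by rewrite -subr_ge0 E mulr_ge0 ?dF0// subr0.
Qed.

(** Integration against the weight [exp (l s)], which turns the Lipschitz condition
    into a contraction. *)
Lemma exponential_bound (F dF : R -> R) (A l T : R) : 0 < l -> 0 <= A -> F 0 = 0 ->
  (forall s : R, 0 <= s -> is_derive s 1 F (dF s)) ->
  (forall s, 0 <= s <= T -> `|dF s| <= A * expR (l * s)) ->
  forall t, 0 <= t <= T -> `|F t| <= A / l * expR (l * t).
Proof.
move=> l0 A0 F0 dFE dFA t /andP[t0 tT].
have dE (s : R) : is_derive s 1 (fun s : R => A / l * expR (l * s)) (A * expR (l * s)).
  have dls : is_derive s 1 (fun s : R => l * s) l.
    by have := @is_deriveZ R R R id l s 1 1 (is_derive_id s 1); rewrite -[l *: 1]/(l * 1) mulr1.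
  have := is_derive1_comp (is_derive_expR (l * s)) dls => H.
  have := @is_deriveZ R R R (fun s : R => expR (l * s)) (A / l) s 1 _ H.
  rewrite -[_ *: (_ *: _)]/(A / l * (expR (l * s) * l)).
  by rewrite (mulrC _ l) mulrA divfK ?gt_eqF.
have le0 (sg : R) : (sg = 1 \/ sg = -1) -> sg * F t <= A / l * expR (l * t).
  move=> sg1.
  have := @nondecreasing_nonneg (fun s => A / l * expR (l * s) - sg * F s)
    (fun s => A * expR (l * s) - sg * dF s) t.
  rewrite F0 !mulr0 subr0 expR0 mulr1 => H.
  have Al : 0 <= A / l by rewrite divr_ge0// ltW.
  rewrite -subr_ge0; apply: (le_trans Al); apply: H; last exact: t0.
    move=> s s0; have H := @is_deriveZ R R R F sg s 1 _ (dFE s s0).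
    exact: (is_deriveB (dE s) H).
  move=> s /andP[s0 st]; rewrite subr_ge0.
  have := dFA s; rewrite s0 (le_trans st tT) => /(_ isT).
  rewrite ler_norml => /andP[h1 h2].
  by case: sg1 => ->; rewrite ?mul1r ?mulN1r//; lra.
rewrite ler_norml; apply/andP; split.
  by have := le0 (-1) (or_intror erefl); rewrite mulN1r; lra.
by have := le0 1 (or_introl erefl); rewrite mul1r.
Qed.

End scalar.

Section picard.
Context {R : realType} {n : nat} {J : Type}.
Local Notation state := (J -> 'rV[R]_n -> R).
Implicit Types (X Y : state).

Definition admissible X := forall i, continuous_torus (X i).

Definition state_le X Y (d : R) := forall i x, `|X i x - Y i x| <= d.

Variables (F : R -> state -> state) (X0 : state).
Hypothesis X0_adm : admissible X0.
Hypothesis F_adm : forall (t : R) X, 0 <= t -> admissible X -> admissible (F t X).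
Hypothesis F_bounded : forall T : R, exists K : R, forall (t : R) X i x,
  0 <= t <= T -> admissible X -> `|F t X i x| <= K.
Hypothesis F_lipschitz : forall T : R, exists2 L : R, 0 <= L & forall (s t : R) X Y (d : R),
  0 <= s <= T -> 0 <= t <= T -> admissible X -> admissible Y -> state_le X Y d ->
  state_le (F s X) (F t Y) (L * (`|s - t| + d)).

Fixpoint picard (k : nat) (t : R) : state :=
  if k is k'.+1 then fun i x => X0 i x + primitive (fun s => F s (picard k' s) i x) t
  else X0.

(** The Lipschitz condition in time and the compactness of the time interval make
    the modulus of continuity in space uniform in time. *)
Lemma admissible_modulus (c : R -> state) (T K e : R) i x :
  (forall t : R, 0 <= t -> admissible (c t)) -> 0 <= T -> 0 < e ->
  (forall s t : R, 0 <= s <= T -> 0 <= t <= T -> state_le (c s) (c t) (K * `|s - t|)) ->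
  exists2 d : R, 0 < d & forall y, `|x - y| < d -> forall s, 0 <= s <= T -> `|c s i x - c s i y| < e.
Proof.
move=> ca T0 e0 cK.
have := @segment_compact R 0 T; rewrite compact_near_coveringP.
move=> /(_ _ (nbhs x) (fun y s => 0 <= s <= T -> `|c s i x - c s i y| < e)).
move=> /(_ (nbhs_filter _)) H.
have {H} : \forall y \near x, [set` `[0, T]] `<=` (fun s : R => 0 <= s <= T -> `|c s i x - c s i y| < e).
  apply: H => s /=; rewrite in_itv/= => sT.
  have s0 : 0 <= s by case/andP: sT.
  have e3 : 0 < e / 3 by rewrite divr_gt0.
  have [d d0 xd] := continuous_ball x (ca s s0 i).1 e3.
  have K0 : 0 < `|K| + 1 by rewrite ltr_wpDl.
  exists (ball s (e / 3 / (`|K| + 1)), ball x d).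
    by split; apply: nbhsx_ballx => //; rewrite divr_gt0.
  move=> [s' y] []/=; rewrite -ball_normE/= => ss' xy sT'.
  have cs' z : `|c s' i z - c s i z| < e / 3.
    have := cK s' s sT' sT i z => /le_lt_trans; apply.
    rewrite ltr_pdivlMr// in ss'; rewrite distrC; apply: le_lt_trans ss'.
    rewrite mulrC ler_wpM2l// (le_trans (ler_norm _))// lerDl//.
  have h1 := cs' x; have h2 := cs' y; have h3 : `|c s i x - c s i y| < e / 3.
    by apply: xd; move: xy; rewrite -ball_normE.
  rewrite (_ : _ - _ = (c s' i x - c s i x) + (c s i x - c s i y) - (c s' i y - c s i y)); last by ring.
  apply: (le_lt_trans (ler_normB _ _)); apply: (@le_lt_trans _ _ ((`|c s' i x - c s i x| + `|c s i x - c s i y|) + `|c s' i y - c s i y|)).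
    by rewrite lerD2r ler_normD.
  lra.
move=> /nbhs_ballP[d /= d0 dP]; exists d => // y xy s sT.
have xb : ball x d y by rewrite -ball_normE.
by apply: (dP y xb s _ sT); rewrite /= in_itv.
Qed.

Lemma primitive_admissible (c : R -> state) (t : R) : 0 <= t ->
  (forall s, 0 <= s -> admissible (c s)) ->
  (forall T, exists K : R, forall s t : R, 0 <= s <= T -> 0 <= t <= T ->
     state_le (c s) (c t) (K * `|s - t|)) ->
  admissible (fun i x => primitive (fun s => c s i x) t).
Proof.
move=> t0 ca cl i; have lc x : locally_lipschitz (fun s => c s i x).
  by move=> T; have [K cK] := cl T; exists K => s u sT uT; exact: cK.
split; last first.
  by move=> k x; apply: eq_primitive => s s0; exact: (ca s s0 i).2.
apply: ball_continuous => x e e0.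
have t1 : 0 < t + 1 by rewrite ltr_wpDl.
have [K cK] := cl t.
have [d d0 xd] := @admissible_modulus c t K (e / (t + 1)) i x ca t0 (divr_gt0 e0 t1) cK.
exists d => // y xy.
have [s sT] := @mean_value_nonneg _ (fun t => primitive (fun s => c s i x) t - primitive (fun s => c s i y) t)
  (fun s => c s i x - c s i y) 0 t (lexx _) t0 (fun s s0 =>
    is_deriveB (is_derive_primitive (lc x) s0) (is_derive_primitive (lc y) s0)).
rewrite !primitive0 subrr !subr0 => ->; rewrite normrM (ger0_norm t0).
have := xd y xy s sT; rewrite ltr_pdivlMr// => H.
by apply: le_lt_trans H; rewrite ler_wpM2l// lerDl.
Qed.

Lemma picard_curve_lipschitz (c : R -> state) (T K L : R) : 0 <= L ->
  (forall (s t : R) X Y (d : R), 0 <= s <= T -> 0 <= t <= T -> admissible X -> admissible Y ->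
    state_le X Y d -> state_le (F s X) (F t Y) (L * (`|s - t| + d))) ->
  (forall t : R, 0 <= t -> admissible (c t)) ->
  (forall s t : R, 0 <= s <= T -> 0 <= t <= T -> state_le (c s) (c t) (K * `|s - t|)) ->
  forall s t : R, 0 <= s <= T -> 0 <= t <= T ->
  state_le (F s (c s)) (F t (c t)) (L * (1 + K) * `|s - t|).
Proof.
move=> L0 FL ca cK s t sT tT i x; case/andP: (sT) => s0 _; case/andP: (tT) => t0 _.
apply: (le_trans (FL s t _ _ _ sT tT (ca s s0) (ca t t0) (cK s t sT tT) i x)).
by rewrite -mulrA ler_wpM2l// mulrDl mul1r.
Qed.

Lemma F_bounded_ge0 (T : R) : exists2 K : R, 0 <= K & forall (t : R) X i x,
  0 <= t <= T -> admissible X -> `|F t X i x| <= K.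
Proof.
have [K FK] := F_bounded T; exists `|K| => // t X i x tT aX.
by apply: (le_trans (FK t X i x tT aX)); exact: ler_norm.
Qed.

(** The iterates are Lipschitz continuous in time, since [F] is bounded. *)
Lemma picard_invariant k :
  (forall t : R, 0 <= t -> admissible (picard k t)) /\
  (forall T K, (forall (t : R) X i x, 0 <= t <= T -> admissible X -> `|F t X i x| <= K) -> 0 <= K ->
     forall s t : R, 0 <= s <= T -> 0 <= t <= T -> state_le (picard k s) (picard k t) (K * `|s - t|)).
Proof.
elim: k => [|k [IHa IHl]].
  by split=> // T K _ K0 s t _ _ i x; rewrite /= subrr normr0 mulr_ge0.
have ca s : 0 <= s -> admissible (F s (picard k s)).
  by move=> s0; apply: F_adm => //; exact: IHa.
have cl T : exists K : R, forall s t : R, 0 <= s <= T -> 0 <= t <= T ->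
    state_le (F s (picard k s)) (F t (picard k t)) (K * `|s - t|).
  have [K K0 FK] := F_bounded_ge0 T; have [L L0 FL] := F_lipschitz T.
  exists (L * (1 + K)); apply: (picard_curve_lipschitz L0 FL IHa).
  exact: IHl FK K0.
have lc i x : locally_lipschitz (fun s => F s (picard k s) i x).
  by move=> T; have [K cK] := cl T; exists K => s u sT uT; exact: cK.
split=> [t t0 i|T K FK K0 s t sT tT i x] /=.
  apply: continuous_torusD; first exact: X0_adm.
  exact: (primitive_admissible t0 ca cl i).
rewrite opprD addrACA subrr add0r.
apply: (primitive_bound (lc i x) _ tT sT) => u uT; apply: FK => //.
by apply: IHa; case/andP: uT.
Qed.

Lemma picard_lipschitz_time k (T L K : R) : 0 <= L ->
  (forall (s t : R) X Y (d : R), 0 <= s <= T -> 0 <= t <= T -> admissible X -> admissible Y ->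
    state_le X Y d -> state_le (F s X) (F t Y) (L * (`|s - t| + d))) ->
  0 <= K -> (forall (t : R) X i x, 0 <= t <= T -> admissible X -> `|F t X i x| <= K) ->
  forall s t : R, 0 <= s <= T -> 0 <= t <= T ->
  state_le (F s (picard k s)) (F t (picard k t)) (L * (1 + K) * `|s - t|).
Proof.
move=> L0 FL K0 FK; have [ca cl] := picard_invariant k.
exact: picard_curve_lipschitz L0 FL ca (cl T K FK K0).
Qed.

Lemma picard_locally_lipschitz k i x : locally_lipschitz (fun s => F s (picard k s) i x).
Proof.
move=> T; have [K K0 FK] := F_bounded_ge0 T; have [L L0 FL] := F_lipschitz T.
exists (L * (1 + K)) => s u sT uT.
exact: (picard_lipschitz_time k L0 FL K0 FK uT sT).
Qed.

(** Weighting with exp(l t), for l larger than twice the Lipschitz constant, makes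
    each iteration halve the distance, on the whole interval at once. *)
Lemma picard_contraction (T : R) : 0 <= T -> exists a : R, forall k (t : R), 0 <= t <= T ->
  state_le (picard k.+1 t) (picard k t) (a / 2 ^+ k).
Proof.
move=> T0; have [K K0 FK] := F_bounded_ge0 T; have [L L0 FL] := F_lipschitz T.
pose l := 2 * L + 1; have l0 : 0 < l by rewrite /l; lra.
have p2 k : 0 < 2 ^+ k :> R by rewrite exprn_gt0.
have e1 t : 0 <= t -> 1 <= expR (l * t).
  by move=> t0; rewrite -expR0 ler_expR mulr_ge0// ltW.
have H k t : 0 <= t <= T ->
    state_le (picard k.+1 t) (picard k t) (K * T / 2 ^+ k * expR (l * t)).
  elim: k t => [|k IH] t tT i x.
    rewrite expr0 divr1 /= addrAC subrr add0r; case/andP: (tT) => t0 t1.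
    have := @primitive_bound R (fun s => F s X0 i x) T K 0 t.
    rewrite primitive0 !subr0 lexx T0 (ger0_norm t0) => H.
    apply: le_trans (H _ _ _ _) _ => //.
    - exact: (picard_locally_lipschitz 0).
    - by move=> u uT; exact: FK.
    - apply: (@le_trans _ _ (K * T)); first by rewrite ler_wpM2l.
      by rewrite ler_peMr// ?mulr_ge0// e1.
  rewrite /= opprD addrACA subrr add0r.
  have A0 : 0 <= L * (K * T / 2 ^+ k) by rewrite !mulr_ge0// invr_ge0 ltW.
  have lk := picard_locally_lipschitz k i x; have lk1 := picard_locally_lipschitz k.+1 i x.
  have := @exponential_bound _ (fun t => primitive (fun s => F s (picard k.+1 s) i x) t -
      primitive (fun s => F s (picard k s) i x) t)
    (fun s => F s (picard k.+1 s) i x - F s (picard k s) i x)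
    (L * (K * T / 2 ^+ k)) l T l0 A0.
  rewrite !primitive0 subrr => /(_ erefl) H.
  apply: le_trans (H _ _ t tT) _.
  - by move=> s s0; apply: is_deriveB; exact: is_derive_primitive.
  - move=> s sT; case/andP: (sT) => s0 _.
    have [a1 _] := picard_invariant k.+1; have [a0 _] := picard_invariant k.
    apply: (le_trans (FL s s _ _ _ sT sT (a1 s s0) (a0 s s0) (IH s sT) i x)).
    by rewrite subrr normr0 add0r mulrA.
  - rewrite ler_wpM2r ?expR_ge0// ler_pdivrMr// exprS invfM.
    have : 0 <= K * T / 2 ^+ k by rewrite !mulr_ge0// invr_ge0 ltW.
    rewrite (mulrCA (K * T)); set Z := K * T / 2 ^+ k => Z0.
    by rewrite /l; nra.
exists (K * T * expR (l * T)) => k t tT i x; apply: (le_trans (H k t tT i x)).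
rewrite mulrAC ler_wpM2r ?invr_ge0 ?exprn_ge0// ler_wpM2l ?mulr_ge0//.
by rewrite ler_expR ler_pM2l//; case/andP: tT.
Qed.

Definition picard_limit (t : R) : state := fun i x =>
  xget 0 [set l : R | exists a : R, forall k, `|l - picard k t i x| <= a / 2 ^+ k].

Lemma geometric_unique (u : nat -> R) (l l' a a' : R) :
  (forall k, `|l - u k| <= a / 2 ^+ k) -> (forall k, `|l' - u k| <= a' / 2 ^+ k) -> l = l'.
Proof.
move=> la la'; apply/eqP; rewrite -subr_eq0 -normr_le0.
apply: (@le_geometric _ _ _ (a + a')) => k; rewrite add0r mulrDl.
rewrite (_ : l - l' = (l - u k) - (l' - u k)); last by ring.
by rewrite (le_trans (ler_normB _ _))// lerD.
Qed.

Lemma picard_limit_bound (T : R) : 0 <= T -> exists2 a : R, 0 <= a & forall k (t : R), 0 <= t <= T ->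
  state_le (picard_limit t) (picard k t) (a / 2 ^+ k).
Proof.
move=> T0; have [a ak] := picard_contraction T0.
exists `|2 * a| => // k t tT i x.
have [l lk] := geometric_limit (fun k => ak k t tT i x).
have : [set l : R | exists a : R, forall k, `|l - picard k t i x| <= a / 2 ^+ k] (picard_limit t i x).
  by apply: (@xgetI _ _ _ l); exists (2 * a).
move=> [a' a'k]; rewrite (geometric_unique a'k lk) (le_trans (lk k))//.
by rewrite ler_wpM2r ?invr_ge0 ?exprn_ge0// ler_norm.
Qed.

(** Boundedness of [F] makes the iterates Lipschitz continuous in time, which gives
    them primitives, and the contraction holds on every compact time interval;
    hence there is no blow-up.  The equation is stated through a remainder that is
    quadratic uniformly in space, the form in which it passes to the limit. *)
Theorem picard_solution : exists X : R -> state,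
  [/\ forall i x, X 0 i x = X0 i x,
      forall t : R, 0 <= t -> admissible (X t) &
      forall T : R, exists2 C : R, 0 <= C & forall s t : R, 0 <= s <= T -> 0 <= t <= T -> forall i x,
        `|X t i x - X s i x - (t - s) * F s (X s) i x| <= C * (t - s) ^+ 2].
Proof.
exists picard_limit.
have Xadm t : 0 <= t -> admissible (picard_limit t).
  move=> t0 i; have [a a0 ak] := picard_limit_bound t0.
  have tt : 0 <= t <= t by rewrite t0 lexx.
  split; last first.
    move=> k x; rewrite /picard_limit; congr (xget _ _); apply/seteqP.
    have E m : picard m t i (x + (2 * pi) *: basis_rV k) = picard m t i x.
      by have [pa _] := picard_invariant m; exact: (pa t t0 i).2.
    by split=> l [b bk]; exists b => m; have := bk m; rewrite E.
  apply: ball_continuous => x e e0.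
  have e3 : 0 < e / 3 by rewrite divr_gt0.
  have [m am] : exists m, a / 2 ^+ m < e / 3.
    apply: contrapT => H.
    have : e / 3 <= 0.
      apply: (@le0_geometric _ _ a) => m; rewrite leNgt; apply/negP => am.
      by apply: H; exists m.
    by rewrite leNgt e3.
  have [pa _] := picard_invariant m.
  have [d d0 xd] := continuous_ball x (pa t t0 i).1 e3.
  exists d => // y xy.
  rewrite (_ : _ - _ = (picard_limit t i x - picard m t i x) + (picard m t i x - picard m t i y)
    - (picard_limit t i y - picard m t i y)); last by ring.
  have h1 := ak m t tt i x; have h2 := ak m t tt i y; have h3 := xd y xy.
  apply: (le_lt_trans (ler_normB _ _)).
  have := ler_normD (picard_limit t i x - picard m t i x) (picard m t i x - picard m t i y).
  lra.
split=> // [i x|T].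
  have [a _ ak] := picard_limit_bound (lexx (0 : R)).
  apply: (@geometric_unique (fun k => picard k 0 i x) _ _ a 0) => k.
    by apply: ak; rewrite lexx.
  by case: k => [|k] /=; rewrite ?primitive0 ?addr0 subrr normr0 mul0r.
have [T0|T0] := ltP T 0.
  by exists 0 => // s t /andP[s0 sT]; have := le_trans s0 sT; rewrite leNgt T0.
have [K K0 FK] := F_bounded_ge0 T; have [L L0 FL] := F_lipschitz T.
have [a a0 ak] := picard_limit_bound T0.
have C0 : 0 <= L * (1 + K) by rewrite mulr_ge0// addr_ge0.
exists (L * (1 + K)) => // s t sT tT i x.
case/andP: (sT) => s0 _.
apply: (@le_geometric _ _ _ (2 * a + `|t - s| * (L * a))) => k.
have H := @primitive_taylor _ _ T _ s t (picard_locally_lipschitz k i x) C0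
  (fun u v uT vT => picard_lipschitz_time k L0 FL K0 FK uT vT i x) sT tT.
have p1 := ak k.+1 t tT i x; have p2 := ak k.+1 s sT i x.
have [pa _] := picard_invariant k.
have p3 := FL s s _ _ _ sT sT (Xadm s s0) (pa s s0) (ak k s sT) i x.
rewrite subrr normr0 add0r in p3.
have p4 : `|(t - s) * (F s (picard_limit s) i x - F s (picard k s) i x)| <= `|t - s| * (L * (a / 2 ^+ k)).
  by rewrite normrM ler_wpM2l.
have pk : a / 2 ^+ k.+1 <= a / 2 ^+ k.
  by rewrite ler_wpM2l// lef_pV2 ?posrE ?exprn_gt0// ler_eXn2l// ltr1n.
rewrite /= in p1 p2.
move: p1 p2 p4 H; rewrite [in X in _ -> _ -> _ -> X -> _]/=.
set Xt := picard_limit t i x; set Xs := picard_limit s i x.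
set Ft := F s (picard_limit s) i x; set Fk := F s (picard k s) i x.
set Pt := primitive _ t; set Ps := primitive _ s => p1 p2 p4 H.
rewrite (_ : _ - _ - _ = (Xt - (X0 i x + Pt)) - (Xs - (X0 i x + Ps)) +
   (Pt - Ps - (t - s) * Fk) - (t - s) * (Ft - Fk)); last by ring.
rewrite [X in _ <= _ + X]mulrDl; apply: (le_trans (ler_normB _ _)).
have q1 := ler_normD (Xt - (X0 i x + Pt) - (Xs - (X0 i x + Ps))) (Pt - Ps - (t - s) * Fk).
have q2 := ler_normB (Xt - (X0 i x + Pt)) (Xs - (X0 i x + Ps)).
have -> : 2 * a / 2 ^+ k = a / 2 ^+ k + a / 2 ^+ k by rewrite -mulrA mulrDl !mul1r.
have -> : `|t - s| * (L * a) / 2 ^+ k = `|t - s| * (L * (a / 2 ^+ k)) by rewrite !mulrA.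
lra.
Qed.

End picard.

(** * Scalar comparison *)

Section comparison.
Context {R : realType}.
Implicit Types (w g : R -> R).

(** [w] is differentiable with derivative [g], in the quantitative form that
    survives uniform limits; at time 0 the derivative is one-sided. *)
Definition c11 w g := forall T : R, exists2 K : R, 0 <= K &
  forall s t : R, 0 <= s <= T -> 0 <= t <= T ->
  [/\ `|w t - w s - (t - s) * g s| <= K * (t - s) ^+ 2, `|g s| <= K, `|w s| <= K &
      `|w t - w s| <= K * `|t - s|].

Lemma c11_intro w g : (forall T : R, exists K : R,
  forall s t : R, 0 <= s <= T -> 0 <= t <= T ->
  `|w t - w s - (t - s) * g s| <= K * (t - s) ^+ 2 /\ `|g s| <= K) -> c11 w g.
Proof.
move=> H T; have [K wK] := H T.
have [T0|T0] := ltP T 0.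
  by exists 0 => // s t /andP[s0 sT]; have := le_trans s0 sT; rewrite leNgt T0.
have zT : 0 <= (0 : R) <= T by rewrite lexx T0.
have K0 : 0 <= K by have [_] := wK 0 0 zT zT; exact: le_trans.
have lip (s t : R) : 0 <= s <= T -> 0 <= t <= T -> `|w t - w s| <= (K + K * T) * `|t - s|.
  move=> sT tT; have [h1 h2] := wK s t sT tT.
  have ts : `|t - s| <= T by rewrite ler_norml; lra.
  rewrite (_ : w t - w s = (w t - w s - (t - s) * g s) + (t - s) * g s); last by ring.
  apply: (le_trans (ler_normD _ _)); rewrite (mulrDl K) [leRHS]addrC lerD//; last first.
    by rewrite normrM mulrC ler_wpM2r.
  apply: (le_trans h1); rewrite -(real_normK (num_real (t - s))) expr2 mulrA.
  by rewrite ler_wpM2r// ler_wpM2l.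
have KT : 0 <= K * T by exact: mulr_ge0.
have KTT : 0 <= (K + K * T) * T by rewrite mulr_ge0// addr_ge0.
have w0 := normr_ge0 (w 0).
exists (K + K * T + (K + K * T) * T + `|w 0|); first by rewrite !addr_ge0.
move=> s t sT tT; have [h1 h2] := wK s t sT tT; split.
- by apply: (le_trans h1); rewrite ler_wpM2r ?sqr_ge0//; lra.
- by apply: (le_trans h2); lra.
- rewrite -[w s](subrK (w 0)); apply: (le_trans (ler_normD _ _)).
  rewrite lerD2r (le_trans (lip 0 s zT sT))// subr0.
  case/andP: sT => s0 sT; rewrite (ger0_norm s0) ler_wpDl ?addr_ge0// ler_wpM2l ?addr_ge0//.
- by apply: (le_trans (lip s t sT tT)); rewrite ler_wpM2r//; lra.
Qed.

Lemma c11_cst (c : R) : c11 (fun=> c) (fun=> 0).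
Proof.
apply: c11_intro => T; exists 0 => s t _ _.
by rewrite subrr mulr0 subrr normr0 mul0r.
Qed.

Lemma c11_id : c11 id (fun=> 1).
Proof.
apply: c11_intro => T; exists 1 => s t _ _.
by rewrite /= mulr1 subrr normr0 mul1r sqr_ge0 normr1.
Qed.

Lemma c11D w1 w2 g1 g2 : c11 w1 g1 -> c11 w2 g2 ->
  c11 (fun t => w1 t + w2 t) (fun t => g1 t + g2 t).
Proof.
move=> H1 H2; apply: c11_intro => T.
have [K1 K10 k1] := H1 T; have [K2 K20 k2] := H2 T.
exists (K1 + K2) => s t sT tT.
have [a1 b1 _ _] := k1 s t sT tT; have [a2 b2 _ _] := k2 s t sT tT.
split; last by rewrite (le_trans (ler_normD _ _))// lerD.
rewrite (_ : _ - _ - _ = (w1 t - w1 s - (t - s) * g1 s) + (w2 t - w2 s - (t - s) * g2 s)); last by ring.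
by rewrite (mulrDl K1) (le_trans (ler_normD _ _))// lerD.
Qed.

Lemma c11M w1 w2 g1 g2 : c11 w1 g1 -> c11 w2 g2 ->
  c11 (fun t => w1 t * w2 t) (fun t => g1 t * w2 t + w1 t * g2 t).
Proof.
move=> H1 H2; apply: c11_intro => T.
have [K1 K10 k1] := H1 T; have [K2 K20 k2] := H2 T.
exists (3 * (K1 * K2)) => s t sT tT.
have [a1 b1 c1 d1] := k1 s t sT tT; have [a2 b2 c2 d2] := k2 s t sT tT.
have q : `|t - s| * `|t - s| = (t - s) ^+ 2 by rewrite -expr2 real_normK ?num_real.
have KK : 0 <= K1 * K2 by exact: mulr_ge0.
split; last first.
  apply: (le_trans (ler_normD _ _)); rewrite !normrM.
  have := ler_pM (normr_ge0 _) (normr_ge0 _) b1 c2.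
  have := ler_pM (normr_ge0 _) (normr_ge0 _) c1 b2; lra.
rewrite (_ : _ - _ - _ = (w1 t - w1 s - (t - s) * g1 s) * w2 s +
   w1 s * (w2 t - w2 s - (t - s) * g2 s) + (w1 t - w1 s) * (w2 t - w2 s)); last by ring.
apply: (le_trans (ler_normD _ _)); have := ler_normD ((w1 t - w1 s - (t - s) * g1 s) * w2 s)
   (w1 s * (w2 t - w2 s - (t - s) * g2 s)).
rewrite !normrM.
have e1 := ler_pM (normr_ge0 _) (normr_ge0 _) a1 c2.
have e2 := ler_pM (normr_ge0 _) (normr_ge0 _) c1 a2.
have e3 := ler_pM (normr_ge0 _) (normr_ge0 _) d1 d2.
rewrite mulrACA q in e3; rewrite mulrAC in e1; rewrite mulrA in e2.
lra.
Qed.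

Lemma c11Z (c : R) w g : c11 w g -> c11 (fun t => c * w t) (fun t => c * g t).
Proof.
move=> H; have := c11M (c11_cst c) H; congr c11.
by apply/funext => t; rewrite mul0r add0r.
Qed.

Lemma expR_taylor (x y K : R) : x <= K -> y <= K ->
  `|expR y - expR x - (y - x) * expR x| <= expR K * (y - x) ^+ 2 /\
  `|expR y - expR x| <= expR K * `|y - x|.
Proof.
move=> xK yK.
have lo (a b : R) : (b - a) * expR a <= expR b - expR a.
  have := expR_ge1Dx (b - a); rewrite expRB ler_pdivlMr ?expR_gt0//; lra.
have up (a b : R) : expR b - expR a <= (b - a) * expR b by have := lo b a; lra.
have ex : expR x <= expR K by rewrite ler_expR.
have ey : expR y <= expR K by rewrite ler_expR.
have ex0 := expR_gt0 x; have ey0 := expR_gt0 y.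
have l1 := lo x y; have u1 := up x y.
have lip : `|expR y - expR x| <= expR K * `|y - x|.
  have [xy|yx] := leP x y.
    rewrite !ger0_norm ?subr_ge0 ?ler_expR//; nra.
  have yx' := ltW yx; rewrite !ler0_norm ?subr_le0 ?ler_expR//.
  have : (x - y) * expR x <= (x - y) * expR K by rewrite ler_wpM2l// subr_ge0.
  by lra.
split=> //; rewrite ger0_norm; last by lra.
apply: (@le_trans _ _ ((y - x) * (expR y - expR x))); first by lra.
apply: (le_trans (ler_norm _)); rewrite normrM -(real_normK (num_real (y - x))).
by rewrite expr2 mulrCA ler_wpM2l.
Qed.

Lemma c11_expR w g : c11 w g -> c11 (fun t => expR (w t)) (fun t => g t * expR (w t)).
Proof.
move=> H; apply: c11_intro => T; have [K K0 k] := H T.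
exists (expR K * K ^+ 2 + K * expR K) => s t sT tT.
have [a b c d] := k s t sT tT; have [_ _ c' _] := k t s tT sT.
have ws : w s <= K := le_trans (ler_norm _) c.
have wt : w t <= K := le_trans (ler_norm _) c'.
have [e1 _] := expR_taylor ws wt.
have eK := expR_gt0 K; have es := expR_gt0 (w s).
have esK : expR (w s) <= expR K by rewrite ler_expR.
have p0 : 0 <= expR K * K ^+ 2 by rewrite mulr_ge0 ?sqr_ge0// ltW.
split; last first.
  rewrite normrM (ger0_norm (ltW es)).
  by have := ler_pM (normr_ge0 _) (ltW es) b esK; lra.
rewrite (_ : _ - _ - _ = (expR (w t) - expR (w s) - (w t - w s) * expR (w s)) +
   (w t - w s - (t - s) * g s) * expR (w s)); last by ring.
apply: (le_trans (ler_normD _ _)); rewrite [leRHS]mulrDl lerD//.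
  apply: (le_trans e1); rewrite -mulrA ler_wpM2l ?(ltW eK)// -exprMn.
  rewrite -[leLHS]real_normK ?num_real// -[leRHS]real_normK ?num_real//.
  by rewrite lerXn2r ?nnegrE// normrM (ger0_norm K0).
rewrite normrM (ger0_norm (ltW es)) mulrAC.
exact: ler_pM.
Qed.

(** Each bisection of the interval halves the sum of the squares, so that repeated
    bisection makes the bound on the increment arbitrarily small. *)
Lemma quadratic_nonincreasing (f : R -> R) (C T : R) :
  (forall s t : R, 0 <= s -> s <= t -> t <= T -> f t - f s <= C * (t - s) ^+ 2) ->
  forall s t : R, 0 <= s -> s <= t -> t <= T -> f t <= f s.
Proof.
move=> fC.
have H k : forall s t : R, 0 <= s -> s <= t -> t <= T -> f t - f s <= C * (t - s) ^+ 2 / 2 ^+ k.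
  elim: k => [|k IH] s t s0 st tT; first by rewrite expr0 divr1 fC.
  pose m := (s + t) / 2.
  have sm : s <= m by rewrite /m; lra.
  have mt : m <= t by rewrite /m; lra.
  have h1 := IH s m s0 sm (le_trans mt tT); have h2 := IH m t (le_trans s0 sm) mt tT.
  rewrite (_ : C * (t - s) ^+ 2 / 2 ^+ k.+1 =
    C * (m - s) ^+ 2 / 2 ^+ k + C * (t - m) ^+ 2 / 2 ^+ k); first by lra.
  have : (2 : R) ^+ k != 0 by rewrite expf_neq0.
  by rewrite /m (exprS _ k); move: ((2 : R) ^+ k) => K K0; field.
move=> s t s0 st tT; rewrite -subr_le0.
by apply: (@le0_geometric _ _ (C * (t - s) ^+ 2)) => k; exact: H.
Qed.

(** The square of the negative part of [w] does not increase: where w < 0 its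
    derivative 2 w g is at most 0, and where w >= 0 it can only become quadratically
    small in the time step. *)
Lemma comparison w g : c11 w g -> 0 <= w 0 -> (forall s, 0 <= s -> w s < 0 -> 0 <= g s) ->
  forall t, 0 <= t -> 0 <= w t.
Proof.
move=> wg w0 wneg t t0; have [K K0 k] := wg t.
pose f s := Num.min (w s) 0 ^+ 2.
have fC (s u : R) : 0 <= s -> s <= u -> u <= t -> f u - f s <= (2 * (K * K) + K ^+ 2) * (u - s) ^+ 2.
  move=> s0 su ut.
  have sT : 0 <= s <= t by rewrite s0 (le_trans su).
  have uT : 0 <= u <= t by rewrite (le_trans s0).
  have [a _ b c] := k s u sT uT.
  have q : `|w u - w s| ^+ 2 <= K ^+ 2 * (u - s) ^+ 2.
    by rewrite -exprMn -[leRHS]real_normK ?num_real// lerXn2r ?nnegrE// normrM (ger0_norm K0).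
  rewrite real_normK ?num_real// in q.
  have [ws|ws] := leP 0 (w s).
    have -> : f s = 0 by rewrite /f min_r// expr0n.
    have KK : 0 <= 2 * (K * K) * (u - s) ^+ 2.
      by rewrite mulr_ge0 ?sqr_ge0// mulr_ge0// mulr_ge0.
    have : f u <= (w u - w s) ^+ 2.
      rewrite /f; have [wu|wu] := leP (w u) 0; last by rewrite expr0n/= sqr_ge0.
      by nra.
    by lra.
  have gs := wneg s s0 ws.
  have -> : f s = w s ^+ 2 by rewrite /f min_l// ltW.
  have fu : f u <= w u ^+ 2.
    by rewrite /f; have [//|_] := leP (w u) 0; rewrite expr0n/= sqr_ge0.
  have lo : - (K * (u - s) ^+ 2) <= w u - w s.
    move: a; rewrite ler_norml => /andP[a _].
    have : 0 <= (u - s) * g s by rewrite mulr_ge0// subr_ge0.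
    by lra.
  have wK : - w s <= K by move: b; rewrite ler_norml => /andP[b _]; lra.
  have : - w s * (- (w u - w s)) <= K * (K * (u - s) ^+ 2).
    have S0 : 0 <= K * (u - s) ^+ 2 by rewrite mulr_ge0 ?sqr_ge0.
    apply: (@le_trans _ _ (- w s * (K * (u - s) ^+ 2))).
      by rewrite ler_wpM2l//; lra.
    by rewrite ler_wpM2r.
  by nra.
have := quadratic_nonincreasing fC (lexx 0) t0 (lexx t).
rewrite /f [in X in _ <= X]min_r// expr0n/= => H.
have : Num.min (w t) 0 ^+ 2 = 0 by apply/eqP; rewrite eq_le H sqr_ge0.
move=> /eqP; rewrite sqrf_eq0 => /eqP mw.
by rewrite -mw ge_min lexx.
Qed.

End comparison.

(** * Bounded Lipschitz functionals of time and state *)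

Section bounded_lipschitz.
Context {R : realType} {n : nat} {J : Type}.
Local Notation state := (J -> 'rV[R]_n -> R).
Local Notation functional := (R -> state -> 'rV[R]_n -> R).
Implicit Types (f g p : functional).

Definition torus_valued f := forall (t : R) X, 0 <= t -> admissible X -> continuous_torus (f t X).

Definition lipschitz_functional f := forall T : R, exists2 K : R, 0 <= K &
  forall (s t : R) X Y (d : R), 0 <= d -> 0 <= s <= T -> 0 <= t <= T ->
  admissible X -> admissible Y -> state_le X Y d -> forall x, `|f s X x - f t Y x| <= K * (`|s - t| + d).

Definition bounded_functional f := forall T : R, exists2 K : R, 0 <= K &
  forall (t : R) X x, 0 <= t <= T -> admissible X -> `|f t X x| <= K.

(** The right-hand side of the truncated system is composed of such functionals;
    the lemmas that follow check it piece by piece. *)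
Record bounded_lipschitz f : Prop := {
  bl_torus : torus_valued f ;
  bl_lipschitz : lipschitz_functional f ;
  bl_bounded : bounded_functional f }.

Lemma bl_time (w dw : R -> R) : c11 w dw -> bounded_lipschitz (fun t _ _ => w t).
Proof.
move=> wg; split.
- by move=> t X _ _; exact: continuous_torus_cst.
- move=> T; have [K K0 k] := wg T; exists K => // s t X Y d d0 sT tT _ _ XY x.
  have [_ _ _ h] := k t s tT sT; apply: (le_trans h).
  by rewrite ler_wpM2l// lerDl.
- move=> T; have [K K0 k] := wg T; exists K => // t X x tT _.
  by have [] := k t t tT tT.
Qed.

Lemma bl_cst (c : R) : bounded_lipschitz (fun _ _ _ => c).
Proof. exact: (bl_time (c11_cst c)). Qed.

Lemma bl_D f g : bounded_lipschitz f -> bounded_lipschitz g ->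
  bounded_lipschitz (fun t X x => f t X x + g t X x).
Proof.
move=> [fT fL fB] [gT gL gB]; split.
- by move=> t X t0 aX; apply: continuous_torusD; [exact: fT|exact: gT].
- move=> T; have [K K0 k] := fL T; have [L L0 l] := gL T.
  exists (K + L); first exact: addr_ge0.
  move=> s t X Y d d0 sT tT aX aY XY x; rewrite opprD addrACA [leRHS]mulrDl.
  by rewrite (le_trans (ler_normD _ _))// lerD ?k ?l.
- move=> T; have [K K0 k] := fB T; have [L L0 l] := gB T.
  exists (K + L); first exact: addr_ge0.
  by move=> t X x tT aX; rewrite (le_trans (ler_normD _ _))// lerD ?k ?l.
Qed.

Lemma bl_M f g : bounded_lipschitz f -> bounded_lipschitz g ->
  bounded_lipschitz (fun t X x => f t X x * g t X x).
Proof.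
move=> [fT fL fB] [gT gL gB]; split.
- by move=> t X t0 aX; apply: continuous_torusM; [exact: fT|exact: gT].
- move=> T; have [K K0 k] := fL T; have [L L0 l] := gL T.
  have [Kb Kb0 kb] := fB T; have [Lb Lb0 lb] := gB T.
  exists (K * Lb + Kb * L); first by rewrite addr_ge0 ?mulr_ge0.
  move=> s t X Y d d0 sT tT aX aY XY x.
  rewrite (_ : _ - _ = (f s X x - f t Y x) * g s X x + f t Y x * (g s X x - g t Y x)); last by ring.
  apply: (le_trans (ler_normD _ _)); rewrite !normrM [leRHS]mulrDl lerD//.
    by rewrite mulrAC ler_pM// ?k ?lb.
  by rewrite -mulrA ler_pM// ?kb ?l.
- move=> T; have [K K0 k] := fB T; have [L L0 l] := gB T.
  exists (K * L); first exact: mulr_ge0.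
  by move=> t X x tT aX; rewrite normrM ler_pM ?k ?l.
Qed.

Lemma bl_N f : bounded_lipschitz f -> bounded_lipschitz (fun t X x => - f t X x).
Proof.
move=> bf; have := bl_M (bl_cst (-1)) bf; congr bounded_lipschitz.
by apply/funext => t; apply/funext => X; apply/funext => x; rewrite mulN1r.
Qed.

Lemma bl_sum (I : Type) (r : seq I) (f : I -> functional) :
  (forall i, bounded_lipschitz (f i)) ->
  bounded_lipschitz (fun t X x => \sum_(i <- r) f i t X x).
Proof.
move=> bf; elim: r => [|i r IH].
  have := bl_cst 0; congr bounded_lipschitz.
  by apply/funext => t; apply/funext => X; apply/funext => x; rewrite big_nil.
have := bl_D (bf i) IH; congr bounded_lipschitz.
by apply/funext => t; apply/funext => X; apply/funext => x; rewrite big_cons.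
Qed.

Lemma bl_shift f (a : 'rV[R]_n) : bounded_lipschitz f ->
  bounded_lipschitz (fun t X x => f t X (x + a)).
Proof.
move=> [fT fL fB]; split.
- by move=> t X t0 aX; apply: continuous_torus_shift; exact: fT.
- by move=> T; have [K K0 k] := fL T; exists K => // s t X Y d d0 sT tT aX aY XY x; exact: k.
- by move=> T; have [K K0 k] := fB T; exists K => // t X x tT aX; exact: k.
Qed.

Lemma bl_V f : bounded_lipschitz f ->
  (forall T : R, exists2 c : R, 0 < c & forall (t : R) X x, 0 <= t <= T -> c <= f t X x) ->
  bounded_lipschitz (fun t X x => (f t X x)^-1).
Proof.
move=> [fT fL fB] fc; split.
- move=> t X t0 aX; apply: continuous_torusV; first exact: fT.
  have [c c0 fcc] := fc t => x; rewrite gt_eqF// (lt_le_trans c0)// fcc// t0 lexx//.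
- move=> T; have [K K0 k] := fL T; have [c c0 fcc] := fc T.
  exists (K / c ^+ 2); first by rewrite divr_ge0// sqr_ge0.
  move=> s t X Y d d0 sT tT aX aY XY x.
  have h1 := fcc s X x sT; have h2 := fcc t Y x tT.
  have p1 := lt_le_trans c0 h1; have p2 := lt_le_trans c0 h2.
  rewrite (_ : _ - _ = (f t Y x - f s X x) / (f s X x * f t Y x)); last first.
    by field; rewrite !gt_eqF.
  rewrite normrM distrC mulrAC ler_pM ?k// normfV lef_pV2 ?posrE ?exprn_gt0//.
    by rewrite gtr0_norm ?mulr_gt0// expr2 ler_pM// ltW.
  by rewrite normr_gt0 mulf_neq0// gt_eqF.
- move=> T; have [c c0 fcc] := fc T; exists c^-1; first by rewrite invr_ge0 ltW.
  move=> t X x tT aX; have h1 := fcc t X x tT; have p1 := lt_le_trans c0 h1.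
  by rewrite normfV gtr0_norm// lef_pV2.
Qed.

Lemma max_lipschitz (a b a' b' : R) :
  `|Num.max a b - Num.max a' b'| <= `|a - a'| + `|b - b'|.
Proof.
have := ler_norm (a - a'); have := ler_norm (a' - a); rewrite (distrC a').
have := ler_norm (b - b'); have := ler_norm (b' - b); rewrite (distrC b').
have := normr_ge0 (a - a'); have := normr_ge0 (b - b').
move: `|a - a'| `|b - b'| => A B.
by case: (leP a b); case: (leP a' b') => *; rewrite ler_norml; apply/andP; split; lra.
Qed.

Lemma min_lipschitz (a b a' b' : R) :
  `|Num.min a b - Num.min a' b'| <= `|a - a'| + `|b - b'|.
Proof.
have := ler_norm (a - a'); have := ler_norm (a' - a); rewrite (distrC a').
have := ler_norm (b - b'); have := ler_norm (b' - b); rewrite (distrC b').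
have := normr_ge0 (a - a'); have := normr_ge0 (b - b').
move: `|a - a'| `|b - b'| => A B.
by case: (leP a b); case: (leP a' b') => *; rewrite ler_norml; apply/andP; split; lra.
Qed.

(** Truncation makes an unbounded functional bounded. *)
Lemma bl_clamp f g i : bounded_lipschitz f -> bounded_lipschitz g ->
  bounded_lipschitz (fun t X x => Num.max (f t X x) (Num.min (X i x) (g t X x))).
Proof.
move=> [fT fL fB] [gT gL gB]; split.
- move=> t X t0 aX; apply: continuous_torus_max; first exact: fT.
  by apply: continuous_torus_min; [exact: aX|exact: gT].
- move=> T; have [K K0 k] := fL T; have [L L0 l] := gL T.
  exists (K + (1 + L)); first by rewrite !addr_ge0.
  move=> s t X Y d d0 sT tT aX aY XY x.
  apply: (le_trans (max_lipschitz _ _ _ _)); rewrite [leRHS]mulrDl lerD ?k//.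
  apply: (le_trans (min_lipschitz _ _ _ _)); rewrite [leRHS]mulrDl lerD ?l//.
  by rewrite mul1r ler_wpDl.
- move=> T; have [K K0 k] := fB T; have [L L0 l] := gB T.
  exists (K + L); first exact: addr_ge0.
  move=> t X x tT aX; have := k t X x tT aX; have := l t X x tT aX.
  rewrite !ler_norml => /andP[h1 h2] /andP[h3 h4].
  have [h5|h5] := leP (X i x) (g t X x).
    by have [h6|h6] := leP (f t X x) (X i x); apply/andP; split; lra.
  by have [h6|h6] := leP (f t X x) (g t X x); apply/andP; split; lra.
Qed.

Lemma bl_norm f : bounded_lipschitz f -> bounded_lipschitz (fun t X x => `|f t X x|).
Proof.
move=> [fT fL fB]; split.
- by move=> t X t0 aX; apply: continuous_torus_norm; exact: fT.
- move=> T; have [K K0 k] := fL T; exists K => // s t X Y d d0 sT tT aX aY XY x.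
  by apply: (le_trans (ler_dist_dist _ _)); exact: k.
- by move=> T; have [K K0 k] := fB T; exists K => // t X x tT aX; rewrite normr_id k.
Qed.

Lemma bl_pos f : bounded_lipschitz f -> bounded_lipschitz (fun t X => (f t X)^\+).
Proof.
move=> bf; have := bl_M (bl_cst 2^-1) (bl_D (bl_norm bf) bf); congr bounded_lipschitz.
apply/funext => t; apply/funext => X; apply/funext => x; rewrite /funrpos.
by case: (leP 0 (f t X x)) => h; [rewrite ger0_norm//; lra|rewrite ltr0_norm//; lra].
Qed.

Lemma bl_neg f : bounded_lipschitz f -> bounded_lipschitz (fun t X => (f t X)^\-).
Proof.
move=> bf; have := bl_pos (bl_N bf); congr bounded_lipschitz.
Qed.

Lemma bl_upwind (eps : R) (u : 'I_n -> functional) (w : functional) :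
  (forall k, bounded_lipschitz (u k)) -> bounded_lipschitz w ->
  bounded_lipschitz (fun t X => upwind eps (fun k => u k t X) (w t X)).
Proof.
move=> bu bw; apply: (bl_M (bl_cst _)); apply: bl_sum => k.
apply: bl_D; first apply: bl_D.
- exact: (bl_shift (- (eps *: basis_rV k)) (bl_M bw (bl_pos (bu k)))).
- by apply: bl_N; apply: bl_M => //; exact: bl_norm.
- exact: (bl_shift (eps *: basis_rV k) (bl_M bw (bl_neg (bu k)))).
Qed.

End bounded_lipschitz.

(** * The upwind operator *)

Section upwind.
Context {R : realType} {n : nat}.
Local Notation mu := (lebesgue_rV R n).
Implicit Types (w f g : 'rV[R]_n -> R) (u : 'I_n -> 'rV[R]_n -> R).

Lemma Rintegral_cubeD f g : continuous_torus f -> continuous_torus g ->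
  \int[mu]_(x in cube n) (f x + g x) = \int[mu]_(x in cube n) f x + \int[mu]_(x in cube n) g x.
Proof.
by move=> cf cg; apply: RintegralD; [exact: measurable_cubeT|exact: integrable_cube|exact: integrable_cube].
Qed.

Lemma Rintegral_cubeZ (c : R) f : continuous_torus f ->
  \int[mu]_(x in cube n) (c * f x) = c * \int[mu]_(x in cube n) f x.
Proof. by move=> cf; apply: RintegralZl; [exact: measurable_cubeT|exact: integrable_cube]. Qed.

Lemma Rintegral_cube_sum (I : Type) (s : seq I) (F : I -> 'rV[R]_n -> R) :
  (forall i, continuous_torus (F i)) ->
  \int[mu]_(x in cube n) (\sum_(i <- s) F i x) = \sum_(i <- s) \int[mu]_(x in cube n) F i x.
Proof.
move=> cF; elim: s => [|i s IH].
  rewrite big_nil; transitivity (\int[mu]_(x in cube n) (0 : R)).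
    by apply: eq_Rintegral_in => x _; rewrite big_nil.
  by rewrite Rintegral_cst ?mul0r//; exact: measurable_cubeT.
rewrite big_cons -IH -Rintegral_cubeD//; last exact: continuous_torus_sum.
by apply: eq_Rintegral_in => x _; rewrite big_cons.
Qed.

Lemma norm_Rintegral_cube_le f (K : R) : continuous_torus f -> (forall x, `|f x| <= K) ->
  `|\int[mu]_(x in cube n) f x| <= K * fine (mu (cube n)).
Proof.
move=> cf fK; rewrite -Rintegral_cst; last exact: measurable_cubeT.
apply: norm_Rintegral_le => //; first exact: measurable_cubeT.
  exact: integrable_cube.
exact: (integrable_cube (continuous_torus_cst K)).
Qed.

Lemma continuous_torus_pos f : continuous_torus f -> continuous_torus f^\+.
Proof. by move=> cf; apply: continuous_torus_max => //; exact: continuous_torus_cst. Qed.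

Lemma continuous_torus_neg f : continuous_torus f -> continuous_torus f^\-.
Proof. by move=> cf; apply: continuous_torus_pos; exact: continuous_torusN. Qed.

(** The upwind scheme is in conservation form: it only moves mass around. *)
Lemma Rintegral_upwind (eps : R) u w : (forall k, continuous_torus (u k)) -> continuous_torus w ->
  \int[mu]_(x in cube n) upwind eps u w x = 0.
Proof.
move=> cu cw.
have c1 k : continuous_torus (fun x => w x * (u k)^\+ x).
  by apply: continuous_torusM => //; exact: continuous_torus_pos.
have c2 k : continuous_torus (fun x => w x * (u k)^\- x).
  by apply: continuous_torusM => //; exact: continuous_torus_neg.
have c3 k : continuous_torus (fun x => - (w x * `|u k x|)).
  by apply: continuous_torusN; apply: continuous_torusM => //; exact: continuous_torus_norm.
have s1 k := continuous_torus_shift (- (eps *: basis_rV k)) (c1 k).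
have s2 k := continuous_torus_shift (eps *: basis_rV k) (c2 k).
have s13 k := continuous_torusD (s1 k) (c3 k).
have s132 k := continuous_torusD (s13 k) (s2 k).
rewrite /upwind Rintegral_cubeZ; last exact: continuous_torus_sum.
rewrite Rintegral_cube_sum// big1 ?mulr0// => k _.
rewrite (Rintegral_cubeD (s13 k) (s2 k)) (Rintegral_cubeD (s1 k) (c3 k)).
rewrite (Rintegral_cube_translate _ (c1 k)) (Rintegral_cube_translate _ (c2 k)).
rewrite -Rintegral_cubeD// -Rintegral_cubeD//; last exact: continuous_torusD.
transitivity (\int[mu]_(x in cube n) (0 : R)).
  apply: eq_Rintegral_in => x _; rewrite /funrneg /funrpos.
  case: (leP 0 (u k x)) => h.
    by rewrite ger0_norm// max_r ?oppr_le0// mulr0 addr0 subrr.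
  rewrite ltr0_norm// max_l ?oppr_ge0 ?(ltW h)//; ring.
by rewrite Rintegral_cst ?mul0r//; exact: measurable_cubeT.
Qed.

Lemma upwind_linear (eps a b : R) u w1 w2 x :
  upwind eps u (fun y => a * w1 y + b * w2 y) x = a * upwind eps u w1 x + b * upwind eps u w2 x.
Proof.
rewrite /upwind (mulrCA a) (mulrCA b) -mulrDr; congr (_ * _).
rewrite !mulr_sumr -big_split/=.
by apply: eq_bigr => k _; ring.
Qed.

(** What leaves the cell of [x] is proportional to [w x], and what enters it is
    nonnegative: in particular the operator is nonnegative where [w] vanishes. *)
Lemma upwind_ge (eps : R) u w x : 0 < eps -> (forall y, 0 <= w y) ->
  - (eps^-1 * (w x * \sum_k `|u k x|)) <= upwind eps u w x.
Proof.
move=> e0 w0; rewrite -mulrN ler_wpM2l ?invr_ge0 ?(ltW e0)//.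
rewrite mulr_sumr -sumrN; apply: ler_sum => k _.
rewrite -[leLHS]addr0 lerD//; last by rewrite mulr_ge0// le_max lexx orbT.
by rewrite -[leLHS]add0r lerD2r mulr_ge0// le_max lexx orbT.
Qed.

Lemma upwind_le (eps W V : R) u w x : 0 < eps -> (forall y, 0 <= w y <= W) ->
  (forall k y, `|u k y| <= V) -> upwind eps u w x <= eps^-1 * (n%:R * (2 * (V * W))).
Proof.
move=> e0 wW uV; rewrite ler_wpM2l ?invr_ge0 ?(ltW e0)//.
have W0 : 0 <= W by case/andP: (wW x); exact: le_trans.
rewrite (_ : n%:R * _ = \sum_(k < n) 2 * (V * W)); last first.
  by rewrite sumr_const card_ord mulr_natl.
apply: ler_sum => k _.
have V0 : 0 <= V by exact: le_trans (uV k x).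
have wp y (z : R) : 0 <= z <= V -> w y * z <= V * W.
  by move=> /andP[z0 zV]; case/andP: (wW y) => h1 h2; rewrite mulrC ler_pM.
have p y : 0 <= (u k)^\+ y <= V.
  rewrite /funrpos le_max lexx orbT ge_max V0 andbT.
  exact: le_trans (ler_norm _) (uV k y).
have m y : 0 <= (u k)^\- y <= V.
  rewrite /funrneg /funrpos le_max lexx orbT ge_max V0 andbT.
  by rewrite (le_trans (ler_norm _))// normrN.
have := wp (x - eps *: basis_rV k) _ (p (x - eps *: basis_rV k)).
have := wp (x + eps *: basis_rV k) _ (m (x + eps *: basis_rV k)).
have : 0 <= w x * `|u k x| by rewrite mulr_ge0//; case/andP: (wW x).
rewrite /=; lra.
Qed.

End upwind.

Section c1_torus.
Context {R : realType} {n : nat}.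

Lemma uniform_cvg_ball (I : Type) (F : set_system I) {FF : Filter F}
    (h : I -> 'rV[R]_n -> R) (g : 'rV[R]_n -> R) :
  (forall e : R, 0 < e -> \forall i \near F, forall x, `|g x - h i x| < e) ->
  {uniform, h @ F --> g}.
Proof.
move=> H P /uniform_nbhs[E [entE EP]].
move: entE; rewrite -entourage_ballE => -[e /= e0 eE].
have := H e e0; rewrite /nbhs/= => He.
apply: filterS He => i hi; apply: EP => x _; apply: eE => /=.
by rewrite -ball_normE /=.
Qed.

(** The remainder is quadratic uniformly in x, hence the difference quotients
    converge uniformly. *)
Lemma C1_torus_intro (f df : R -> 'rV[R]_n -> R) :
  (forall t : R, 0 <= t -> continuous_torus (f t) /\ continuous_torus (df t)) ->
  (forall T : R, exists2 C : R, 0 <= C & forall s t : R, 0 <= s <= T -> 0 <= t <= T ->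
    forall x, `|f t x - f s x - (t - s) * df s x| <= C * (t - s) ^+ 2 /\
      `|df t x - df s x| <= C * `|t - s|) ->
  C1_torus f df.
Proof.
move=> cf H t t0; have [cft cdft] := cf t t0; split=> //.
- have [C C0 fC] := H (t + 1); have C1 : 0 < C + 1 by rewrite ltr_wpDl.
  apply: uniform_cvg_ball => e e0; exists (Num.min 1 (e / (C + 1))) => /=.
    by rewrite lt_min ltr01 divr_gt0.
  move=> h /=; rewrite sub0r normrN lt_min => /andP[h1 he] h0 th x.
  have tT : 0 <= t <= t + 1 by rewrite t0 lerDl ler01.
  have thT : 0 <= t + h <= t + 1.
    by rewrite th lerD2l (le_trans (ler_norm _))// ltW.
  have [fh _] := fC t (t + h) tT thT x; rewrite (_ : t + h - t = h) in fh; last by rewrite addrAC subrr add0r.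
  rewrite distrC (_ : _ - _ = h^-1 * (f (t + h) x - f t x - h * df t x)); last first.
    by field.
  rewrite normrM normfV ltr_pdivrMl ?normr_gt0//; apply: (le_lt_trans fh).
  rewrite -(real_normK (num_real h)) expr2 mulrCA ltr_pM2l ?normr_gt0//.
  move: he; rewrite ltr_pdivlMr// => he; apply: le_lt_trans he.
  by rewrite mulrC ler_wpM2l// lerDl.
- have [C C0 fC] := H (t + 1); have C1 : 0 < C + 1 by rewrite ltr_wpDl.
  apply: uniform_cvg_ball => e e0; exists (Num.min 1 (e / (C + 1))) => /=.
    by rewrite lt_min ltr01 divr_gt0.
  move=> s /=; rewrite lt_min => /andP[h1 he] s0 x.
  have tT : 0 <= t <= t + 1 by rewrite t0 lerDl ler01.
  have sT : 0 <= s <= t + 1.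
    by rewrite s0/=; have := ler_norm (s - t); rewrite distrC; lra.
  have [_ fh] := fC s t sT tT x; apply: (le_lt_trans fh).
  move: he; rewrite ltr_pdivlMr// => he; apply: le_lt_trans he.
  by rewrite mulrC ler_wpM2l// lerDl.
Qed.

Lemma finite_uniform_bound (J : finType) (P : J -> R -> Prop) :
  (forall i K K', P i K -> K <= K' -> P i K') ->
  (forall i, exists2 K : R, 0 <= K & P i K) -> exists2 K : R, 0 <= K & forall i, P i K.
Proof.
move=> Pmono H; pose K i := sval (cid2 (H i)).
have K0 i : 0 <= K i by rewrite /K; case: cid2.
exists (\sum_i K i); first exact: sumr_ge0.
move=> i; apply: (Pmono i (K i)); first by rewrite /K; case: cid2.
by rewrite (bigD1 i)//= lerDl sumr_ge0.
Qed.

End c1_torus.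

(** * Global solutions of bounded Lipschitz systems *)

Section ode.
Context {R : realType} {n : nat} {J : finType}.
Local Notation state := (J -> 'rV[R]_n -> R).
Variables (F : R -> state -> state) (X0 : state).
Hypothesis blF : forall i, bounded_lipschitz (fun t X => F t X i).
Hypothesis X0_adm : admissible X0.

Let F_bounded (T : R) : exists2 K : R, 0 <= K & forall i (t : R) X x,
  0 <= t <= T -> admissible X -> `|F t X i x| <= K.
Proof.
apply: (finite_uniform_bound (P := fun i K => forall (t : R) X x,
  0 <= t <= T -> admissible X -> `|F t X i x| <= K)).
  by move=> i K K' k KK t X x tT aX; exact: le_trans (k t X x tT aX) KK.
by move=> i; exact: (bl_bounded (blF i)).
Qed.

Let F_lipschitz (T : R) : exists2 L : R, 0 <= L & forall i (s t : R) X Y (d : R), 0 <= d ->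
  0 <= s <= T -> 0 <= t <= T -> admissible X -> admissible Y -> state_le X Y d ->
  forall x, `|F s X i x - F t Y i x| <= L * (`|s - t| + d).
Proof.
apply: (finite_uniform_bound (P := fun i L => forall (s t : R) X Y (d : R), 0 <= d ->
  0 <= s <= T -> 0 <= t <= T -> admissible X -> admissible Y -> state_le X Y d ->
  forall x, `|F s X i x - F t Y i x| <= L * (`|s - t| + d))).
  move=> i K K' k KK s t X Y d d0 sT tT aX aY XY x.
  by apply: (le_trans (k s t X Y d d0 sT tT aX aY XY x)); rewrite ler_wpM2r// addr_ge0.
by move=> i; exact: (bl_lipschitz (blF i)).
Qed.

Theorem ode_solution (i0 : J) : exists X : R -> state,
  [/\ forall i x, X 0 i x = X0 i x,
      forall t : R, 0 <= t -> admissible (X t),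
      forall i, C1_torus (fun t => X t i) (fun t => F t (X t) i),
      forall i x, c11 (fun t => X t i x) (fun t => F t (X t) i x) &
      forall T : R, exists2 C : R, 0 <= C & forall s t : R, 0 <= s <= T -> 0 <= t <= T -> forall i x,
        `|X t i x - X s i x - (t - s) * F s (X s) i x| <= C * (t - s) ^+ 2].
Proof.
have Fadm (t : R) X : 0 <= t -> admissible X -> admissible (F t X).
  by move=> t0 aX i; exact: (bl_torus (blF i)).
have Fb (T : R) : exists K : R, forall (t : R) X i x,
    0 <= t <= T -> admissible X -> `|F t X i x| <= K.
  by have [K _ k] := F_bounded T; exists K => t X i x; exact: k.
have Fl (T : R) : exists2 L : R, 0 <= L & forall (s t : R) X Y (d : R),
    0 <= s <= T -> 0 <= t <= T -> admissible X -> admissible Y -> state_le X Y d ->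
    state_le (F s X) (F t Y) (L * (`|s - t| + d)).
  have [L L0 l] := F_lipschitz T; exists L => // s t X Y d sT tT aX aY XY i x.
  by apply: l => //; exact: le_trans (XY i0 0).
have [X [XX0 Xadm XC]] := picard_solution X0_adm Fadm Fb Fl.
exists X; split=> //.
- move=> i; apply: C1_torus_intro => [t t0|T].
    by split; [exact: Xadm|exact: Fadm (Xadm _ t0) i].
  have [C C0 c] := XC T; have [K K0 k] := F_bounded T; have [L L0 l] := F_lipschitz T.
  have [T0|T0] := ltP T 0.
    by exists 0 => // s t /andP[s0 sT]; have := le_trans s0 sT; rewrite leNgt T0.
  have CTK : 0 <= C * T + K by rewrite addr_ge0// mulr_ge0.
  have LL : 0 <= L * (1 + (C * T + K)) by rewrite mulr_ge0// addr_ge0.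
  exists (C + L * (1 + (C * T + K))); first by rewrite addr_ge0.
  move=> s t sT tT x; split.
    apply: (le_trans (c s t sT tT i x)).
    by rewrite ler_wpM2r ?sqr_ge0// lerDl.
  have ts : `|t - s| <= T by rewrite ler_norml; lra.
  have aX (r : R) : 0 <= r <= T -> admissible (X r) by case/andP => r0 _; exact: Xadm.
  have XY : state_le (X t) (X s) ((C * T + K) * `|t - s|).
    move=> i' y; rewrite -[X t i' y - _](subrK ((t - s) * F s (X s) i' y)).
    apply: (le_trans (ler_normD _ _)); rewrite (mulrDl (C * T)) lerD//.
      apply: (le_trans (c s t sT tT i' y)).
      rewrite -(real_normK (num_real (t - s))) expr2 mulrA ler_wpM2r// ler_wpM2l//.
    by rewrite normrM mulrC ler_wpM2r//; apply: k => //; exact: aX.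
  apply: (le_trans (l i t s (X t) (X s) _ (mulr_ge0 CTK (normr_ge0 _)) tT sT (aX _ tT) (aX _ sT) XY x)).
  have CC : 0 <= C * `|t - s| by exact: mulr_ge0.
  by move: CC; lra.
- move=> i x; apply: c11_intro => T.
  have [C C0 c] := XC T; have [K K0 k] := F_bounded T.
  exists (C + K) => s t sT tT; split.
    by apply: (le_trans (c s t sT tT i x)); rewrite ler_wpM2r ?sqr_ge0// lerDl.
  apply: (@le_trans _ _ K); last by rewrite lerDr.
  by apply: k => //; apply: Xadm; case/andP: sT.
Qed.

End ode.

(** * The acceleration as a functional of the state *)

Section truncation.
Context {R : realType} {n : nat}.
Hypothesis n2 : (2 <= n)%N.
Local Notation mu := (lebesgue_rV R n).
Variables (phi : 'rV[R]_n -> R) (dphi : 'I_n -> 'rV[R]_n -> R) (B M : R).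
Hypothesis c2phi : c2_bounded phi dphi B M.
Variables (G alpha eps : R).
Hypotheses (G0 : 0 <= G) (alpha0 : 0 <= alpha) (eps01 : 0 < eps <= 1).

Let acc (r : 'rV[R]_n -> R) (j : 'I_n) : 'rV[R]_n -> R :=
  'D_(basis_rV j) (potential G alpha phi eps r).

(** The potential is linear in the density, so its bound is a Lipschitz estimate. *)
Lemma bl_acceleration {J : Type} (f : R -> (J -> 'rV[R]_n -> R) -> 'rV[R]_n -> R) j :
  bounded_lipschitz f -> bounded_lipschitz (fun t X => acc (f t X) j).
Proof.
move=> [fT fL fB].
set A := G * (M * @covering_number R n B * @kernel_mass R n) * eps `^ (- (n.+1%:R * alpha)).
have H r (K : R) x : 0 <= K -> continuous_torus r -> (forall y, `|r y| <= K) ->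
    `|acc r j x| <= `|A| * (K * fine (mu (cube n))).
  move=> K0 cr rK; apply: (le_trans (acceleration_bound n2 c2phi G0 alpha0 eps01 j x cr)).
  rewrite -/A; have := norm_Rintegral_cube_le (continuous_torus_norm cr) (K := K).
  rewrite ger0_norm ?Rintegral_ge0// => h.
  apply: (@le_trans _ _ (`|A| * \int[mu]_(y in cube n) `|r y|)).
    by rewrite ler_wpM2r ?Rintegral_ge0// ler_norm.
  by rewrite ler_wpM2l// h// => y; rewrite normr_id.
have mu0 : 0 <= fine (mu (cube n)) by rewrite fine_ge0.
split.
- by move=> t X t0 aX; apply: (acceleration_torus n2 c2phi G0 alpha0 eps01); exact: fT.
- move=> T; have [K K0 k] := fL T; exists (`|A| * (K * fine (mu (cube n)))); first by rewrite !mulr_ge0.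
  move=> s t X Y d d0 sT tT aX aY XY x.
  have cs : continuous_torus (f s X) by apply: fT => //; case/andP: sT.
  have ct : continuous_torus (f t Y) by apply: fT => //; case/andP: tT.
  rewrite -(accelerationB n2 c2phi G0 alpha0 eps01 j x cs ct).
  have dd : 0 <= K * (`|s - t| + d) by rewrite mulr_ge0// addr_ge0.
  have := H _ _ x dd (continuous_torusB cs ct) (k s t X Y d d0 sT tT aX aY XY).
  by rewrite (mulrAC K) [X in _ <= X -> _]mulrA.
- move=> T; have [K K0 k] := fB T; exists (`|A| * (K * fine (mu (cube n)))); first by rewrite !mulr_ge0.
  move=> t X x tT aX; apply: H => //; last by move=> y; exact: k.
  by apply: fT => //; case/andP: tT.
Qed.

End truncation.

(** * Global solutions of the scheme *)

Section existence.
Context {R : realType} {n : nat}.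
Hypothesis n2 : (2 <= n)%N.
Local Notation mu := (lebesgue_rV R n).
Variables (phi : 'rV[R]_n -> R) (dphi : 'I_n -> 'rV[R]_n -> R) (B M : R).
Hypothesis c2phi : c2_bounded phi dphi B M.
Variables (G alpha eps : R).
Hypotheses (G0 : 0 <= G) (alpha0 : 0 <= alpha) (eps01 : 0 < eps <= 1).
Variables (rho0 : 'rV[R]_n -> R) (u0 : 'I_n -> 'rV[R]_n -> R) (U0 : R).
Hypotheses (crho0 : continuous_torus rho0) (cu0 : forall j, continuous_torus (u0 j)).
Hypotheses (rho0_gt0 : forall x, 0 < rho0 x) (U0_ge0 : 0 <= U0).
Hypothesis u0_le : forall j x, `|u0 j x| <= U0.

Let acc (r : 'rV[R]_n -> R) (j : 'I_n) : 'rV[R]_n -> R :=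
  'D_(basis_rV j) (potential G alpha phi eps r).
Let mass : R := \int[mu]_(x in cube n) rho0 x.

Definition acceleration_constant : R := G * (M * @covering_number R n B * @kernel_mass R n).
Let C : R := acceleration_constant * eps `^ (- (n.+1%:R * alpha)) * mass.

Let eps0 : 0 < eps. Proof. by case/andP: eps01. Qed.

Let mass_ge0 : 0 <= mass.
Proof. by apply: Rintegral_ge0 => x _; exact: ltW. Qed.

Lemma acceleration_constant_ge0 : 0 <= acceleration_constant.
Proof.
have M0 : 0 <= M := le_trans (normr_ge0 _) (c2_bound c2phi 0).
by rewrite /acceleration_constant !mulr_ge0 ?covering_number_ge0 ?kernel_mass_ge0.
Qed.

Let C_ge0 : 0 <= C.
Proof. by apply: mulr_ge0 => //; apply: mulr_ge0; [exact: acceleration_constant_ge0|exact: powR_ge0]. Qed.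

(* V is the speed reached under the acceleration C; P is its primitive. *)
Let V (t : R) : R := U0 + C * t.
Let P (t : R) : R := U0 * t + C / 2 * (t * t).

Let V_ge0 (t : R) : 0 <= t -> 0 <= V t.
Proof. by move=> t0; apply: addr_ge0 => //; exact: mulr_ge0. Qed.

Let P_ge0 (t : R) : 0 <= t -> 0 <= P t.
Proof. move=> t0; have C2 : 0 <= C / 2 by rewrite divr_ge0.
by apply: addr_ge0; apply: mulr_ge0 => //; exact: mulr_ge0. Qed.

Let V_c11 : c11 V (fun=> C).
Proof.
have := c11D (c11_cst U0) (c11Z C (@c11_id R)); congr c11.
by apply/funext => t; rewrite add0r mulr1.
Qed.

Let P_c11 : c11 P V.
Proof.
have := c11D (c11Z U0 (@c11_id R)) (c11Z (C / 2) (c11M (@c11_id R) (@c11_id R))); congr c11.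
by apply/funext => t; rewrite /V/=; lra.
Qed.

Variables (d0 R0 : R).
Hypotheses (d0_gt0 : 0 < d0) (rho0_bounds : forall x, d0 <= rho0 x <= R0).

(* If the speed is at most V, the density loses at most the fraction n V / eps
   per unit of time, and gains at most 2 n V / eps times its maximum. *)
Let delta (t : R) : R := d0 * expR (- (n%:R / eps) * P t).
Let Rmax (t : R) : R := R0 * expR (2 * n%:R / eps * P t).

Let delta_c11 : c11 delta (fun t => - (n%:R / eps) * V t * delta t).
Proof.
have := c11Z d0 (c11_expR (c11Z (- (n%:R / eps)) P_c11)); congr c11.
by apply/funext => t; rewrite /delta; ring.
Qed.

Let Rmax_c11 : c11 Rmax (fun t => 2 * n%:R / eps * V t * Rmax t).
Proof.
have := c11Z R0 (c11_expR (c11Z (2 * n%:R / eps) P_c11)); congr c11.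
by apply/funext => t; rewrite /Rmax; ring.
Qed.

Let delta_gt0 t : 0 < delta t. Proof. by rewrite mulr_gt0 ?expR_gt0. Qed.

Let delta_Rmax (t : R) : 0 <= t -> delta t <= Rmax t.
Proof.
move=> t0; have /andP[h1 h2] := rho0_bounds 0.
rewrite ler_pM ?(ltW d0_gt0) ?expR_ge0 ?(le_trans h1)// ler_expR.
have e0 : 0 <= n%:R / eps by rewrite divr_ge0// ltW.
have := mulr_ge0 e0 (P_ge0 t0); rewrite -(mulrA 2); lra.
Qed.

Local Notation state := (option 'I_n -> 'rV[R]_n -> R).

(* Density and momenta are cut off at the bounds that are expected of them; the
   velocity is then at most V, and never involves a division by a small density. *)
Let r (t : R) (X : state) (x : 'rV[R]_n) : R :=
  Num.max (delta t) (Num.min (X None x) (Rmax t)).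
Let q (j : 'I_n) (t : R) (X : state) (x : 'rV[R]_n) : R :=
  Num.max (- (V t * r t X x)) (Num.min (X (Some j) x) (V t * r t X x)).
Let v (j : 'I_n) (t : R) (X : state) (x : 'rV[R]_n) : R := q j t X x * (r t X x)^-1.

Definition truncated_field (t : R) (X : state) (i : option 'I_n) (x : 'rV[R]_n) : R :=
  if i is Some j then
    upwind eps (fun k => v k t X) (q j t X) x + - (r t X x * acc (r t X) j x)
  else upwind eps (fun k => v k t X) (r t X) x.

Let bl_r : bounded_lipschitz r.
Proof. exact: (bl_clamp None (bl_time delta_c11) (bl_time Rmax_c11)). Qed.

Let r_ge t X x : delta t <= r t X x.
Proof. by rewrite le_max lexx. Qed.

Let r_gt0 t X x : 0 < r t X x.
Proof. exact: lt_le_trans (r_ge t X x). Qed.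

Let r_le t X x : 0 <= t -> r t X x <= Rmax t.
Proof. by move=> t0; rewrite ge_max delta_Rmax//= ge_min lexx orbT. Qed.

Let bl_q j : bounded_lipschitz (q j).
Proof.
have bVr := bl_M (bl_time V_c11) bl_r.
exact: (bl_clamp (Some j) (bl_N bVr) bVr).
Qed.

Let bl_v j : bounded_lipschitz (v j).
Proof.
apply: bl_M; first exact: bl_q.
apply: bl_V; first exact: bl_r.
move=> T; exists (d0 * expR (- (n%:R / eps) * P `|T|)); first by rewrite mulr_gt0 ?expR_gt0.
move=> t X x /andP[t0 tT]; apply: le_trans (r_ge t X x).
rewrite /delta ler_wpM2l ?(ltW d0_gt0)// ler_expR !mulNr lerN2 ler_wpM2l//.
  by rewrite divr_ge0// ltW.
have tT' : t <= `|T| by exact: le_trans (ler_norm _).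
by rewrite /P lerD// ler_wpM2l// ?divr_ge0// ler_pM.
Qed.

Let bl_truncated_field i : bounded_lipschitz (fun t X => truncated_field t X i).
Proof.
case: i => [j|]; last exact: bl_upwind.
apply: bl_D; first exact: bl_upwind.
exact: (bl_N (bl_M bl_r (bl_acceleration n2 c2phi G0 alpha0 eps01 j bl_r))).
Qed.

Let q_le j t X x : 0 <= t -> `|q j t X x| <= V t * r t X x.
Proof.
move=> t0; have Vr : 0 <= V t * r t X x by rewrite mulr_ge0 ?V_ge0// ltW.
rewrite ler_norml le_max lexx/= ge_max ge_min lexx orbT andbT; lra.
Qed.

Let v_le j t X x : 0 <= t -> `|v j t X x| <= V t.
Proof.
move=> t0; rewrite normrM normfV (gtr0_norm (r_gt0 t X x)) ler_pdivrMr//.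
exact: q_le.
Qed.

Let init (i : option 'I_n) (x : 'rV[R]_n) : R :=
  if i is Some j then rho0 x * u0 j x else rho0 x.

Let init_adm : admissible init.
Proof. by case=> [j|] //=; exact: continuous_torusM. Qed.

Section solution.
Variable X : R -> state.
Hypothesis X_init : forall i x, X 0 i x = init i x.
Hypothesis X_adm : forall t : R, 0 <= t -> admissible (X t).
Hypothesis X_c11 : forall i x, c11 (fun t => X t i x) (fun t => truncated_field t (X t) i x).
Hypothesis X_taylor : forall T : R, exists2 K : R, 0 <= K &
  forall s t : R, 0 <= s <= T -> 0 <= t <= T -> forall i x,
  `|X t i x - X s i x - (t - s) * truncated_field s (X s) i x| <= K * (t - s) ^+ 2.

(* Where the density is below delta, the cut-off density equals delta, and the
   scheme cannot decrease it faster than delta decreases. *)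
Let density_ge (t : R) x : 0 <= t -> delta t <= X t None x.
Proof.
move=> t0; rewrite -subr_ge0 -[- _]mulN1r; move: t t0; apply: (comparison (c11D (X_c11 None x) (c11Z (-1) delta_c11))).
  rewrite X_init /delta /P !mulr0 addr0 mulr0 expR0 mulN1r mulr1 subr_ge0.
  by case/andP: (rho0_bounds x).
move=> t t0; rewrite mulN1r subr_lt0 => Xd.
have rd : r t (X t) x = delta t.
  by rewrite /r max_l// ge_min (ltW Xd).
have h := upwind_ge (fun k => v k t (X t)) x eps0 (fun y => ltW (r_gt0 t (X t) y)).
rewrite mulN1r subr_ge0; apply: le_trans h; rewrite rd !mulNr lerN2.
have : \sum_k `|v k t (X t) x| <= n%:R * V t.
  apply: (@le_trans _ _ (\sum_(k < n) V t)); first by apply: ler_sum => k _; exact: v_le.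
  by rewrite sumr_const card_ord mulr_natl.
move=> h; rewrite (_ : n%:R / eps * V t * delta t = eps^-1 * (delta t * (n%:R * V t))); last by ring.
rewrite ler_wpM2l ?invr_ge0 ?(ltW eps0)// ler_wpM2l// ltW//.
Qed.

Let density_le (t : R) x : 0 <= t -> X t None x <= Rmax t.
Proof.
move=> t0; rewrite -subr_ge0 -[- _]mulN1r; move: t t0; apply: (comparison (c11D Rmax_c11 (c11Z (-1) (X_c11 None x)))).
  rewrite X_init /Rmax /P !mulr0 addr0 mulr0 expR0 mulN1r mulr1 subr_ge0.
  by case/andP: (rho0_bounds x).
move=> t t0 _.
have rb y : 0 <= r t (X t) y <= Rmax t by rewrite (ltW (r_gt0 _ _ _)) r_le.
have h := upwind_le x eps0 rb (fun k y => v_le k (X t) y t0).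
rewrite mulN1r subr_ge0; apply: (le_trans h).
by rewrite (_ : _ / eps * V t * Rmax t = eps^-1 * (n%:R * (2 * (V t * Rmax t))))//; ring.
Qed.

Let densityE (t : R) : 0 <= t -> r t (X t) = X t None.
Proof.
move=> t0; apply/funext => x; rewrite /r min_l ?density_le// max_r// density_ge//.
Qed.

(* The field has mass zero, so the increments of the mass are quadratic in the
   time step. *)
Let truncated_mass (t : R) : 0 <= t -> \int[mu]_(x in cube n) X t None x = mass.
Proof.
move=> t0; have [K K0 k] := X_taylor t.
pose f s := \int[mu]_(x in cube n) X s None x.
have fK (s u : R) : 0 <= s -> s <= u -> u <= t ->
    `|f u - f s| <= K * fine (mu (cube n)) * (u - s) ^+ 2.
  move=> s0 su ut.
  have sT : 0 <= s <= t by rewrite s0 (le_trans su).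
  have uT : 0 <= u <= t by rewrite (le_trans s0).
  have cs := X_adm s0 None.
  have cu := X_adm (le_trans s0 su) None.
  have ns := continuous_torusM (continuous_torus_cst (-1)) cs.
  have cF : continuous_torus (truncated_field s (X s) None).
    exact: (bl_torus (bl_truncated_field None)) s0 (X_adm s0).
  have nF := continuous_torusM (continuous_torus_cst (- (u - s))) cF.
  have uF := continuous_torusD (continuous_torusD cu ns) nF.
  have F0 : \int[mu]_(x in cube n) truncated_field s (X s) None x = 0.
    apply: Rintegral_upwind => [j|].
      exact: (bl_torus (bl_v j)) s0 (X_adm s0).
    exact: (bl_torus bl_r) s0 (X_adm s0).
  have -> : f u - f s = \int[mu]_(x in cube n)
      (X u None x + (-1) * X s None x + (- (u - s)) * truncated_field s (X s) None x).
    rewrite (Rintegral_cubeD (continuous_torusD cu ns) nF) (Rintegral_cubeD cu ns).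
    by rewrite (Rintegral_cubeZ _ cF) F0 mulr0 addr0 (Rintegral_cubeZ _ cs) mulN1r.
  rewrite mulrAC; apply: norm_Rintegral_cube_le => // x.
  by rewrite mulN1r mulNr; exact: k.
have f0 : f 0 = mass by apply: eq_Rintegral_in => x _; rewrite X_init.
rewrite -/(f t) -f0; apply/eqP; rewrite eq_le; apply/andP; split.
  apply: (quadratic_nonincreasing (T := t) (C := K * fine (mu (cube n))) (f := f)) => //.
  by move=> s u s0 su ut; apply: le_trans (fK s u s0 su ut); exact: ler_norm.
rewrite -lerN2.
apply: (quadratic_nonincreasing (T := t) (C := K * fine (mu (cube n))) (f := fun s => - f s)) => //.
move=> s u s0 su ut; apply: le_trans (fK s u s0 su ut).
by rewrite distrC opprK addrC ler_norm.
Qed.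

Let truncated_acceleration (t : R) j x : 0 <= t -> `|acc (X t None) j x| <= C.
Proof.
move=> t0; rewrite /C -(truncated_mass t0).
apply: (le_trans (acceleration_bound n2 c2phi G0 alpha0 eps01 j x (X_adm t0 None))).
rewrite le_eqVlt; apply/orP; left; apply/eqP; congr (_ * _).
apply: eq_Rintegral_in => y _; rewrite ger0_norm//.
exact: le_trans (ltW (delta_gt0 t)) (density_ge y t0).
Qed.

(* Where V rho + sg m_j is negative, its cut-off version vanishes, so that the
   scheme can only increase it; the growth rate C of V compensates the force. *)
Let momentum_sign (sg : R) (t : R) j x : `|sg| = 1 -> 0 <= t ->
  0 <= V t * X t None x + sg * X t (Some j) x.
Proof.
move=> sg1; move: t.
apply: (comparison (c11D (c11M V_c11 (X_c11 None x)) (c11Z sg (X_c11 (Some j) x)))).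
  rewrite !X_init /V mulr0 addr0 /= mulrCA (mulrC U0) -mulrDr mulr_ge0 ?(ltW (rho0_gt0 x))//.
  have := u0_le j x; rewrite -[`|_|]mul1r -sg1 -normrM ler_norml; lra.
move=> t t0 neg.
have q0 y : 0 <= V t * r t (X t) y + sg * q j t (X t) y.
  have := q_le j (X t) y t0; rewrite -[leLHS]mul1r -sg1 -normrM ler_norml; lra.
have rx : 0 < r t (X t) x := r_gt0 t (X t) x.
have Vr : 0 <= V t * r t (X t) x by rewrite mulr_ge0 ?V_ge0 ?(ltW rx).
have qx : V t * r t (X t) x + sg * q j t (X t) x = 0.
  move: neg; rewrite -(densityE t0) /q.
  move: (V t * r t (X t) x) Vr (X t (Some j) x) => a a0 b.
  have [sgp|sgn] := leP 0 sg.
    have -> : sg = 1 by rewrite -sg1 ger0_norm.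
    move=> h; have ba : b < - a by lra.
    rewrite min_l; last by lra.
    rewrite max_l; [lra|exact: ltW].
  have -> : sg = -1 by rewrite -[sg]opprK -(ltr0_norm sgn) sg1.
  move=> h; have ba : a < b by lra.
  rewrite min_r; last exact: ltW.
  rewrite max_r; lra.
have up : 0 <= upwind eps (fun k => v k t (X t)) (fun y => V t * r t (X t) y + sg * q j t (X t) y) x.
  by have := upwind_ge (fun k => v k t (X t)) x eps0 q0; rewrite qx mul0r mulr0 oppr0.
rewrite upwind_linear in up.
have ac : `|sg * (r t (X t) x * acc (r t (X t)) j x)| <= C * r t (X t) x.
  by rewrite normrM sg1 mul1r normrM (gtr0_norm rx) mulrC ler_wpM2r ?(ltW rx)// densityE// truncated_acceleration.
move: up ac; rewrite /truncated_field ler_norml -(densityE t0) => up /andP[_ ac]; lra.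
Qed.

Let momentum_le (t : R) j x : 0 <= t -> `|X t (Some j) x| <= V t * X t None x.
Proof.
move=> t0; have := momentum_sign j x (normr1 R) t0.
have := @momentum_sign (-1) t j x (etrans (normrN _) (normr1 R)) t0.
by rewrite ler_norml; lra.
Qed.

Let momentumE (t : R) j : 0 <= t -> q j t (X t) = X t (Some j).
Proof.
move=> t0; apply/funext => x; rewrite /q densityE//.
by have := momentum_le j x t0; rewrite ler_norml => /andP[h1 h2]; rewrite min_l// max_r.
Qed.

Let velocityE (t : R) : 0 <= t -> (fun j => v j t (X t)) = velocity (X t None) (fun j => X t (Some j)).
Proof.
by move=> t0; apply/funext => j; apply/funext => x; rewrite /v momentumE// densityE.
Qed.

Lemma truncated_solution :
  (forall i, C1_torus (fun t => X t i) (fun t => truncated_field t (X t) i)) ->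
  [/\ is_solution G alpha phi eps rho0 u0 (fun t => X t None)
        (fun t => truncated_field t (X t) None) (fun t j => X t (Some j))
        (fun t j => truncated_field t (X t) (Some j)),
      forall t : R, 0 <= t -> \int[mu]_(x in cube n) X t None x = mass &
      forall (t : R) j x, 0 <= t -> `|X t (Some j) x| <= V t * X t None x].
Proof.
move=> C1.
have XC t : 0 <= t -> continuous_torus (X t None) by move=> t0; exact: X_adm.
split; [split|exact: truncated_mass|by move=> t j x; exact: momentum_le].
- exact: (C1 None).
- by move=> j; exact: (C1 (Some j)).
- by move=> t x t0; exact: lt_le_trans (delta_gt0 t) (density_ge x t0).
- by move=> t j x t0; exact: (potential_derivable n2 c2phi G0 alpha0 eps01 (XC t t0)).
- by move=> t x t0; rewrite /truncated_field velocityE// densityE.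
- move=> t j x t0; rewrite /truncated_field /acc (velocityE t0) (densityE t0) (momentumE j t0).
  exact: erefl.
- by move=> x; exact: X_init.
- by move=> j x; exact: X_init.
Qed.

End solution.

Lemma exists_solution_bounds : exists rho drho m dm,
  [/\ is_solution G alpha phi eps rho0 u0 rho drho m dm,
      forall t : R, 0 <= t -> \int[mu]_(x in cube n) rho t x = mass &
      forall (t : R) j x, 0 <= t -> `|m t j x| <= V t * rho t x].
Proof.
have [X [Xi Xa XC1 Xc Xt]] := ode_solution bl_truncated_field init_adm None.
by have H := truncated_solution Xi Xa Xc Xt XC1; do 4 eexists; exact: H.
Qed.

End existence.

(** The bounds on mass and velocity are what the consistency estimates need. *)
Theorem exists_solution {R : realType} {n : nat} (n2 : (2 <= n)%N)
  (phi : 'rV[R]_n -> R) dphi (B M : R) (c2phi : c2_bounded phi dphi B M) (G alpha eps : R)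
  (G0 : 0 <= G) (alpha0 : 0 <= alpha) (eps01 : 0 < eps <= 1)
  (rho0 : 'rV[R]_n -> R) (u0 : 'I_n -> 'rV[R]_n -> R) (U0 : R) :
  continuous_torus rho0 -> (forall j, continuous_torus (u0 j)) -> (forall x, 0 < rho0 x) ->
  0 <= U0 -> (forall j x, `|u0 j x| <= U0) ->
  exists rho drho m dm,
  [/\ is_solution G alpha phi eps rho0 u0 rho drho m dm,
      forall t : R, 0 <= t -> \int[lebesgue_rV R n]_(x in cube n) rho t x = \int[lebesgue_rV R n]_(x in cube n) rho0 x &
      forall (t : R) j x, 0 <= t -> `|m t j x| <= (U0 + @acceleration_constant R n B M G *
        eps `^ (- (n.+1%:R * alpha)) * \int[lebesgue_rV R n]_(x in cube n) rho0 x * t) * rho t x].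
Proof.
move=> crho0 cu0 rho0_gt0 U0_ge0 u0_le.
have [c cmin] := periodic_min crho0; have [K K0 kmax] := periodic_bounded crho0.
apply: (exists_solution_bounds n2 c2phi G0 alpha0 eps01 crho0 cu0 rho0_gt0 U0_ge0 u0_le (rho0_gt0 c) (R0 := K)).
by move=> x; rewrite cmin (le_trans (ler_norm _)).
Qed.

(** * Weak consistency of the upwind operator *)

Section bounded_support.
Context {R : realType} {n : nat}.
Local Notation mu := (lebesgue_rV R n).
Implicit Types (f g : 'rV[R]_n -> R).

Definition bounded_support f := measurable_fun setT f /\
  exists r M : R, (forall x, `|f x| <= M) /\ (forall x, ~ rbox r x -> f x = 0).

Lemma bounded_support_integrable f : bounded_support f -> mu.-integrable setT (EFin \o f).
Proof. by move=> [mf [r [M [fM f0]]]]; exact: (integrable_support mf fM f0). Qed.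

Lemma bounded_supportD f g : bounded_support f -> bounded_support g ->
  bounded_support (fun x => f x + g x).
Proof.
move=> [mf [r [M [fM f0]]]] [mg [s [K [gK g0]]]]; split; first exact: measurable_funD.
exists (Num.max r s), (M + K); split=> [x|x xr].
  by rewrite (le_trans (ler_normD _ _))// lerD.
rewrite f0 ?g0 ?addr0//; apply: subset_rbox xr; by rewrite le_max lexx ?orbT.
Qed.

Lemma bounded_supportZ (c : R) f : bounded_support f -> bounded_support (fun x => c * f x).
Proof.
move=> [mf [r [M [fM f0]]]]; split; first exact: measurable_funM.
exists r, (`|c| * M); split=> [x|x xr]; first by rewrite normrM ler_wpM2l.
by rewrite f0// mulr0.
Qed.

Lemma bounded_support_torusM g f : continuous_torus g -> bounded_support f ->
  bounded_support (fun x => g x * f x).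
Proof.
move=> cg [mf [r [M [fM f0]]]]; have [K K0 gK] := periodic_bounded cg; split.
  by apply: measurable_funM => //; exact: continuous_torus_measurable.
exists r, (K * M); split=> [x|x xr]; first by rewrite normrM ler_pM.
by rewrite f0// mulr0.
Qed.

Lemma bounded_support_sum (I : Type) (s : seq I) (F : I -> 'rV[R]_n -> R) :
  (forall i, bounded_support (F i)) -> bounded_support (fun x => \sum_(i <- s) F i x).
Proof.
move=> bF; elim: s => [|i s IH].
  under eq_fun do rewrite big_nil.
  by split; [exact: measurable_cst|exists 0, 0; split=> // x; rewrite normr0].
by under eq_fun do rewrite big_cons; exact: bounded_supportD.
Qed.

Lemma bounded_support_shift f (a : 'rV[R]_n) : bounded_support f ->
  bounded_support (fun x => f (x + a)).
Proof.
move=> [mf [r [M [fM f0]]]]; split; first exact: measurable_shift.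
exists (r + `|a|), M; split=> // x xr; apply: f0 => /rboxP xar; apply: xr; apply/rboxP => i.
rewrite -[x](addrK a) mxE (le_trans (ler_normD _ _))// lerD//.
by rewrite mxE normrN; exact: rV_coord_le.
Qed.

Lemma RintegralD_support f g : bounded_support f -> bounded_support g ->
  \int[mu]_x (f x + g x) = \int[mu]_x f x + \int[mu]_x g x.
Proof.
by move=> bf bg; apply: RintegralD; [exact: measurableT|exact: bounded_support_integrable|exact: bounded_support_integrable].
Qed.

Lemma Rintegral_support_sum (I : Type) (s : seq I) (F : I -> 'rV[R]_n -> R) :
  (forall i, bounded_support (F i)) ->
  \int[mu]_x (\sum_(i <- s) F i x) = \sum_(i <- s) \int[mu]_x F i x.
Proof.
move=> bF; elim: s => [|i s IH].
  rewrite big_nil; transitivity (\int[mu]_x (0 : R)).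
    by apply: eq_Rintegral_in => x _; rewrite big_nil.
  by rewrite /Rintegral integral0.
rewrite big_cons -IH -RintegralD_support//; last exact: bounded_support_sum.
by apply: eq_Rintegral_in => x _; rewrite big_cons.
Qed.

Lemma c2_bounded_support psi dpsi (B M : R) : c2_bounded psi dpsi B M -> bounded_support psi.
Proof.
move=> H; split; first by apply: continuous_rV_measurable; exact: (c2_continuous H).
by exists B, M; split; [exact: (c2_bound H)|exact: (c2_support H)].
Qed.

Lemma c2_bounded_dsupport psi dpsi (B M : R) k : c2_bounded psi dpsi B M -> bounded_support (dpsi k).
Proof.
move=> H; split; first by apply: continuous_rV_measurable; exact: (c2_dcontinuous H).
by exists B, M; split; [exact: (c2_dbound H)|exact: (c2_dsupport H)].
Qed.

End bounded_support.

Section upwind_weak.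
Context {R : realType} {n : nat}.
Local Notation mu := (lebesgue_rV R n).
Variables (psi : 'rV[R]_n -> R) (dpsi : 'I_n -> 'rV[R]_n -> R) (B M : R).
Hypothesis c2psi : c2_bounded psi dpsi B M.
Variables (eps : R) (p w : 'rV[R]_n -> R) (V W : R).
Hypotheses (eps01 : 0 < eps <= 1) (cp : continuous_torus p) (cw : continuous_torus w).
Hypotheses (p0 : forall x, 0 <= p x) (V0 : 0 <= V) (W0 : 0 <= W).
Hypothesis wp : forall x, `|w x| <= W * p x.

Let flux (u : 'rV[R]_n -> R) k x : R :=
  (w \* u^\+) (x - eps *: basis_rV k) - w x * `|u x| + (w \* u^\-) (x + eps *: basis_rV k).

Let weak_error_term u k x : R := eps^-1 * (flux u k x * psi x) - w x * (u x * dpsi k x).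

Let funrposBneg (a : R) : Num.max a 0 - Num.max (- a) 0 = a.
Proof. by case: (leP 0 a) => h; [rewrite max_r ?oppr_le0//|rewrite max_l ?oppr_ge0 ?(ltW h)//]; lra. Qed.

Let funrposDneg (a : R) : Num.max a 0 + Num.max (- a) 0 = `|a|.
Proof.
by case: (leP 0 a) => h; [rewrite max_r ?oppr_le0// ger0_norm|rewrite max_l ?oppr_ge0 ?(ltW h)// ltr0_norm]; rewrite ?addr0 ?add0r.
Qed.

Let dual_error u k x : R :=
  (w x * u^\+ x) * (eps^-1 * (psi (x + eps *: basis_rV k) - psi x - eps * dpsi k x)) +
  (w x * u^\- x) * (eps^-1 * (psi (x - eps *: basis_rV k) - psi x + eps * dpsi k x)).

Let M0 : 0 <= M. Proof. exact: le_trans (normr_ge0 _) (c2_bound c2psi 0). Qed.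

Let eps0 : 0 < eps. Proof. by case/andP: eps01. Qed.

Let supp_psi : bounded_support psi := c2_bounded_support c2psi.

Let supp_flux u k : continuous_torus u -> bounded_support (fun x => flux u k x * psi x).
Proof.
move=> cu; apply: bounded_support_torusM => //.
have c1 := continuous_torusM cw (continuous_torus_pos cu).
have c2 := continuous_torusM cw (continuous_torus_neg cu).
apply: continuous_torusD; last exact: (continuous_torus_shift (eps *: basis_rV k) c2).
apply: continuous_torusB; first exact: (continuous_torus_shift (- (eps *: basis_rV k)) c1).
by apply: continuous_torusM => //; exact: continuous_torus_norm.
Qed.

Let supp_term u k : continuous_torus u -> bounded_support (weak_error_term u k).
Proof.
move=> cu; have h1 := bounded_supportZ eps^-1 (supp_flux k cu).
have h2 := bounded_support_torusM cw (bounded_support_torusM cu (c2_bounded_dsupport k c2psi)).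
have := bounded_supportD h1 (bounded_supportZ (-1) h2); congr bounded_support.
by apply/funext => x; rewrite mulN1r.
Qed.

(** Summation by parts: the differences of the scheme are moved to the test
    function by translation invariance of the integral. *)
Let weak_error_termE u k : continuous_torus u ->
  \int[mu]_x weak_error_term u k x = \int[mu]_x dual_error u k x.
Proof.
move=> cu; set a := eps *: basis_rV k.
have c1 := continuous_torusM cw (continuous_torus_pos cu).
have c2 := continuous_torusM cw (continuous_torus_neg cu).
pose T1 x := w x * u^\+ x * (eps^-1 * psi (x + a)).
pose T2 x := w x * u^\- x * (eps^-1 * psi (x - a)).
pose T3 x := (- (w x * `|u x|)) * (eps^-1 * psi x) + (- w x) * (u x * dpsi k x).
have b1 : bounded_support T1.
  exact: (bounded_support_torusM c1 (bounded_supportZ eps^-1 (bounded_support_shift a supp_psi))).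
have b2 : bounded_support T2.
  exact: (bounded_support_torusM c2 (bounded_supportZ eps^-1 (bounded_support_shift (- a) supp_psi))).
have b3 : bounded_support T3.
  apply: bounded_supportD.
    apply: (bounded_support_torusM _ (bounded_supportZ eps^-1 supp_psi)).
    by apply: continuous_torusN; apply: continuous_torusM => //; exact: continuous_torus_norm.
  apply: (bounded_support_torusM (continuous_torusN cw)).
  exact: (bounded_support_torusM cu (c2_bounded_dsupport k c2psi)).
have s1 := bounded_support_shift (- a) b1; have s2 := bounded_support_shift a b2.
transitivity (\int[mu]_x (T1 (x - a) + T2 (x + a) + T3 x)).
  apply: eq_Rintegral_in => x _; rewrite /T1 /T2 /T3 subrK addrK /weak_error_term /flux -/a /=; ring.
rewrite (RintegralD_support (bounded_supportD s1 s2) b3) (RintegralD_support s1 s2).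
rewrite (Rintegral_translate (- a) b1.1) (Rintegral_translate a b2.1).
rewrite -(RintegralD_support b1 b2) -(RintegralD_support (bounded_supportD b1 b2) b3).
apply: eq_Rintegral_in => x _; rewrite /T1 /T2 /T3 /dual_error /funrneg /funrpos -/a.
rewrite -(funrposDneg (u x)) -[in X in _ + - w x * (X * _)](funrposBneg (u x)).
have e : eps^-1 * eps = 1 by rewrite mulVf// gt_eqF.
rewrite !mulrBr !mulrDr !(mulrA eps^-1 eps) e; ring.
Qed.

Let supp_dual_error u k : continuous_torus u -> bounded_support (dual_error u k).
Proof.
move=> cu; pose a := eps *: basis_rV k.
have c1 := continuous_torusM cw (continuous_torus_pos cu).
have c2 := continuous_torusM cw (continuous_torus_neg cu).
have b v s := bounded_supportZ eps^-1 (bounded_supportD (bounded_supportD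
  (bounded_support_shift v supp_psi) (bounded_supportZ (-1) supp_psi))
  (bounded_supportZ s (c2_bounded_dsupport k c2psi))).
have := bounded_supportD (bounded_support_torusM c1 (b a (- eps)))
  (bounded_support_torusM c2 (b (- a) eps)); congr bounded_support.
by apply/funext => x; rewrite /dual_error !mulN1r mulNr.
Qed.

Let dual_error_bound u k x : `|u x| <= V -> `|dual_error u k x| <= M * eps * (V * W) * p x.
Proof.
move=> uV.
have T1 : `|eps^-1 * (psi (x + eps *: basis_rV k) - psi x - eps * dpsi k x)| <= M * eps.
  rewrite normrM (gtr0_norm (_ : 0 < eps^-1)) ?invr_gt0// ler_pdivrMl//.
  by apply: (le_trans (c2_taylor c2psi k x eps)); rewrite expr2 mulrCA.
have T2 : `|eps^-1 * (psi (x - eps *: basis_rV k) - psi x + eps * dpsi k x)| <= M * eps.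
  rewrite normrM (gtr0_norm (_ : 0 < eps^-1)) ?invr_gt0// ler_pdivrMl//.
  have := c2_taylor c2psi k x (- eps); rewrite scaleNr mulNr opprK sqrrN expr2.
  by rewrite mulrCA.
have up : 0 <= u^\+ x by rewrite le_max lexx orbT.
have un : 0 <= u^\- x by rewrite le_max lexx orbT.
have Me : 0 <= M * eps by rewrite mulr_ge0// ltW.
apply: (@le_trans _ _ (`|w x| * `|u x| * (M * eps))); last first.
  rewrite mulrC -mulrA ler_wpM2l// mulrC (le_trans (ler_pM _ _ uV (wp x)))//.
  by rewrite mulrA.
rewrite -(funrposDneg (u x)) mulrDr mulrDl (le_trans (ler_normD _ _))// lerD//.
  by rewrite normrM (normrM (w x)) (ger0_norm up) ler_wpM2l// mulr_ge0.
by rewrite normrM (normrM (w x)) (ger0_norm un) ler_wpM2l// mulr_ge0.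
Qed.

(** The error is linear in the flux [w], which is measured against the density
    [p]: for the density itself W = 1, and for a momentum W = V. *)
Lemma upwind_weak_error (u : 'I_n -> 'rV[R]_n -> R) :
  (forall k, continuous_torus (u k)) -> (forall k x, `|u k x| <= V) ->
  `|\int[mu]_x (upwind eps u w x * psi x - w x * \sum_(k < n) u k x * dpsi k x)| <=
  n%:R * (M * eps * (V * W) * (@covering_number R n (B + 1) * \int[mu]_(x in cube n) p x)).
Proof.
move=> cu uV.
rewrite (_ : \int[mu]_x _ = \int[mu]_x (\sum_(k < n) weak_error_term (u k) k x)); last first.
  apply: eq_Rintegral_in => x _.
  by rewrite /upwind sumrB -!mulr_sumr -mulr_suml mulrA.
rewrite Rintegral_support_sum; last by move=> k; exact: supp_term.
apply: (le_trans (ler_norm_sum _ _ _)).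
rewrite mulr_natl -[X in _ <= _ *+ X]card_ord -sumr_const; apply: ler_sum => k _.
rewrite weak_error_termE//; apply: Rintegral_support_bound => //.
- by rewrite !mulr_ge0// ltW.
- exact: (supp_dual_error k (cu k)).1.
- by move=> x; exact: dual_error_bound.
- move=> x xB.
  have xB' : ~ rbox B x by apply: subset_rbox xB; rewrite lerDl.
  have sh (h : R) : `|h| <= 1 -> psi (x + h *: basis_rV k) = 0.
    move=> h1; apply: (c2_support c2psi) => /rboxP xhB; apply: xB; apply/rboxP => i.
    rewrite -[x](addrK (h *: basis_rV k)) mxE (le_trans (ler_normD _ _))// lerD//.
    rewrite !mxE normrN normrM eqxx/=; apply: le_trans h1.
    by case: (i == k); rewrite ?normr1 ?normr0 ?mulr1 ?mulr0.
  have e1 : `|eps| <= 1 by rewrite gtr0_norm//; case/andP: eps01.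
  have s1 : psi (x + eps *: basis_rV k) = 0 by exact: sh.
  have s2 : psi (x - eps *: basis_rV k) = 0 by rewrite -scaleNr sh// normrN.
  rewrite /dual_error s1 s2 (c2_support c2psi xB') (c2_dsupport c2psi k xB').
  by rewrite !(mulr0, subrr, addr0).
Qed.

End upwind_weak.

(** * Weak consistency of the mollified Poisson equation *)

Section mollification_weak.
Context {R : realType} {n : nat}.
Local Notation mu := (lebesgue_rV R n).

(** Boundedness and bounded support make [F] integrable on the product. *)
Lemma Rintegral_swap (F : 'rV[R]_n * 'rV[R]_n -> R) (r1 r2 K : R) :
  measurable_fun setT F -> (forall z, `|F z| <= K) ->
  (forall x y, ~ rbox r1 x -> F (x, y) = 0) -> (forall x y, ~ rbox r2 y -> F (x, y) = 0) ->
  \int[mu]_x \int[mu]_y F (x, y) = \int[mu]_y \int[mu]_x F (x, y) /\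
  measurable_fun setT (fun y => \int[mu]_x F (x, y)).
Proof.
move=> mF FK F1 F2.
have K0 : 0 <= K by exact: le_trans (normr_ge0 _) (FK (0, 0)).
have mF1 x : measurable_fun setT (fun y => F (x, y)) by exact: (measurableT_comp mF (pair1_measurable x)).
have mF2 y : measurable_fun setT (fun x => F (x, y)) by exact: (measurableT_comp mF (pair2_measurable y)).
have i1 x : mu.-integrable setT (EFin \o (fun y => F (x, y))).
  by apply: (integrable_support (mF1 x) (fun y => FK (x, y))) => y; exact: F2.
have i2 y : mu.-integrable setT (EFin \o (fun x => F (x, y))).
  by apply: (integrable_support (mF2 y) (fun x => FK (x, y))) => x; exact: F1.
have mEF : measurable_fun setT (EFin \o F) by exact/measurable_EFinP.
have iF : (mu \x mu)%E.-integrable setT (EFin \o F).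
  apply/integrable12ltyP => //.
  have i3 : mu.-integrable setT (EFin \o (fun x => K * (fine (mu (rbox r2))) * \1_(rbox r1) x)).
    apply: (@integrable_support _ _ _ r1 (K * fine (mu (rbox r2)))).
    - by apply: measurable_funM => //; apply: measurable_indic; exact: measurable_rbox.
    - move=> x; rewrite normrM ger0_norm ?mulr_ge0 ?fine_ge0//.
      by rewrite ler_piMr ?mulr_ge0 ?fine_ge0// indicE; case: (_ \in _); rewrite ?normr1 ?normr0.
    - by move=> x xr; rewrite indicE memNset// mulr0.
  apply: le_lt_trans (integrableP _ _ _ i3).2.
  apply: ge0_le_integral => //.
  - by move=> x _; exact: integral_ge0.
  - apply: (measurable_fun_fubini_tonelli_F (m2 := mu) (abse \o (EFin \o F))); last by move=> z; exact: abse_ge0.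
    exact: measurableT_comp.
  - by apply: measurableT_comp => //; exact: (measurable_int _ i3).
  move=> x _.
  have -> : (\int[mu]_y `|(EFin \o F) (x, y)| = \int[mu]_(y in rbox r2) `|(F (x, y))%:E|)%E.
    rewrite [RHS]integral_mkcond; apply: eq_integral => y _; rewrite patchE.
    by case: ifPn => //= yr; rewrite F2 ?normr0// => h; move: yr; rewrite notin_setE.
  have [xr|xr] := pselect (rbox r1 x); last first.
    under eq_integral do rewrite F1//= normr0.
    by rewrite integral0.
  rewrite /= indicE mem_set// mulr1 ger0_norm ?mulr_ge0 ?fine_ge0// EFinM fineK; last first.
    by rewrite ge0_fin_numE// lebesgue_rbox_fin.
  rewrite -integral_cst; last exact: measurable_rbox.
  apply: ge0_le_integral => //.
  - exact: measurable_rbox.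
  - by apply: measurable_funTS; apply/measurable_EFinP; apply: (measurableT_comp _ (mF1 x)).
  - by move=> y _; rewrite lee_fin.
split.
  rewrite /Rintegral; congr fine.
  transitivity (\int[mu]_x \int[mu]_y (EFin \o F) (x, y))%E.
    by apply: eq_integral => x _; rewrite fineK//; exact: (integrable_fin_num measurableT (i1 x)).
  rewrite Fubini//; apply: eq_integral => y _.
  by rewrite fineK//; exact: (integrable_fin_num measurableT (i2 y)).
by apply: (measurableT_comp _ (measurable_fubini_G iF)) => //; exact: fine_measurable.
Qed.

Lemma Rintegral_mollifier (alpha eps : R) (phi : 'rV[R]_n -> R) : 0 < eps ->
  measurable_fun setT phi -> (forall x, 0 <= phi x) -> \int[mu]_x phi x = 1 ->
  \int[mu]_x mollifier alpha eps phi x = 1.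
Proof.
move=> e0 mphi phi0 phi1; rewrite /Rintegral /mollifier.
set l := (eps `^ alpha)^-1; set c := eps `^ _.
have l0 : 0 < l by rewrite invr_gt0 powR_gt0.
have mphiE : measurable_fun setT (EFin \o phi) by exact/measurable_EFinP.
have mphil : measurable_fun setT (fun x : 'rV[R]_n => (phi (l *: x + 0))%:E).
  apply: (measurableT_comp mphiE); exact: measurable_rV_affine.
under eq_integral do rewrite EFinM -[l *: _]addr0.
rewrite ge0_integralZl//; last first.
- by rewrite lee_fin powR_ge0.
- by move=> x _; rewrite lee_fin.
rewrite (ge0_integral_affine 0 (f := EFin \o phi))//; last first.
  by rewrite gt_eqF.
have : fine (\int[mu]_x (phi x)%:E)%E = 1 by exact: phi1.
case: (\int[mu]_x (phi x)%:E)%E => [a /= ->|/= /eqP|/= /eqP]; rewrite ?(eq_sym 0) ?oner_eq0//.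
rewrite mulr1 gtr0_norm// /c /l exprVn invrK -powR_mulrn ?powR_ge0//.
rewrite -powRrM -powRD; last by apply/implyP => _; rewrite gt_eqF.
by rewrite (mulrC alpha) addNr powRr0.
Qed.

Section error.
Variables (psi : 'rV[R]_n -> R) (dpsi : 'I_n -> 'rV[R]_n -> R) (B M : R).
Hypothesis c2psi : c2_bounded psi dpsi B M.

Let M0 : 0 <= M. Proof. exact: le_trans (normr_ge0 _) (c2_bound c2psi 0). Qed.

Lemma c2_lipschitz_rbox (r : R) (x y : 'rV[R]_n) : rbox r y -> `|psi (x + y) - psi x| <= n%:R * (M * r).
Proof.
move=> /rboxP yr.
have H (s : seq 'I_n) : `|psi (x + \sum_(k <- s) y ord0 k *: basis_rV k) - psi x| <= \sum_(k <- s) (M * r).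
  elim: s => [|k s IH]; first by rewrite !big_nil addr0 subrr normr0.
  rewrite !big_cons (addrC (_ *: _)) addrA; set z := x + _.
  rewrite -[X in `|X|](subrKA (psi z)) (le_trans (ler_normD _ _))// lerD//.
  by rewrite (le_trans (c2_lipschitz c2psi k z _))// ler_wpM2l.
have := H (index_enum 'I_n); rewrite sumr_const card_ord mulr_natl; apply: le_trans.
by have <- : y = \sum_(k < n) y ord0 k *: basis_rV k by exact: row_sum_delta.
Qed.

Variables (p w : 'rV[R]_n -> R) (r D K : R).
Hypotheses (cp : continuous_torus p) (p0 : forall x, 0 <= p x).
Hypotheses (mw : measurable_fun setT w) (w0 : forall x, 0 <= w x) (wK : forall x, `|w x| <= K).
Hypotheses (supp_w : forall x, ~ rbox r x -> w x = 0) (w1 : \int[mu]_x w x = 1).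
Hypotheses (r0 : 0 <= r) (rD : r <= D).

Let displacement (y : 'rV[R]_n) : R := \int[mu]_x ((p (x - y) - p x) * psi x).

Let displacement_bound y : rbox r y ->
  `|displacement y| <= n%:R * (M * r) * (@covering_number R n (B + D) * \int[mu]_(x in cube n) p x).
Proof.
move=> yr; have D0 : 0 <= D by exact: le_trans rD.
have supp := c2_bounded_support c2psi.
have b1 : bounded_support (fun x => p x * psi (x + y)).
  exact: bounded_support_torusM cp (bounded_support_shift y supp).
have b2 : bounded_support (fun x => - p x * psi x).
  exact: bounded_support_torusM (continuous_torusN cp) supp.
have -> : displacement y = \int[mu]_x (p x * (psi (x + y) - psi x)).
  transitivity (\int[mu]_x (p (x - y) * psi (x - y + y) + - p x * psi x)).
    by apply: eq_Rintegral_in => x _; rewrite subrK mulrBl mulNr.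
  rewrite (RintegralD_support (bounded_support_shift (- y) b1) b2) (Rintegral_translate (- y) b1.1).
  rewrite -(RintegralD_support b1 b2).
  by apply: eq_Rintegral_in => x _; rewrite mulrBr mulNr.
apply: Rintegral_support_bound => //.
- by rewrite !mulr_ge0.
- have := (bounded_supportD b1 b2).1; congr (measurable_fun _).
  by apply/funext => x; rewrite mulrBr mulNr.
- by move=> x; rewrite normrM mulrC (ger0_norm (p0 x)) ler_wpM2r// c2_lipschitz_rbox.
- move=> x xB.
  have xB' : ~ rbox B x by apply: subset_rbox xB; rewrite lerDl.
  rewrite (c2_support c2psi xB') (c2_support c2psi) ?subrr ?mulr0// => /rboxP xyB.
  apply: xB; apply/rboxP => i; rewrite -[x](addrK y) mxE (le_trans (ler_normD _ _))// lerD//.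
  by rewrite mxE normrN (le_trans _ rD)//; move/rboxP: yr.
Qed.

(** By Fubini the error is the average over the mollifier of the integrals of
    (p (x - y) - p x) psi x, in which the translation can be moved to [psi]. *)
Lemma mollification_weak_error :
  `|\int[mu]_x ((convolution p w x - p x) * psi x)| <=
  n%:R * (M * r) * (@covering_number R n (B + D) * \int[mu]_(x in cube n) p x).
Proof.
have [P P0 pP] := periodic_bounded cp.
pose F (z : 'rV[R]_n * 'rV[R]_n) : R := (p (z.1 - z.2) - p z.1) * psi z.1 * w z.2.
have mpm := continuous_torus_measurable cp.
have mpsi := (c2_bounded_support c2psi).1.
have mF : measurable_fun setT F.
  apply: measurable_funM; last exact: measurableT_comp measurable_snd.
  apply: measurable_funM; last exact: measurableT_comp measurable_fst.
  apply: measurable_funB; last exact: measurableT_comp measurable_fst.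
  apply: (measurableT_comp mpm); apply/measurable_fun_rVP => i.
  rewrite (_ : (fun _ => _) = (fun z : 'rV[R]_n * 'rV[R]_n => z.1 ord0 i - z.2 ord0 i)); last first.
    by apply/funext => z; rewrite !mxE.
  by apply: measurable_funB; apply: (measurableT_comp (measurable_coord_rV i)).
have FK z : `|F z| <= (P + P) * M * K.
  rewrite !normrM ler_pM ?mulr_ge0// ler_pM ?(c2_bound c2psi)//.
  by rewrite (le_trans (ler_normB _ _))// lerD.
have [swap mG] := Rintegral_swap (r1 := B) (r2 := r) mF FK
  (fun x y xB => etrans (congr1 (fun a => _ * a * _) (c2_support c2psi xB)) (etrans (congr1 (fun a => a * _) (mulr0 _)) (mul0r _)))
  (fun x y yr => etrans (congr1 (fun a => _ * a) (supp_w yr)) (mulr0 _)).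
have iw : bounded_support w by split=> //; exists r, K.
have -> : \int[mu]_x ((convolution p w x - p x) * psi x) = \int[mu]_x \int[mu]_y F (x, y).
  apply: eq_Rintegral_in => x _; rewrite /convolution.
  have -> : p x = p x * \int[mu]_y w y by rewrite w1 mulr1.
  have ic := convolution_integrable mw wK supp_w x cp.
  have ipw : mu.-integrable setT (fun y => (p x * w y)%:E).
    exact: (bounded_support_integrable (bounded_supportZ (p x) iw)).
  rewrite -RintegralZl//; last exact: bounded_support_integrable.
  rewrite -RintegralB// mulrC -RintegralZl//.
    by apply: eq_Rintegral_in => y _; rewrite /F/=; ring.
  have := integrableB measurableT ic ipw.
  by apply: eq_integrable.
rewrite swap.
have GE y : \int[mu]_x F (x, y) = w y * displacement y.
  have bs : bounded_support (fun x => (p (x - y) - p x) * psi x).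
    apply: bounded_support_torusM (c2_bounded_support c2psi).
    exact: continuous_torusB (continuous_torus_shift (- y) cp) cp.
  rewrite -RintegralZl//; last exact: bounded_support_integrable.
  by apply: eq_Rintegral_in => x _; rewrite /F/= mulrC.
set b := n%:R * _ * _.
have Gb y : `|\int[mu]_x F (x, y)| <= b * w y.
  rewrite GE normrM (ger0_norm (w0 y)) mulrC.
  have [yr|yr] := pselect (rbox r y); last by rewrite (supp_w yr) !mulr0.
  by rewrite ler_wpM2r// displacement_bound.
have bsG : bounded_support (fun y => \int[mu]_x F (x, y)).
  split=> //; exists r, (`|b| * K); split=> [y|y yr]; last by rewrite GE supp_w// mul0r.
  apply: (le_trans (Gb y)); apply: (le_trans (ler_norm _)); rewrite normrM.
  by rewrite ler_wpM2l.
rewrite -[leRHS]mulr1 -w1 -RintegralZl//; last exact: bounded_support_integrable.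
apply: norm_Rintegral_le => //.
- exact: bounded_support_integrable.
- exact: (bounded_support_integrable (bounded_supportZ b iw)).
Qed.

End error.

End mollification_weak.

(** * Consistency of a solution of the scheme *)

Section consistency.
Context {R : realType} {n : nat}.
Local Notation mu := (lebesgue_rV R n).
Variables (G alpha eps : R) (phi : 'rV[R]_n -> R) (dphi : 'I_n -> 'rV[R]_n -> R) (B M : R).
Hypothesis c2phi : c2_bounded phi dphi B M.
Hypotheses (phi_ge0 : forall x, 0 <= phi x) (phi_int1 : \int[mu]_x phi x = 1).
Hypotheses (G0 : 0 <= G) (alpha0 : 0 <= alpha) (eps01 : 0 < eps <= 1).
Variables (rho0 : 'rV[R]_n -> R) (u0 : 'I_n -> 'rV[R]_n -> R).
Variables (rho drho : R -> 'rV[R]_n -> R) (m dm : R -> 'I_n -> 'rV[R]_n -> R).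
Hypothesis sol : is_solution G alpha phi eps rho0 u0 rho drho m dm.
Variables (t V K : R).
Hypotheses (t0 : 0 <= t) (V0 : 0 <= V) (m_le : forall j x, `|m t j x| <= V * rho t x).
Hypothesis mass_le : \int[mu]_(x in cube n) rho t x <= K.
Variables (psi : 'rV[R]_n -> R) (dpsi : 'I_n -> 'rV[R]_n -> R) (B' M' : R).
Hypothesis c2psi : c2_bounded psi dpsi B' M'.
Local Notation u := (velocity (rho t) (m t)).

Let crho : continuous_torus (rho t).
Proof. by have [] := solution_rho_C1 sol t0. Qed.

Let cm j : continuous_torus (m t j).
Proof. by have [] := solution_m_C1 sol j t0. Qed.

Let rho_gt0 x : 0 < rho t x. Proof. exact: (solution_rho_gt0 sol). Qed.

Let rho_ge0 x : 0 <= rho t x. Proof. exact: ltW. Qed.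

Let M0 : 0 <= M'. Proof. exact: le_trans (normr_ge0 _) (c2_bound c2psi 0). Qed.

Let cu k : continuous_torus (u k).
Proof.
by apply: continuous_torusM => //; apply: continuous_torusV => // x; rewrite gt_eqF.
Qed.

Let u_le k x : `|u k x| <= V.
Proof. by rewrite normrM normfV (gtr0_norm (rho_gt0 x)) ler_pdivrMr. Qed.

Let scheme_error (W : R) : 0 <= W ->
  n%:R * (M' * eps * (V * W) * (@covering_number R n (B' + 1) * \int[mu]_(x in cube n) rho t x)) <=
  n%:R * (M' * (@covering_number R n (B' + 1) * K)) * (eps * (V * W)).
Proof.
move=> W0; have e0 : 0 <= eps by case/andP: eps01 => /ltW.
have Q : @covering_number R n (B' + 1) * \int[mu]_(x in cube n) rho t x <= @covering_number R n (B' + 1) * K.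
  by rewrite ler_wpM2l ?covering_number_ge0.
have c0 : 0 <= n%:R * (M' * eps * (V * W)) by rewrite !mulr_ge0.
move: Q; move: (_ * \int[_]_(_ in _) _) (_ * K) => q q' /(ler_wpM2l c0); lra.
Qed.

Lemma density_weak_error :
  `|\int[mu]_x (drho t x * psi x - rho t x * \sum_(k < n) u k x * dpsi k x)| <=
  n%:R * (M' * (@covering_number R n (B' + 1) * K)) * (eps * V).
Proof.
rewrite -(mulr1 V); apply: le_trans (scheme_error ler01).
have w1 x : `|rho t x| <= 1 * rho t x by rewrite mul1r ger0_norm.
have := upwind_weak_error c2psi eps01 crho crho rho_ge0 V0 ler01 w1 cu u_le.
by rewrite [in X in X -> _](_ : \int[mu]_x _ = \int[mu]_x (drho t x * psi x - rho t x * \sum_(k < n) u k x * dpsi k x))//;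
  apply: eq_Rintegral_in => x _; rewrite (solution_rho_eq sol).
Qed.

Lemma momentum_weak_error j :
  `|\int[mu]_x (dm t j x * psi x - m t j x * (\sum_(k < n) u k x * dpsi k x)
      + rho t x * 'D_(basis_rV j) (potential G alpha phi eps (rho t)) x * psi x)| <=
  n%:R * (M' * (@covering_number R n (B' + 1) * K)) * (eps * (V * V)).
Proof.
apply: le_trans (scheme_error V0).
have := upwind_weak_error c2psi eps01 crho (cm j) rho_ge0 V0 V0 (m_le j) cu u_le.
set lhs := (X in `|X| <= _ -> _); set rhs := (X in _ -> `|X| <= _).
suff -> : lhs = rhs by [].
apply: eq_Rintegral_in => x _; rewrite (solution_m_eq sol) //.
by move: ('D_(basis_rV j) _ x) => a; ring.
Qed.

Lemma poisson_weak_error :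
  `|\int[mu]_x ((poisson_rhs G alpha phi eps (rho t) x - 4 * pi * G * rho t x) * psi x)| <=
  4 * pi * G * (n%:R * (M' * B) * (@covering_number R n (B' + B) * K)) * eps `^ alpha.
Proof.
have /andP[e0 e1] := eps01.
set w := mollifier alpha eps phi.
have mphi : measurable_fun setT phi by apply: continuous_rV_measurable; exact: (c2_continuous c2phi).
have ea : 0 < eps `^ alpha by exact: powR_gt0.
have ea1 : eps `^ alpha <= 1.
  by rewrite -(powRr0 eps); apply: ger_powR.
have w0 x : 0 <= w x by rewrite mulr_ge0 ?powR_ge0.
have supp x : ~ rbox (B * eps `^ alpha) x -> w x = 0.
  move=> xr; rewrite /w /mollifier (c2_support c2phi) ?mulr0// => /rboxP xB.
  apply: xr; apply/rboxP => i; have := xB i.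
  by rewrite mxE normrM gtr0_norm ?invr_gt0// ler_pdivrMl// mulrC.
have BD : B * eps `^ alpha <= B by rewrite ler_piMr// (c2_ge0 c2phi).
have Be0 : 0 <= B * eps `^ alpha by rewrite mulr_ge0 ?(c2_ge0 c2phi)// ltW.
have cG : 0 <= 4 * pi * G by rewrite !mulr_ge0// pi_ge0.
have mw := measurable_mollifier c2phi alpha eps.
have := mollification_weak_error c2psi crho rho_ge0 mw w0 (mollifier_bound c2phi alpha0 eps01)
  supp (Rintegral_mollifier alpha e0 mphi phi_ge0 phi_int1) Be0 BD.
set I := \int[mu]_x _ => hI.
have -> : \int[mu]_x ((poisson_rhs G alpha phi eps (rho t) x - 4 * pi * G * rho t x) * psi x) = 4 * pi * G * I.
  rewrite -RintegralZl//.
    by apply: eq_Rintegral_in => x _; rewrite /poisson_rhs -mulrBr mulrA.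
  apply: bounded_support_integrable; apply: bounded_support_torusM (c2_bounded_support c2psi).
  apply: continuous_torusB => //.
  exact: (convolution_torus mw (mollifier_bound c2phi alpha0 eps01) supp crho).
rewrite normrM ger0_norm// -[leRHS]mulrA ler_wpM2l//; apply: (le_trans hI).
rewrite -!mulrA ler_wpM2l// ler_wpM2l// ler_wpM2l ?(c2_ge0 c2phi)// [leRHS]mulrA [leRHS]mulrC.
by rewrite ler_wpM2l ?(ltW ea)// ler_wpM2l ?covering_number_ge0.
Qed.

End consistency.

(** * Bounds on the initial data *)

Section initial_data.
Context {R : realType} {n : nat}.
Local Notation mu := (lebesgue_rV R n).
Local Notation torus := (torus_measure R n).

Lemma near_right01 : \forall eps \near (0 : R)^'+, 0 < eps <= 1.
Proof.
near=> eps; apply/andP; split; near: eps; [exact: nbhs_right_gt|exact: nbhs_right_le].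
Unshelve. all: by end_near. Qed.

Lemma near_norm_lt1 (F : R -> \bar R) : F eps @[eps --> (0 : R)^'+] --> 0%E ->
  \forall eps \near (0 : R)^'+, (F eps < 1)%E.
Proof. move=> Fc; apply: (Fc [set x | (x < 1)%E]); apply: open_nbhs_nbhs; split; last exact: lte01.
exact: open_ereal_lt_ereal. Qed.

Lemma mass_bound (f : 'rV[R]_n -> R) (fe : R -> 'rV[R]_n -> R) :
  f \in Lfun torus 1%:E ->
  (forall eps : R, 0 < eps <= 1 -> continuous_torus (fe eps)) ->
  ('N[torus]_1%:E[EFin \o (f \- fe eps)%R])%E @[eps --> (0 : R)^'+] --> 0%E ->
  exists2 K : R, 0 <= K & \forall eps \near (0 : R)^'+, \int[mu]_(x in cube n) `|fe eps x| <= K.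
Proof.
move=> fL cfe /near_norm_lt1 fcvg.
have mf : measurable_fun setT f := set_mem (sub_Lfun_mfun fL).
have ff : ('N[torus]_1%:E[EFin \o f] < +oo)%E := set_mem (sub_Lfun_finLfun fL).
rewrite Lnorm1 in ff; have f0 : (0 <= \int[torus]_x `|(EFin \o f) x|)%E by exact: integral_ge0.
exists (fine (\int[torus]_x `|(EFin \o f) x|)%E + 1); first by rewrite addr_ge0// fine_ge0.
near=> eps.
have e01 : 0 < eps <= 1 by near: eps; exact: near_right01.
have cf := cfe eps e01; have mfe := continuous_torus_measurable cf.
have : ('N[torus]_1%:E[EFin \o (f \- fe eps)%R] < 1)%E by near: eps; exact: fcvg.
rewrite Lnorm1 => f1.
have mB : measurable_fun setT (f \- fe eps) by exact: measurable_funB.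
have mE (g : 'rV[R]_n -> R) : measurable_fun setT g -> measurable_fun setT (fun x : 'rV[R]_n => (`|(EFin \o g) x|)%E).
  by move=> mg; apply: measurableT_comp => //; exact/measurable_EFinP.
rewrite -torus_Rintegral; last by apply: measurableT_comp.
rewrite -lee_fin EFinD [X in (_ <= X + _)%E]fineK ?ge0_fin_numE//.
apply: (@le_trans _ _ (\int[torus]_x `|(EFin \o fe eps) x|)%E).
  have fine_le (z : \bar R) : (0 <= z)%E -> ((fine z)%:E <= z)%E by case: z.
  by apply: fine_le; exact: integral_ge0.
have i1 : (\int[torus]_x (`|(EFin \o f) x| + `|(EFin \o (f \- fe eps)%R) x|) =
    \int[torus]_x `|(EFin \o f) x| + \int[torus]_x `|(EFin \o (f \- fe eps)%R) x|)%E.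
  by apply: ge0_integralD => //; exact: mE.
apply: (@le_trans _ _ (\int[torus]_x (`|(EFin \o f) x| + `|(EFin \o (f \- fe eps)%R) x|))%E).
  apply: ge0_le_integral => //; first exact: mE.
  - by apply: emeasurable_funD; exact: mE.
  - move=> x _; rewrite /= -EFinD lee_fin.
    have := ler_normB (f x) (f x - fe eps x); by rewrite subKr.
by rewrite i1 leeD2l// ltW.
Unshelve. all: by end_near. Qed.

Lemma measurable_half_open_box (a b : 'I_n -> R) :
  measurable [set x : 'rV[R]_n | forall i, x ord0 i \in `[a i, b i[].
Proof.
by apply: (measurable_rV_box (A := fun i => [set` `[a i, b i[])) => i; exact: measurable_itv.
Qed.

Lemma half_open_box_gt0 (a b : 'I_n -> R) : (forall i, a i < b i) ->
  (0 < mu [set x : 'rV[R]_n | forall i, x ord0 i \in `[a i, b i[])%E.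
Proof.
move=> ab.
have := lebesgue_rV_box (R := R) (A := fun i => [set` `[a i, b i[]) (fun i => measurable_itv _).
rewrite /= => ->; elim/big_ind : _ => //; first by move=> x y; exact: mule_gt0.
by move=> i _; rewrite lebesgue_measure_itv/= lte_fin ab -EFinB lte_fin subr_gt0.
Qed.

Lemma torus_measure_gt0 : (0 < torus setT)%E.
Proof.
rewrite /torus_measure /mrestr setTI.
by apply: half_open_box_gt0 => i; have := pi_gt0 R; lra.
Qed.

(** If a continuous function exceeds the bound at some point of the half-open
    cube, then it does so on a small half-open box inside the cube that has this
    point as its lower corner, and such a box has positive measure. *)
Lemma ae_torus_bound (f : 'rV[R]_n -> R) (K : R) : continuous_torus f ->
  {ae torus, forall x, `|f x| <= K} -> forall x, `|f x| <= K.
Proof.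
move=> cf [N [mN N0 NK]] x0; rewrite leNgt; apply/negP => Kx.
pose x1 := torus_repr x0.
have fx1 : f x1 = f x0 by apply: periodic_torus_repr; exact: cf.2.
have [d d0 fd] : exists2 d : R, 0 < d & forall y : 'rV[R]_n, (forall i, `|y ord0 i - x1 ord0 i| < d) -> K < `|f y|.
  have e0 : 0 < `|f x1| - K by rewrite subr_gt0 fx1.
  have [d d0 fd] := continuous_ball x1 cf.1 e0; have d2 : 0 < d / 2 by rewrite divr_gt0.
  exists (d / 2) => // y yd.
  have xy : `|x1 - y| < d.
    apply: (@le_lt_trans _ _ (d / 2)); last by lra.
    apply/(rV_norm_le _ (ltW d2))/rboxP => i.
    by have := yd i; rewrite distrC => /ltW; rewrite /x1 !mxE.
  have := fd y xy; have := ler_norm (f x1 - f y); have := lerB_dist (f x1) (f y); lra.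
have x1c := torus_repr_cube x0 : cube n x1.
pose A := [set x : 'rV[R]_n | forall i, x ord0 i \in `[x1 ord0 i, Num.min pi (x1 ord0 i + d)[].
have AN : A `<=` N `&` cube n.
  move=> y Ay; split.
    apply: NK => /=; apply/negP; rewrite -ltNge; apply: fd => i.
    have := Ay i; rewrite in_itv/= lt_min => /andP[h1 /andP[h2 h3]].
    by rewrite ger0_norm ?subr_ge0// ltrBlDl.
  move=> i; have := Ay i; have := x1c i; rewrite !in_itv/= lt_min.
  by move=> /andP[h1 h2] /andP[h3 /andP[h4 h5]]; rewrite h4 (le_trans h1).
have : (0 < mu A)%E.
  apply: half_open_box_gt0 => i; have := x1c i; rewrite in_itv/= => /andP[h1 h2].
  by rewrite lt_min h2 ltrDl.
rewrite ltNge => /negP; apply; rewrite -N0; apply: le_measure => //.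
- by rewrite inE; exact: measurable_half_open_box.
- by rewrite inE; apply: measurableI => //; exact: measurable_cubeT.
Qed.

Lemma velocity_bound (f : 'rV[R]_n -> R) (fe : R -> 'rV[R]_n -> R) :
  f \in Lfun torus +oo%E ->
  (forall eps : R, 0 < eps <= 1 -> continuous_torus (fe eps)) ->
  ('N[torus]_+oo[EFin \o (f \- fe eps)%R])%E @[eps --> (0 : R)^'+] --> 0%E ->
  exists2 K : R, 0 <= K & \forall eps \near (0 : R)^'+, forall x, `|fe eps x| <= K.
Proof.
move=> fL cfe /near_norm_lt1 fcvg.
have ff : ('N[torus]_+oo[EFin \o f] < +oo)%E := set_mem (sub_Lfun_finLfun fL).
have tp := torus_measure_gt0.
rewrite unlock /Lnorm tp in ff.
exists (`|fine (ess_sup torus (abse \o (EFin \o f)))| + 1); first by rewrite addr_ge0.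
near=> eps; apply: ae_torus_bound.
  by apply: cfe; near: eps; exact: near_right01.
have : ('N[torus]_+oo[EFin \o (f \- fe eps)%R] < 1)%E by near: eps; exact: fcvg.
rewrite unlock /Lnorm tp => f1.
have a1 := ess_sup_ge torus (abse \o (EFin \o f)).
have a2 := ess_sup_ge torus (abse \o (EFin \o (f \- fe eps))).
apply: filterS2 a1 a2 => x /= h1 h2.
have h3 : `|f x| <= `|fine (ess_sup torus (abse \o (EFin \o f)))|.
  move: h1 ff; case: (ess_sup _ _) => [a| |]//=.
  by rewrite lee_fin => h _; exact: le_trans h (ler_norm _).
have h4 : `|f x - fe eps x| <= 1 by rewrite -lee_fin (le_trans h2)// ltW.
have := ler_normB (f x) (f x - fe eps x); rewrite subKr => /le_trans; apply.
exact: lerD.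
Unshelve. all: by end_near. Qed.

End initial_data.

(** * The weak asymptotic method *)

Lemma powR_squeeze {R : realType} (f : R -> R) (A b : R) : 0 < b ->
  (\forall eps \near (0 : R)^'+, `|f eps| <= A * eps `^ b) -> f eps @[eps --> (0 : R)^'+] --> (0 : R).
Proof.
move=> b0 fA.
have c : A * eps `^ b @[eps --> (0 : R)^'+] --> (0 : R).
  by rewrite -[X in _ --> X](mulr0 A); apply: cvgM; [exact: cvg_cst|exact: powR_cvg0].
apply/norm_cvg0P; apply: (squeeze_cvgr _ (cvg_cst 0) c).
by apply: filterS fA => eps ->; rewrite normr_ge0.
Qed.

(** Both errors of the scheme are bounded by the same power of eps, namely that
    of the larger one. *)
Lemma scheme_error_powR {R : realType} (eps a V0 V : R) : 0 < eps <= 1 -> 0 <= a -> 0 <= V ->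
  V <= V0 * eps `^ (- a) ->
  eps * V <= V0 * eps `^ (1 - 2 * a) /\ eps * (V * V) <= V0 * V0 * eps `^ (1 - 2 * a).
Proof.
move=> eps01 a0 Vge Vle; have /andP[e0 e1] := eps01.
have ea : 0 < eps `^ (- a) by exact: powR_gt0.
have ea1 : 1 <= eps `^ (- a).
  by rewrite -[leLHS](powRr0 eps); apply: ger_powR => //; rewrite oppr_le0.
have V00 : 0 <= V0 by rewrite -(pmulr_lge0 _ ea) (le_trans Vge).
have E : eps `^ (1 - 2 * a) = eps * (eps `^ (- a) * eps `^ (- a)).
  have imp (r s : R) : (r + s == 0) ==> (eps != 0) by apply/implyP => _; rewrite gt_eqF.
  rewrite -powRD// -[X in _ = X * _](powRr1 (ltW e0)) -powRD//; congr (_ `^ _); ring.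
rewrite E; move: ea ea1 Vle; move: (eps `^ (- a)) => q q0 q1 Vq; split.
  rewrite mulrCA ler_wpM2l ?(ltW e0)// (le_trans Vq)// ler_wpM2l//.
  by rewrite ler_peMr// ltW.
rewrite (_ : V0 * V0 * _ = eps * ((V0 * q) * (V0 * q))); last by ring.
by rewrite ler_wpM2l ?(ltW e0)// ler_pM.
Qed.

Theorem theorem4 (R : realType) (n : nat) (n23 : n = 2%N \/ n = 3%N)
  (G : R) (G_gt0 : 0 < G)
  (rho0 : 'rV[R]_n -> R) (u0 : 'I_n -> 'rV[R]_n -> R)
  (rho0_periodic : periodic_2pi rho0)
  (rho0_L1 : rho0 \in Lfun (torus_measure R n) 1%:E)
  (rho0_ge0 : {ae torus_measure R n, forall x, 0 <= rho0 x})
  (u0_periodic : forall j, periodic_2pi (u0 j))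
  (u0_Loo : forall j, u0 j \in Lfun (torus_measure R n) +oo%E)
  (rho0e : R -> 'rV[R]_n -> R) (u0e : R -> 'I_n -> 'rV[R]_n -> R)
  (rho0e_continuous : forall eps : R, 0 < eps <= 1 -> continuous_torus (rho0e eps))
  (u0e_continuous : forall (eps : R) j, 0 < eps <= 1 -> continuous_torus (u0e eps j))
  (rho0e_gt0 : forall (eps : R) x, 0 < eps <= 1 -> 0 < rho0e eps x)
  (rho0e_cvg :
    ('N[torus_measure R n]_1%:E[EFin \o (rho0 \- rho0e eps)%R])%E
      @[eps --> (0 : R)^'+] --> 0%E)
  (u0e_cvg : forall j,
    ('N[torus_measure R n]_+oo[EFin \o (u0 j \- u0e eps j)%R])%E
      @[eps --> (0 : R)^'+] --> 0%E)
  (phi : 'rV[R]_n -> R)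
  (phi_test : test_function phi)
  (phi_ge0 : forall x, 0 <= phi x)
  (phi_int1 : \int[lebesgue_rV R n]_x phi x = 1) :
  exists2 alpha0 : R, 0 < alpha0 <= 1 &
  forall alpha : R, 0 < alpha < alpha0 ->
  exists (rho drho : R -> R -> 'rV[R]_n -> R)
         (m dm : R -> R -> 'I_n -> 'rV[R]_n -> R),
    (forall eps : R, 0 < eps <= 1 ->
      is_solution G alpha phi eps (rho0e eps) (u0e eps)
        (rho eps) (drho eps) (m eps) (dm eps)) /\
    forall (psi : 'rV[R]_n -> R) (t : R) (j : 'I_n),
      test_function psi -> 0 <= t ->
      let u (eps : R) := velocity (rho eps t) (m eps t) in
      let Phi (eps : R) := potential G alpha phi eps (rho eps t) in
      [/\ (\int[lebesgue_rV R n]_x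
             (drho eps t x * psi x
              - rho eps t x
                * \sum_(k < n) u eps k x * 'D_(basis_rV k) psi x))
            @[eps --> (0 : R)^'+] --> (0 : R),
          (\int[lebesgue_rV R n]_x
             (dm eps t j x * psi x
              - m eps t j x
                * (\sum_(k < n) u eps k x * 'D_(basis_rV k) psi x)
              + rho eps t x * 'D_(basis_rV j) (Phi eps) x * psi x))
            @[eps --> (0 : R)^'+] --> (0 : R) &
          (\int[lebesgue_rV R n]_x
             ((poisson_rhs G alpha phi eps (rho eps t) x
               - 4 * pi * G * rho eps t x) * psi x))
            @[eps --> (0 : R)^'+] --> (0 : R)].
Proof.
have n2 : (2 <= n)%N by case: n23 => ->.
have n4 : n.+1%:R <= 4 :> R by rewrite (ler_nat R n.+1 4); case: n23 => ->.
have G0 := ltW G_gt0.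
have [B [M c2phi]] := test_function_c2 phi_test.
have [K K0 massK] := mass_bound rho0_L1 rho0e_continuous rho0e_cvg.
have [U U0 velU] : exists2 U : R, 0 <= U & \forall eps \near (0 : R)^'+, forall j x, `|u0e eps j x| <= U.
  have H j := velocity_bound (u0_Loo j) (fun eps => u0e_continuous eps j) (u0e_cvg j).
  pose U j := sval (cid2 (H j)).
  have U0 j : 0 <= U j by rewrite /U; case: cid2.
  exists (\sum_j U j); first exact: sumr_ge0.
  apply: filter_forall => j; have : \forall eps \near (0 : R)^'+, forall x, `|u0e eps j x| <= U j.
    by rewrite /U; case: cid2.
  apply: filterS => eps H1 x; apply: (le_trans (H1 x)).
  by rewrite (bigD1 j)//= lerDl sumr_ge0.
(* As n + 1 <= 4, this is the condition 2 (n + 1) alpha < 1. *)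
exists (1 / 8); first by lra.
move=> alpha /andP[alpha_gt0 alpha_lt].
have alpha0 := ltW alpha_gt0.
pose a : R := n.+1%:R * alpha.
have a0 : 0 <= a by exact: mulr_ge0.
have b0 : 0 < 1 - 2 * a.
  have : a <= 4 * alpha by rewrite ler_wpM2r.
  by lra.
pose mass eps := \int[lebesgue_rV R n]_(x in cube n) rho0e eps x.
pose C : R := @acceleration_constant R n B M G.
have C0 : 0 <= C := acceleration_constant_ge0 c2phi G0.
pose V eps t := U + C * eps `^ (- a) * mass eps * t.
(* The bound U holds only for small eps; for the others any bound will do, as
   their velocities do not matter in the limit. *)
have sol eps : exists s : (R -> 'rV[R]_n -> R) * (R -> 'rV[R]_n -> R) *
    (R -> 'I_n -> 'rV[R]_n -> R) * (R -> 'I_n -> 'rV[R]_n -> R),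
    0 < eps <= 1 ->
    [/\ is_solution G alpha phi eps (rho0e eps) (u0e eps) s.1.1.1 s.1.1.2 s.1.2 s.2,
        forall t : R, 0 <= t -> \int[lebesgue_rV R n]_(x in cube n) s.1.1.1 t x = mass eps &
        (forall j x, `|u0e eps j x| <= U) ->
        forall (t : R) j x, 0 <= t -> `|s.1.2 t j x| <= V eps t * s.1.1.1 t x].
  have [e01|ne] := pselect (0 < eps <= 1); last by exists (fun _ _ => 0, fun _ _ => 0, fun _ _ _ => 0, fun _ _ _ => 0).
  have c1 := rho0e_continuous eps e01; have c2 j := u0e_continuous eps j e01.
  have p1 x := rho0e_gt0 eps x e01.
  have [uU|nU] := pselect (forall j x, `|u0e eps j x| <= U).
    have [rho [drho [m [dm [s1 s2 s3]]]]] := exists_solution n2 c2phi G0 alpha0 e01 c1 c2 p1 U0 uU.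
    by exists (rho, drho, m, dm).
  have [U' U'0 uU'] : exists2 U' : R, 0 <= U' & forall j x, `|u0e eps j x| <= U'.
    apply: (finite_uniform_bound (P := fun j K => forall x, `|u0e eps j x| <= K)).
      by move=> j K1 K2 h h12 x; exact: le_trans (h x) h12.
    by move=> j; exact: periodic_bounded (c2 j).
  have [rho [drho [m [dm [s1 s2 s3]]]]] := exists_solution n2 c2phi G0 alpha0 e01 c1 c2 p1 U'0 uU'.
  by exists (rho, drho, m, dm).
have [s sP] := choice sol.
exists (fun eps => (s eps).1.1.1), (fun eps => (s eps).1.1.2), (fun eps => (s eps).1.2), (fun eps => (s eps).2).
split; first by move=> eps e01; have [] := sP eps e01.
move=> psi t j psi_test t0 /=.
have [B' [M' c2psi]] := test_function_c2 psi_test.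
pose V0 : R := U + C * K * t.
have near_eps : \forall eps \near (0 : R)^'+, [/\ 0 < eps <= 1, mass eps <= K, 0 <= V eps t,
    V eps t <= V0 * eps `^ (- a) & forall j x, `|(s eps).1.2 t j x| <= V eps t * (s eps).1.1.1 t x].
  near=> eps.
  have e01 : 0 < eps <= 1 by near: eps; exact: near_right01.
  have mK : mass eps <= K.
    have : \int[lebesgue_rV R n]_(x in cube n) `|rho0e eps x| <= K by near: eps; exact: massK.
    by rewrite (eq_Rintegral_in (g := rho0e eps))// => x _; rewrite gtr0_norm// rho0e_gt0.
  have uU : forall j x, `|u0e eps j x| <= U by near: eps; exact: velU.
  have m0 : 0 <= mass eps by apply: Rintegral_ge0 => x _; rewrite ltW// rho0e_gt0.
  have ea : 0 <= eps `^ (- a) by exact: powR_ge0.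
  have ea1 : 1 <= eps `^ (- a).
    by rewrite -[leLHS](powRr0 eps); apply: ger_powR => //; rewrite oppr_le0.
  split=> //.
  - by apply: addr_ge0 => //; apply: mulr_ge0 => //; apply: mulr_ge0 => //; exact: mulr_ge0.
  - rewrite /V /V0 mulrDl lerD//; first exact: ler_peMr.
    rewrite (_ : C * K * t * _ = C * eps `^ (- a) * K * t); last by ring.
    by rewrite ler_wpM2r// ler_wpM2l// mulr_ge0.
  - by move=> k x; have [_ _ ->] := sP eps e01.
have M'0 : 0 <= M' := le_trans (normr_ge0 _) (c2_bound c2psi 0).
pose c : R := n%:R * (M' * (@covering_number R n (B' + 1) * K)).
have c0 : 0 <= c by rewrite /c !mulr_ge0// covering_number_ge0.
split.
- apply: (@powR_squeeze _ _ (c * V0) _ b0).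
  apply: filterS near_eps => eps [e01 mK V0' Vle mV].
  have [sl ms _] := sP eps e01; rewrite -(ms t t0) in mK.
  have := density_weak_error e01 sl t0 V0' mV mK c2psi => /le_trans; apply.
  have [h _] := scheme_error_powR e01 a0 V0' Vle.
  by rewrite -/c -[leRHS]mulrA ler_wpM2l.
- apply: (@powR_squeeze _ _ (c * (V0 * V0)) _ b0).
  apply: filterS near_eps => eps [e01 mK V0' Vle mV].
  have [sl ms _] := sP eps e01; rewrite -(ms t t0) in mK.
  have := momentum_weak_error e01 sl t0 V0' mV mK c2psi j => /le_trans; apply.
  have [_ h] := scheme_error_powR e01 a0 V0' Vle.
  by rewrite -/c -[leRHS]mulrA ler_wpM2l.
- apply: (@powR_squeeze _ _ (4 * pi * G * (n%:R * (M' * B) * (@covering_number R n (B' + B) * K))) _ alpha_gt0).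
  apply: filterS near_eps => eps [e01 mK _ _ _].
  have [sl ms _] := sP eps e01; rewrite -(ms t t0) in mK.
  exact: (poisson_weak_error c2phi phi_ge0 phi_int1 G0 alpha0 e01 sl t0 mK c2psi).
Unshelve. all: by end_near. Qed.
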